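(* Let $n\ge 2$ be an integer. Then $$sat(K_4^n, C_4) = 5n-1 .$$ Moreover, $Sat(K_4^n, C_4)=\mathcal{F}^n$, where $\mathcal{F}^n=\mathcal{F}_1^n\cup\mathcal{F}_2^n\cup\mathcal{F}_3^n\cup\mathcal{F}_4^n$ (graphs being considered up to isomorphism).
   Context: All graphs are finite, simple and undirected. $K_4^n$ is the complete $4$-partite graph with $n$ vertices in each part. $C_4$ is the cycle on 4 vertices and $K_3$ the triangle. $N(u)$ is the neighbourhood of $u$, $d(u)=|N(u)|$, $e(H)$ is the number of edges of $H$, $G[A]$ is the subgraph of $G$ induced by $A$, and $[m]=\{1,\dots,m\}$. Saying that $G[A]$ is a perfect matching means that $G[A]$ is a 1-regular graph. Given graphs $G$ and $F$, a (spanning) subgraph $H$ of $G$ is $F$-saturated relative to $G$ if $H$ contains no copy of $F$, but the addition of any edge of $E(G)\setminus E(H)$ to $H$ creates a copy of $F$. Put $sat(G,F)=\min\{e(H): H \text{ is } F\text{-saturated relative to } G\}$ and $Sat(G,F)=\{H : H \text{ is } F\text{-saturated relative to } G \text{ and } e(H)=sat(G,F)\}$. Each $\mathcal{F}_i^n$, $i\in[4]$, is the family of quadripartite graphs $G=V_1\cup V_2\cup V_3\cup V_4$ with $n$ vertices in each part (the parts $V_j$ being independent sets) such that the following properties hold: $G\in\mathcal{F}_1^n$ if: (i) there exists $X^*=\{y_1,y_2,y_3\}\subseteq V_2\cup V_3\cup V_4$ such that $G[X^*]=K_3$; (ii) there exist $\emptyset\neq I_i\subseteq V_i$ for $i\in[3]$,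 with $|I_1|+|I_2|+|I_3|=2n-1$, such that for any $x_i\in I_i$, $N(x_i)=\{y_i\}$; (iii) for any $u\in V^*:=\left(\bigcup_{i=1}^4V_i\right)\setminus\left(\bigcup_{i=1}^3 I_i\cup X^*\right)$, $d(u)=2$ with $|N(u)\cap X^*|=1$ and $|N(u)\cap V^*|=1$; moreover, $G[V^*]$ is a perfect matching such that for any $uv\in E(G[V^*])$, either $u\in V_4$ or $v\in V_4$, and $\emptyset\neq N(u)\cap N(v)\subseteq X^*$. $G\in\mathcal{F}_2^n$ if: (i) there exists $y^*\in V_2$ such that $N(y^* )=V_1\cup V_3\cup V_4$, and $G[V_3\cup V_4]$ is a perfect matching; (ii) for any $u\in V_2\setminus\{y^*\}$, $d(u)=1$, where $N(u)\subseteq V_1\cup V_3\cup V_4$. $G\in\mathcal{F}_3^n$ if: (i) there exist $y^*\in V_2$ and $\{z^*,w^*\}\subseteq V_3\cup V_4$ such that for any $u\in V_2\setminus\{y^*\}$, $N(u)=\{z^*\}$, and $G[\{y^*,z^*,w^*\}]=K_3$; (ii) $V_3\cup V_4\subseteq N(y^* )$ and $G[V_3\cup V_4]$ is a perfect matching; (iii) for any $u\in V_1$, $d(u)=1$ and $N(u)\subseteq\{y^*,w^*\}$. $G\in\mathcal{F}_4^n$ if: (i) there exist $x^*\in V_1$ and $y^*\in V_2$ such that $V_2\subseteq N(x^* )$ and $V_1\subseteq N(y^* )$; (ii) $G[V_3\cup V_4]$ is a perfect matching, and for any $v\in V_i$ with $i\in\{3,4\}$, $N(v)=\{y^*,v'\}$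 for some $v'\in V_{7-i}$ or $N(v)=\{x^*,v'\}$ for some $v'\in V_{7-i}$.
   Formalization: In F_2 no edge joins V_1 to V_3∪V_4; in F_4 matched vertices of V_3∪V_4 share a neighbour and each V_1–V_2 edge contains x* or y* (otherwise these families contain graphs with a C_4). Isomorphism means an automorphism of K_4^n. *)

(* Defs.v *)
From mathcomp Require Import all_boot.
From mathcomp Require Import perm.

Set Implicit Arguments.
Unset Strict Implicit.
Unset Printing Implicit Defensive.

(* A graph on the vertex type T is given by its edge set. It is simple when
   every edge has two elements; a subset of the edge set of a simple graph is
   again simple, so spanning subgraphs of a simple graph need no side
   condition. *)
Definition graph (T : finType) := {set {set T}}.

Section Graphs.

Variable T : finType.
Implicit Types (G H K : graph T) (A : {set T}) (u v : T).

Definition simple G := [forall e in G, #|e| == 2].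

(* For simple G this forces u != v, as [set u; u] is a singleton. *)
Definition adj G u v := [set u; v] \in G.

Definition nbhd G u : {set T} := [set v | adj G u v].

Definition deg G u := #|nbhd G u|.

Definition induced G A : graph T := [set e in G | e \subset A].

Definition one_regular_on G A :=
  [forall u in A, deg (induced G A) u == 1].

Definition triangle_on G A :=
  (#|A| == 3) &&
  [forall u in A, forall v in A, (u != v) ==> adj (induced G A) u v].

(* Not necessarily induced. *)
Definition has_copy (S : finType) (F : graph S) H :=
  [exists f : {ffun S -> T}, injectiveb f && [forall e in F, f @: e \in H]].

Definition saturated (S : finType) G (F : graph S) H :=
  [&& H \subset G, ~~ has_copy F H & [forall e in G :\: H, has_copy F (e |: H)]].

(* The unit #|G| of the iterated minimum is an upper bound for the edge count
   of every subgraph of G, so it does not affect the minimum as soon as there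
   is a saturated subgraph. *)
Definition sat (S : finType) G (F : graph S) :=
  \big[minn/#|G|]_(H : graph T | saturated G F H) #|H|.

Definition Sat (S : finType) G (F : graph S) : {set graph T} :=
  [set H | saturated G F H && (#|H| == sat G F)].

Definition relabel (s : {perm T}) G : graph T := [set s @: (e : {set T}) | e in G].

(* Isomorphism of subgraphs of a host graph K: an automorphism of K that
   carries H to H'. *)
Definition iso_in K H H' :=
  exists2 s : {perm T}, relabel s K = K & relabel s H = H'.

Lemma simple_sub G H : H \subset G -> simple G -> simple H.
Proof.
move=> /subsetP sHG /forall_inP simG; apply/forall_inP => e eH.
exact: simG (sHG e eH).
Qed.

Lemma sat_le (S : finType) G (F : graph S) H :
  saturated G F H -> sat G F <= #|H|.
Proof.
rewrite /sat -big_filter => satH.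
have: H \in [seq K <- index_enum (graph T) | saturated G F K].
  by rewrite mem_filter satH mem_index_enum.
elim: [seq _ <- _ | _] => // K s IHs; rewrite inE big_cons geq_min.
by case/predU1P => [<-|/IHs ->]; rewrite ?leqnn ?orbT.
Qed.

Lemma sat_attained (S : finType) G (F : graph S) H :
  saturated G F H -> exists2 K, saturated G F K & #|K| = sat G F.
Proof.
move=> satH; pose K := [arg min_(K < H | saturated G F K) #|K|].
have [satK minK]: saturated G F K /\ forall L, saturated G F L -> #|K| <= #|L|.
  by rewrite /K; case: arg_minnP.
exists K => //; apply/eqP; rewrite eqn_leq (sat_le satK) andbT /sat.
elim/big_ind: _ => [|a b Ka Kb|L /minK //].
  by apply: subset_leq_card; case/and3P: satK.
by rewrite leq_min Ka.
Qed.

End Graphs.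

Definition C4 : graph 'I_4 := [set [set i; ordS i] | i : 'I_4].

Lemma simple_C4 : simple C4.
Proof.
apply/forall_inP => _ /imsetP[i _ ->]; rewrite cards2 eqSS eqb1.
by case: i => [[|[|[|[|]]]]].
Qed.

Notation vertex n := ('I_4 * 'I_n)%type.

Section Families.

Variable n : nat.
Local Notation vertex := (vertex n).

Definition K4 : graph vertex :=
  [set [set p.1; p.2] | p : vertex * vertex & p.1.1 != p.2.1].

Lemma simple_K4 : simple K4.
Proof.
apply/forall_inP => _ /imsetP[p p12 ->]; rewrite inE in p12.
by rewrite cards2 eqSS eqb1; apply: contra p12 => /eqP ->.
Qed.

Lemma adj_K4 (u v : vertex) : adj K4 u v = (u.1 != v.1).
Proof.
apply/imsetP/idP => [[[a b]]|uv]; last by exists (u, v); rewrite ?inE.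
rewrite inE /= => ab /setP uv_ab.
have: (u == a) || (u == b) by have := uv_ab u; rewrite !inE eqxx.
have: (v == a) || (v == b) by have := uv_ab v; rewrite !inE eqxx orbT.
have: (a == u) || (a == v) by have := uv_ab a; rewrite !inE eqxx.
have: (b == u) || (b == v) by have := uv_ab b; rewrite !inE eqxx orbT.
case/orP=> /eqP eb /orP[] /eqP ea /orP[] /eqP ev /orP[] /eqP eu;
  by move: ab; subst => //; rewrite ?eqxx // eq_sym.
Qed.

(* The parts are numbered from 1: they are V 1, V 2, V 3 and V 4. *)
Definition V (k : nat) : {set vertex} := [set u : vertex | (u.1 : nat).+1 == k].

Implicit Type G : graph vertex.

(* A graph whose parts V 1, ..., V 4 are independent sets is a subgraph of K4. *)
Definition quadripartite G := G \subset K4.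

Definition family1 G :=
  quadripartite G /\
  exists (y : 'I_3 -> vertex) (I : 'I_3 -> {set vertex}),
  let X := [set y i | i : 'I_3] in
  let W := ~: (\bigcup_i I i :|: X) in
  [/\ X \subset V 2 :|: V 3 :|: V 4 /\ triangle_on G X,
      [/\ forall i : 'I_3, I i != set0 /\ I i \subset V i.+1,
          \sum_i #|I i| = 2 * n - 1
        & forall (i : 'I_3) (x : vertex), x \in I i -> nbhd G x = [set y i]],
      forall u, u \in W ->
        [/\ deg G u = 2, #|nbhd G u :&: X| = 1 & #|nbhd G u :&: W| = 1],
      one_regular_on G W
    & forall u v, u \in W -> v \in W -> adj G u v ->
        [/\ u \in V 4 \/ v \in V 4,
            nbhd G u :&: nbhd G v != set0
          & nbhd G u :&: nbhd G v \subset X]].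

(* The last clause says that the edges named by the other clauses are all the
   edges of G. Without it, an edge between u in V 1 and v in V 3 :|: V 4 would
   be allowed, and would close a 4-cycle u, v, v', y with v' matched to v. *)
Definition family2 G :=
  quadripartite G /\
  exists2 y, y \in V 2 &
  [/\ nbhd G y = V 1 :|: V 3 :|: V 4,
      one_regular_on G (V 3 :|: V 4),
      forall u, u \in V 2 :\ y ->
        deg G u = 1 /\ nbhd G u \subset V 1 :|: V 3 :|: V 4
    & forall u v, u \in V 1 -> v \in V 3 :|: V 4 -> ~~ adj G u v].

Definition family3 G :=
  quadripartite G /\
  exists y z w,
  [/\ y \in V 2 /\ [set z; w] \subset V 3 :|: V 4,
      forall u, u \in V 2 :\ y -> nbhd G u = [set z],
      triangle_on G [set y; z; w],
      V 3 :|: V 4 \subset nbhd G y /\ one_regular_on G (V 3 :|: V 4)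
    & forall u, u \in V 1 -> deg G u = 1 /\ nbhd G u \subset [set y; w]].

(* The last two clauses say that matched vertices of V 3 :|: V 4 hang on the
   same vertex (x or y), and that the edges named by the other clauses are all
   the edges between V 1 and V 2. Without the first, a matched pair v, v' with
   v adjacent to y and v' adjacent to x would close a 4-cycle v, v', x, y;
   without the second, an edge u w with u in V 1 :\ x and w in V 2 :\ y would
   close a 4-cycle u, w, x, y. *)
Definition family4 G :=
  quadripartite G /\
  exists x y,
  [/\ [/\ x \in V 1, y \in V 2, V 2 \subset nbhd G x & V 1 \subset nbhd G y],
      one_regular_on G (V 3 :|: V 4),
      forall i v, i \in [:: 3; 4] -> v \in V i ->
        (exists2 v', v' \in V (7 - i) & nbhd G v = [set y; v']) \/
        (exists2 v', v' \in V (7 - i) & nbhd G v = [set x; v']),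
      forall v v', v \in V 3 :|: V 4 -> v' \in V 3 :|: V 4 -> adj G v v' ->
        nbhd G v :&: nbhd G v' != set0
    & forall u w, u \in V 1 -> w \in V 2 -> adj G u w -> u = x \/ w = y].

Definition extremal G := [\/ family1 G, family2 G, family3 G | family4 G].

End Families.

(* Main.v *)
(* For any level function on the vertices, charge each edge 2 to its end of
   larger level, or 1 to both ends if the levels agree; the charges add up to
   2 #|H|, and the lower bound 10 n - 2 comes from bounding every charge from
   below. The levels are essentially distances from a root chosen by the set of parts that
   contain vertices of degree 1: if x is such a vertex with neighbour y, every
   vertex outside the part of x other than y ends a walk of length 2 from y.
   - Leaves in three parts: their neighbours form a triangle, the root. Equality
     forces family 1. (Four parts are impossible.)
   - Leaves in two parts: the root is the edge joining their neighbours.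
     Equality forces families 2, 3 and 4.
   - Leaves in one part: the root is the neighbour of a leaf; no equality.
   - No leaves: either all degrees are at least 3, or the root is a vertex of
     degree 2 with its neighbours; no equality.
   Conversely, a graph of one of the families is a triangle, an edge or a vertex
   with triangles and trees hanging from it, hence has no 4-cycle, and walks of
   length 3 between nonadjacent vertices are exhibited. *)

Require Import Defs.
From mathcomp Require Import all_boot.
From mathcomp Require Import perm zify.

Set Implicit Arguments.
Unset Strict Implicit.
Unset Printing Implicit Defensive.

(** * Charging the edges of a graph to their ends *)

Section Graphs.

Variable T : finType.
Implicit Types (H : graph T) (a b c d u v : T).

(** The constant in [10 * n - 2] comes from budgets that depend on the part. For a column, one
    vertex from each part, the budgets add up to 10 whenever there are leaves: 1 + 3 + 3 + 3, 2 + 2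
    + 3 + 3 or 2 + 2 + 2 + 4 for leaves in one, two or three parts; the corrections at the roots
    account for the 2. Here 1 stands for a single edge inside a level, 2 for an edge to a lower
    level, 3 for one of each, 4 for two edges down. The charges add up exactly to twice the number
    of edges, so in a graph that meets the bound every charge equals its budget. The families are
    read off from these pointwise equalities. The delicate cases are those where the budgets alone
    allow equality although no graph attains it: leaves in a single part, and no leaves with
    [n = 2]. There the exact charges are used to force a local structure in which some walk of
    length 3 is missing. The edge numbers of the families are only bounded from above; the
    classification of small saturated graphs then returns the exact value. *)

Lemma adjC H u v : adj H u v = adj H v u.
Proof. by rewrite /adj setUC. Qed.

Lemma in_nbhd H u v : (v \in nbhd H u) = adj H u v.
Proof. by rewrite inE. Qed.

Lemma adj_neq H u v : simple H -> adj H u v -> u != v.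
Proof. by move=> /forall_inP simH /simH; rewrite cards2 eqSS eqb1. Qed.

Lemma sum_deg H : simple H -> \sum_u deg H u = 2 * #|H|.
Proof.
move=> simH; have <-: \sum_(e in H) #|e| = 2 * #|H|.
  rewrite mulnC -sum_nat_const; apply: eq_bigr => e eH.
  by apply/eqP; move/forall_inP: simH; apply.
under [RHS]eq_bigr do rewrite -sum1_card.
rewrite (exchange_big_dep predT) //=; apply: eq_bigr => u _.
have inj_u : {in nbhd H u &, injective (fun v => [set u; v])}.
  move=> v w; rewrite !in_nbhd => uv uw /setP/(_ v).
  rewrite !inE eqxx orbT => /esym/orP[/eqP vu|/eqP //].
  by have := adj_neq simH uv; rewrite vu eqxx.
rewrite sum1_card /deg -(card_in_imset inj_u); apply: eq_card => e.
apply/imsetP/andP => [[v uv ->]|[eH ue]].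
  by rewrite in_nbhd in uv; rewrite set21.
have /cards2P[v [w [nvw e_vw]]] : #|e| == 2 by move/forall_inP: simH; apply.
move: ue; rewrite e_vw !inE => /orP[]/eqP ->; [exists w | exists v] => //.
  by rewrite in_nbhd /adj -e_vw.
  by rewrite in_nbhd adjC /adj -e_vw.
by rewrite setUC.
Qed.

(* The charge to v of an edge from v to u. *)
Definition score (l : T -> nat) v u : nat :=
  if l u < l v then 2 else l u == l v.

Lemma score_gt0 l v u : l u <= l v -> 0 < score l v u.
Proof. by rewrite /score leq_eqVlt => /orP[->|->] //; case: ifP. Qed.

Lemma score_lt l v u : l u < l v -> score l v u = 2.
Proof. by rewrite /score => ->. Qed.

Lemma score_eq l v u : l u = l v -> score l v u = 1.
Proof. by rewrite /score => ->; rewrite ltnn eqxx. Qed.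

Definition wt H l v := \sum_(u in nbhd H v) score l v u.

Lemma sum_nbhd_exchange H (f : T -> T -> nat) :
  \sum_v \sum_(u in nbhd H v) f v u = \sum_v \sum_(u in nbhd H v) f u v.
Proof.
rewrite (exchange_big_dep predT) //=; apply: eq_bigr => v _; apply: eq_bigl => u.
by rewrite !in_nbhd adjC.
Qed.

(** The score is [(l u <= l v) + (l u < l v)]. Exchanging the two ends in the second summand turns
    it into [l v < l u]; each neighbour then counts once and the total is the sum of the degrees. *)
Lemma sum_wt H l : simple H -> \sum_v wt H l v = 2 * #|H|.
Proof.
move=> simH; have s_split v u : score l v u = (l u <= l v) + (l u < l v).
  by rewrite /score; case: ltngtP.
rewrite /wt -sum_deg //; under eq_bigr do under eq_bigr do rewrite s_split.
under eq_bigr do rewrite big_split.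
rewrite big_split /= [X in _ + X]sum_nbhd_exchange -big_split /=.
apply: eq_bigr => v _; rewrite /deg -sum1_card -big_split /=.
by apply: eq_bigr => u _; case: ltngtP.
Qed.

Lemma nbhd_sum_ge_seq H v (f : T -> nat) s :
  uniq s -> {subset s <= nbhd H v} -> \sum_(u <- s) f u <= \sum_(u in nbhd H v) f u.
Proof.
move=> us sN; rewrite big_uniq //= [leqRHS](bigID [in s]) /=.
rewrite -[leqLHS]addn0 leq_add //; apply: eq_leq; apply: eq_bigl => u.
by case: (boolP (u \in s)) => [/sN ->|]; rewrite ?andbF.
Qed.

Lemma nbhd_sum_ge1 H v (f : T -> nat) a :
  adj H v a -> f a <= \sum_(u in nbhd H v) f u.
Proof.
move=> va; have := @nbhd_sum_ge_seq H v f [:: a] isT.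
by rewrite big_seq1; apply=> u; rewrite inE in_nbhd => /eqP ->.
Qed.

Lemma nbhd_sum_ge2 H v (f : T -> nat) a b :
  adj H v a -> adj H v b -> a != b -> f a + f b <= \sum_(u in nbhd H v) f u.
Proof.
move=> va vb nab; have := @nbhd_sum_ge_seq H v f [:: a; b].
rewrite !big_cons big_nil addn0 /= inE nab; apply=> // u.
by rewrite !inE => /orP[]/eqP ->.
Qed.

Lemma nbhd_sum_ge3 H v (f : T -> nat) a b c :
    adj H v a -> adj H v b -> adj H v c -> uniq [:: a; b; c] ->
  f a + f b + f c <= \sum_(u in nbhd H v) f u.
Proof.
move=> va vb vc ?; have := @nbhd_sum_ge_seq H v f [:: a; b; c].
rewrite !big_cons big_nil addn0 addnA; apply=> // u.
by rewrite !inE => /or3P[]/eqP ->.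
Qed.

Lemma wt_ge1 H l v a : adj H v a -> score l v a <= wt H l v.
Proof. exact: nbhd_sum_ge1. Qed.

Lemma wt_ge2 H l v a b :
  adj H v a -> adj H v b -> a != b -> score l v a + score l v b <= wt H l v.
Proof. exact: nbhd_sum_ge2. Qed.

Lemma wt_ge3 H l v a b c :
    adj H v a -> adj H v b -> adj H v c -> uniq [:: a; b; c] ->
  score l v a + score l v b + score l v c <= wt H l v.
Proof. exact: nbhd_sum_ge3. Qed.

Lemma wt_geD H l v a b i j :
    adj H v a -> adj H v b -> a != b -> i <= score l v a -> j <= score l v b ->
  i + j <= wt H l v.
Proof.
by move=> va vb nab ia jb; apply: leq_trans (leq_add ia jb) (wt_ge2 l va vb nab).
Qed.

Lemma wt_geD3 H l v a b c i j k :
    adj H v a -> adj H v b -> adj H v c -> uniq [:: a; b; c] ->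
    i <= score l v a -> j <= score l v b -> k <= score l v c ->
  i + j + k <= wt H l v.
Proof.
move=> va vb vc us ia jb kc.
exact: leq_trans (leq_add (leq_add ia jb) kc) (wt_ge3 l va vb vc us).
Qed.

(** How equality is exploited: once the lower bounds [m] add up to at least the total charge, every
    single charge is known. *)
Lemma sum_tight (f m : T -> nat) :
  (forall v, m v <= f v) -> \sum_v f v <= \sum_v m v -> f =1 m.
Proof.
move=> le_mf le_fm v.
have := leqif_sum (fun i _ => leqif_eq (le_mf i)) : leqif _ _ [forall (i | true), m i == f i].
case=> le_s; rewrite eqn_leq le_s le_fm => /esym/forallP/(_ v)/=.
by move/eqP.
Qed.

Definition c4free H := forall a b c d,
  adj H a b -> adj H b c -> adj H c d -> adj H d a -> a = c \/ b = d.

Lemma C4_copyP H :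
  reflect (exists f : 'I_4 -> T, injective f /\ forall i, adj H (f i) (f (ordS i)))
          (has_copy C4 H).
Proof.
apply: (iffP existsP) => [[f /andP[/injectiveP injf /forall_inP fH]]|[f [injf fH]]].
  exists f; split=> // i; rewrite /adj.
  have: [set i; ordS i] \in C4 by apply: imset_f.
  by move/fH; rewrite imsetU1 imset_set1.
exists (finfun f); apply/andP; split.
  by apply/injectiveP => i j; rewrite !ffunE; apply: injf.
apply/forall_inP => _ /imsetP[i _ ->].
by rewrite imsetU1 imset_set1 !ffunE; apply: fH.
Qed.

End Graphs.

(** * Four-cycles and the saturation condition as walks of length 3 *)

Section FourCycles.

Variable T : finType.
Implicit Types (H : graph T) (a b c d u v : T).

Lemma has_copyC4P H : simple H ->
  reflect (exists a b c d, [/\ [/\ adj H a b, adj H b c, adj H c d & adj H d a],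
                               a != c & b != d])
          (has_copy C4 H).
Proof.
move=> simH; apply: (iffP (C4_copyP H)) => [[f [injf fH]]|].
  pose i0 : 'I_4 := ord0; pose i1 := ordS i0; pose i2 := ordS i1.
  exists (f i0), (f i1), (f i2), (f (ordS i2)).
  split; [|by apply/eqP => /injf/(congr1 val) ..].
  split=> //; have <- : ordS (ordS i2) = i0 by apply: val_inj.
  exact: fH.
move=> [a [b [c [d [[ab bc cd da] nac nbd]]]]].
exists (fun i : 'I_4 => nth a [:: a; b; c; d] i); split.
  have us : uniq [:: a; b; c; d].
    rewrite /= !inE !negb_or nac nbd (adj_neq simH ab) (adj_neq simH bc).
    by rewrite (adj_neq simH cd) eq_sym (adj_neq simH da).
  by move=> i j /eqP; rewrite nth_uniq // => /eqP/val_inj.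
by case=> [[|[|[|[|]]]]].
Qed.

Lemma c4freeP H : simple H -> reflect (c4free H) (~~ has_copy C4 H).
Proof.
move=> simH; apply: (iffP idP) => [nH a b c d ab bc cd da|free].
  have [|nac] := eqVneq a c; first by left.
  have [|nbd] := eqVneq b d; first by right.
  by case/has_copyC4P: nH => //; exists a, b, c, d; split.
apply/has_copyC4P => // -[a [b [c [d [[ab bc cd da] nac nbd]]]]].
by case: (free a b c d) => // /eqP; apply/negP.
Qed.

Lemma set2_inj a b u v :
  [set a; b] = [set u; v] -> (a = u /\ b = v) \/ (a = v /\ b = u).
Proof.
move=> e; have /set2P ha : a \in [set u; v] by rewrite -e set21.
have /set2P hb : b \in [set u; v] by rewrite -e set22.
have /set2P hu : u \in [set a; b] by rewrite e set21.
have /set2P hv : v \in [set a; b] by rewrite e set22.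
by case: ha hb hu hv => -> [] -> [] ? [] ?; subst; auto.
Qed.

Lemma adjU1 H u v a b :
  reflect [\/ adj H a b, a = u /\ b = v | a = v /\ b = u]
          (adj ([set u; v] |: H) a b).
Proof.
rewrite /adj in_setU1; apply: (iffP orP) => [[/eqP/set2_inj[]|]|[|[-> ->]|[-> ->]]].
- by constructor 2.
- by constructor 3.
- by constructor 1.
- by right.
- by left.
- by left; rewrite setUC.
Qed.

(** A new 4-cycle passes through the added edge, and the rest of it is a path of length 3.
    Conversely walks suffice: as [u] and [v] are distinct and nonadjacent, a walk of length 3
    between them cannot repeat a vertex. *)
Lemma has_copyC4_add H u v : simple H -> c4free H -> u != v -> ~~ adj H u v ->
  reflect (exists a b, [/\ adj H u a, adj H a b & adj H b v])
          (has_copy C4 ([set u; v] |: H)).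
Proof.
move=> simH free nuv Nuv.
have simH' : simple ([set u; v] |: H).
  apply/forall_inP => e /setU1P[->|]; last by move/forall_inP: simH; apply.
  by rewrite cards2 nuv.
apply: (iffP (has_copyC4P simH')) => [|[a [b [ua ab bv]]]]; last first.
  exists u, a, b, v; split.
  - by split; apply/adjU1; [constructor 1..| constructor 3].
  - by apply: contra Nuv => /eqP->.
  by apply: contra Nuv => /eqP <-.
(* The case where the added edge is the first side of the cycle; the other sides are reached by
   rotating the cycle. *)
have new a b c d :
    adj ([set u; v] |: H) a b -> adj ([set u; v] |: H) b c ->
    adj ([set u; v] |: H) c d -> adj ([set u; v] |: H) d a ->
    a != c -> b != d -> ~~ adj H a b ->
  exists p q, [/\ adj H u p, adj H p q & adj H q v].
  move=> ab bc cd da nac nbd Nab.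
  have nbc := adj_neq simH' bc; have nda := adj_neq simH' da.
  have old p q : adj ([set u; v] |: H) p q ->
      (p != a) && (p != b) || (q != a) && (q != b) -> adj H p q.
    case/adjU1: ab Nab => [->//|[-> ->]|[-> ->]] _;
    by case/adjU1=> // -[-> ->]; rewrite !eqxx ?andbF.
  have {}bc := old _ _ bc; have {}cd := old _ _ cd; have {}da := old _ _ da.
  rewrite ![c == _]eq_sym nac nbc ![d == _]eq_sym nbd [_ == d]eq_sym nda ?orbT /=
    in bc cd da.
  case/adjU1: ab Nab => [->//|[e1 e2]|[e1 e2]] _; move: bc cd da; rewrite e1 e2.
    by exists d, c; split; rewrite adjC ?bc ?cd ?da.
  by exists c, d; split; rewrite ?bc ?cd ?da.
move=> [a [b [c [d [[ab bc cd da] nac nbd]]]]].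
have [ab'|Nab] := boolP (adj H a b); last exact: new ab bc cd da nac nbd Nab.
have [bc'|Nbc] := boolP (adj H b c).
  have [cd'|Ncd] := boolP (adj H c d).
    have [da'|Nda] := boolP (adj H d a).
      by case: (free a b c d) => // /eqP; rewrite ?(negPf nac) ?(negPf nbd).
    by apply: new da ab bc cd _ nac Nda; rewrite eq_sym.
  by apply: new cd da ab bc _ _ Ncd; rewrite eq_sym.
by apply: new bc cd da ab nbd _ Nbc; rewrite eq_sym.
Qed.

End FourCycles.

Definition walk3 n (H : graph (vertex n)) := forall u v, u.1 != v.1 ->
  ~~ adj H u v -> exists a b, [/\ adj H u a, adj H a b & adj H b v].

Lemma saturatedP n (H : graph (vertex n)) :
  saturated (K4 n) C4 H <-> [/\ H \subset K4 n, c4free H & walk3 H].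
Proof.
split=> [/and3P[sHK nC /forall_inP satH]|[sHK free satH]].
  have simH := simple_sub sHK (simple_K4 n).
  have free : c4free H by apply/c4freeP.
  split=> // u v uv Nuv; apply/has_copyC4_add => //.
    by apply: contraNneq uv => ->.
  by apply: satH; rewrite inE [_ \in H](negPf Nuv) -adj_K4 in uv *.
have simH := simple_sub sHK (simple_K4 n).
apply/and3P; split=> //; first exact/c4freeP.
apply/forall_inP => e /setDP[/imsetP[[u v]]]; rewrite inE /= => uv -> Nuv.
apply/has_copyC4_add => //; last exact: satH.
by apply: contraNneq uv => ->.
Qed.

(** * Relabelling of vertices, isomorphism and permutations of the parts *)

Section Relabel.

Variable T : finType.
Implicit Types (s : {perm T}) (H G : graph T).

Lemma mem_relabel s H (e : {set T}) : (s @: e \in relabel s H) = (e \in H).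
Proof. by rewrite /relabel mem_imset //; apply: imset_inj; apply: perm_inj. Qed.

Lemma adj_relabel s H u v : adj (relabel s H) (s u) (s v) = adj H u v.
Proof. by rewrite /adj -[RHS](mem_relabel s) imsetU1 imset_set1. Qed.

Lemma card_relabel s H : #|relabel s H| = #|H|.
Proof. by rewrite /relabel card_imset //; apply: imset_inj; apply: perm_inj. Qed.

Lemma relabelK s H : relabel s^-1 (relabel s H) = H.
Proof.
rewrite /relabel -imset_comp -[RHS]imset_id; apply: eq_imset => e /=.
by rewrite -imset_comp -[RHS]imset_id; apply: eq_imset => x /=; rewrite permK.
Qed.

Lemma relabelM s t H : relabel (s * t) H = relabel t (relabel s H).
Proof.
rewrite /relabel -[RHS]imset_comp; apply: eq_imset => e /=.
by rewrite -imset_comp; apply: eq_imset => x /=; rewrite permM.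
Qed.

Lemma nbhd_relabel s H u : nbhd (relabel s H) (s u) = s @: nbhd H u.
Proof.
apply/setP => v; rewrite in_nbhd -[v](permKV s) adj_relabel mem_imset ?in_nbhd //.
exact: perm_inj.
Qed.

Lemma has_copy_relabel (S : finType) (F : graph S) s H :
  has_copy F H -> has_copy F (relabel s H).
Proof.
case/existsP=> f /andP[/injectiveP injf /forall_inP fH]; apply/existsP.
exists [ffun x => s (f x)]; apply/andP; split.
  by apply/injectiveP=> x y; rewrite !ffunE => /perm_inj/injf.
apply/forall_inP => e /fH; rewrite -(mem_relabel s) -imset_comp.
by have /eq_imset-> : s \o f =1 [ffun x => s (f x)] by move=> x; rewrite ffunE.
Qed.

Lemma saturated_relabel (S : finType) (F : graph S) s G H :
  saturated G F H -> saturated (relabel s G) F (relabel s H).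
Proof.
case/and3P=> sHG nF /forall_inP satH; apply/and3P; split.
- exact: imsetS.
- by apply: contra nF => /(has_copy_relabel s^-1); rewrite relabelK.
apply/forall_inP => _ /setDP[/imsetP[e eG ->]]; rewrite mem_relabel => eNH.
have -> : s @: e |: relabel s H = relabel s (e |: H) by rewrite /relabel imsetU1.
by apply: has_copy_relabel; apply: satH; rewrite inE eNH.
Qed.

Lemma iso_sat (S : finType) (F : graph S) G H H' : iso_in G H H' ->
  saturated G F H' -> saturated G F H /\ #|H| = #|H'|.
Proof.
case=> s sG <- /(saturated_relabel s^-1); rewrite relabelK card_relabel.
by rewrite -[X in relabel _ X]sG relabelK.
Qed.

Lemma iso_trans G H1 H2 H3 : iso_in G H1 H2 -> iso_in G H2 H3 -> iso_in G H1 H3.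
Proof. by case=> s sG <- [t tG <-]; exists (s * t)%g; rewrite relabelM ?sG. Qed.

Lemma iso_refl G H : iso_in G H H.
Proof.
have rel1 K : relabel 1 K = K.
  rewrite /relabel -[RHS]imset_id; apply: eq_imset => e /=.
  by rewrite -[RHS]imset_id; apply: eq_imset => x /=; rewrite perm1.
by exists 1%g.
Qed.

End Relabel.

Section PartPermutation.

Variable n : nat.
Implicit Types (H : graph (vertex n)) (s : {perm 'I_4}).

Definition part_fun s (u : vertex n) : vertex n := (s u.1, u.2).

Lemma part_fun_inj s : injective (part_fun s).
Proof. by case=> [i x] [j y] [/perm_inj -> ->]. Qed.

Definition part_perm s : {perm vertex n} := perm (@part_fun_inj s).

Lemma part_permE s u : part_perm s u = (s u.1, u.2).
Proof. by rewrite permE. Qed.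

Lemma iso_part_perm s H : iso_in (K4 n) H (relabel (part_perm s) H).
Proof.
exists (part_perm s) => //; apply/setP => e; apply/imsetP/imsetP.
  case=> _ /imsetP[[u v] uv ->] ->; exists (part_perm s u, part_perm s v).
    by rewrite !inE /= !part_permE in uv *; rewrite (inj_eq perm_inj).
  by rewrite imsetU1 imset_set1.
case=> [[u v]]; rewrite inE /= => uv ->.
exists [set (part_perm s)^-1%g u; (part_perm s)^-1%g v]; last first.
  by rewrite imsetU1 imset_set1 !permKV.
apply/imsetP; exists ((part_perm s)^-1%g u, (part_perm s)^-1%g v) => //.
rewrite inE /=; apply: contra uv => /eqP e1.
by rewrite -[u](permKV (part_perm s)) -[v](permKV (part_perm s)) !part_permE /= e1.
Qed.

Lemma sat_part_perm s H : saturated (K4 n) C4 H ->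
  saturated (K4 n) C4 (relabel (part_perm s) H).
Proof.
move=> satH; have [t tK <-] := iso_part_perm s H.
by rewrite -[X in saturated X]tK; apply: saturated_relabel.
Qed.

End PartPermutation.

(** Moves the parts with leaves to the front: the position in [s] followed by the remaining indices
    is a permutation. *)
Lemma perm_parts (s : seq 'I_4) : uniq s -> exists t : {perm 'I_4},
  forall i, i \in s -> t i = index i s :> nat.
Proof.
move=> us; pose l := s ++ [seq i <- enum 'I_4 | i \notin s].
have ul : uniq l.
  rewrite cat_uniq us filter_uniq ?enum_uniq // andbT.
  by apply/hasPn => i; rewrite mem_filter => /andP[].
have lT i : i \in l by rewrite mem_cat mem_filter mem_enum andbT orbN.
have sz_l : size l = 4.
  by rewrite -(card_uniqP ul) -[RHS]card_ord; apply: eq_card => i; rewrite lT.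
have idx i : index i l < 4 by rewrite -[ltnRHS]sz_l index_mem.
have inj : injective (fun i => Ordinal (idx i)).
  by move=> i j [] /(congr1 (nth ord0 l)); rewrite !nth_index.
by exists (perm inj) => i si; rewrite permE /= index_cat si.
Qed.

Lemma sum_part n (f : 'I_4 -> nat) : \sum_(v : vertex n) f v.1 = n * \sum_i f i.
Proof.
rewrite -(pair_big predT predT (fun i _ => f i)) /= big_distrr /=.
by apply: eq_bigr => i _; rewrite sum_nat_const card_ord.
Qed.

Lemma part_other n (u : vertex n) : 2 <= n -> exists2 v, v.1 = u.1 & v != u.
Proof.
case: u => i x hn; have /card_gt0P[y] : 0 < #|predC1 x|.
  by rewrite cardC1 card_ord; lia.
by rewrite inE => nyx; exists (i, y); rewrite // xpair_eqE eqxx.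
Qed.

(** * Saturated graphs, and leaves in a single part *)

Section Saturated.

Variables (n : nat) (H : graph (vertex n)).
Hypothesis satH : saturated (K4 n) C4 H.
Implicit Types (a b c u v x y z : vertex n).
Local Notation e := (adj H).

Definition leaf x y := nbhd H x = [set y].

Lemma sat_sub : H \subset K4 n. Proof. by have /saturatedP[] := satH. Qed.

Lemma sat_free : c4free H. Proof. by have /saturatedP[] := satH. Qed.

Lemma sat_walk : walk3 H. Proof. by have /saturatedP[] := satH. Qed.

Lemma simple_sat : simple H. Proof. exact: simple_sub sat_sub (simple_K4 n). Qed.

Lemma adj_part u v : e u v -> u.1 != v.1.
Proof. by rewrite -adj_K4; apply: (subsetP sat_sub). Qed.

Lemma adjxx u : e u u = false.
Proof. by apply/negP => /adj_part; rewrite eqxx. Qed.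

Lemma adj_ne u v : e u v -> u != v.
Proof. by apply: contraTneq => ->; rewrite adjxx. Qed.

Lemma common_nbr a c b d : e a b -> e c b -> e a d -> e c d -> a != c -> b = d.
Proof.
move=> ab cb ad cd nac; have [||||ac|//] := sat_free (a := a) (b := b) (c := c) (d := d) => //.
- by rewrite adjC.
- by rewrite adjC.
by rewrite ac eqxx in nac.
Qed.

Lemma leaf_adj x y : leaf x y -> e x y.
Proof. by rewrite -in_nbhd => ->; rewrite inE. Qed.

Lemma leaf_eq x y v : leaf x y -> e x v -> v = y.
Proof. by move=> xy; rewrite -in_nbhd xy inE => /eqP. Qed.

Lemma leafI x y : e x y -> (forall v, e x v -> v = y) -> leaf x y.
Proof.
move=> xy xE; apply/setP => v; rewrite in_nbhd inE.
by apply/idP/eqP => [/xE|->].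
Qed.

Lemma leaf_walk x y v : leaf x y -> v.1 != x.1 -> v != y ->
  exists2 a, e y a & e a v.
Proof.
move=> xy vx vy; have Nxv : ~~ e x v by apply: contra vy => /(leaf_eq xy)->.
have [a [b [xa ab bv]]] : exists a b, [/\ e x a, e a b & e b v].
  by apply: sat_walk; rewrite // eq_sym.
by exists b; rewrite // -(leaf_eq xy xa).
Qed.

Lemma exists_nbr v : exists u, e v u.
Proof.
have [i iv] : exists i : 'I_4, v.1 != i.
  by exists (ordS v.1); case: v => [[[|[|[|[|]]]]]].
have [e1|/sat_walk[//|a [b [va _ _]]]] := boolP (e v (i, v.2)); last by exists a.
by exists (i, v.2).
Qed.

Lemma nonleaf_nbr v u : (forall y, ~ leaf v y) -> e v u ->
  exists2 u', e v u' & u' != u.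
Proof.
move=> Nv vu; have [u' /andP[]|no] := pickP (fun u' => e v u' && (u' != u)).
  by exists u'.
case: (Nv u); apply: leafI => // w vw; apply/eqP.
by have := no w; rewrite vw => /negbFE.
Qed.

(** A vertex [v] outside part [p] has a neighbour on level 1, by the walk from the leaf [x]. On
    level 1 it pays 2 to [y] and 1 to that neighbour; on level 2 it pays 2 to that neighbour and at
    least 1 more, not being a leaf. *)
Lemma one_part_leaves p x y : 2 <= n -> leaf x y -> x.1 = p ->
  (forall v, v.1 != p -> forall z, ~ leaf v z) -> 10 * n - 2 < 2 * #|H|.
Proof.
move=> hn xy xp Np; have exy := leaf_adj xy.
have nxy := adj_ne exy; have yp : y.1 != p by rewrite -xp eq_sym adj_part.
pose l v := if v == y then 0 else if e y v then 1 else 2.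
have l2 v : l v <= 2 by rewrite /l; do 2?case: ifP.
have ly : l y = 0 by rewrite /l eqxx.
have l1 v : e y v -> l v = 1.
  by move=> yv; rewrite /l yv eq_sym (negPf (adj_ne yv)).
have lE2 v : v != y -> ~~ e y v -> l v = 2.
  by rewrite /l => /negPf-> /negPf->.
clearbody l; pose base v := if v.1 == p then 1 else 3.
(* Relative to [base], the root [y] saves 3 and its leaf [x] adds 1. *)
pose m v := if v == y then 0 else if v == x then 2 else base v.
have le_m v : m v <= wt H l v.
  rewrite /m; case: eqVneq => // nvy.
  have wy : e y v -> 2 <= wt H l v.
    move=> yv; have := @wt_ge1 _ H l v y.
    by rewrite adjC => /(_ yv); rewrite /score ly (l1 _ yv).
  case: eqVneq => [->|nvx].
    by have := wt_ge1 l exy; rewrite /score ly l1 // adjC.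
  have [yv|Nyv] := boolP (e y v).
    rewrite /base; case: ifP => [_|/negbT vp]; first exact: leq_trans (wy yv).
    have [a ya av] : exists2 a, e y a & e a v by apply: (leaf_walk xy); rewrite ?xp.
    have yv' := yv; rewrite adjC in yv'; rewrite adjC in av.
    by have := wt_ge2 l yv' av (adj_ne ya); rewrite /score ly !l1.
  have lv := lE2 v nvy Nyv; rewrite /base; case: ifP => [_|/negbT vp].
    have [u vu] := exists_nbr v; apply: leq_trans (wt_ge1 l vu).
    by apply: score_gt0; rewrite lv.
  have [a ya av] : exists2 a, e y a & e a v by apply: (leaf_walk xy); rewrite ?xp.
  rewrite adjC in av; have [u vu nua] := nonleaf_nbr (Np v vp) av.
  rewrite eq_sym in nua; apply: leq_trans (wt_ge2 l av vu nua).
  have : 0 < score l v u by rewrite score_gt0 // lv.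
  by rewrite (@score_lt _ l v a) ?lv ?l1 // add2n ltnS.
have sum_m : \sum_v m v = 10 * n - 2.
  have: \sum_v base v = 10 * n.
    rewrite (sum_part n (fun i => if i == p then 1 else 3)) mulnC; congr (_ * _).
    rewrite (bigD1 p) //= eqxx (eq_bigr (fun => 3)) => [|i /negPf->//].
    by rewrite sum_nat_const cardC1 card_ord.
  rewrite (bigD1 y) // (bigD1 x) //= => sb.
  rewrite (bigD1 y) // (bigD1 x) //= {1}/m eqxx {1}/m eqxx (negPf nxy).
  rewrite (eq_bigr base) => [|v /andP[/negPf vy /negPf vx]]; last first.
    by rewrite /m vy vx.
  by move: sb; rewrite {1}/base (negPf yp) {1}/base xp eqxx; clear; lia.
(* Equality is refuted at a second vertex [c] of part [p]. Its charge 1 makes it a leaf of some [b]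
   on level 2, and the charge 3 of [b] leaves room only for [c] and one vertex [a] of level 1. A
   walk of length 3 from [c] to [a] would have to leave [b] through [a] or [c], which is
   impossible. *)
rewrite ltnNge -(sum_wt l simple_sat) -sum_m; apply/negP => /(sum_tight le_m) wE.
have [c cx ncx] := part_other x hn; rewrite xp in cx.
have ncy : c != y by apply: contraNneq yp => <-; rewrite cx.
have wc : wt H l c = 1 by rewrite wE /m (negPf ncy) (negPf ncx) /base cx eqxx.
have Ny v : v.1 = p -> v != x -> ~~ e y v.
  move=> vp nvx; apply/negP => yv; have := wE v.
  have nvy : v != y by rewrite eq_sym adj_ne.
  rewrite /m (negPf nvy) (negPf nvx) /base vp eqxx.
  have := @wt_ge1 _ H l v y; rewrite adjC => /(_ yv).
  by rewrite /score ly (l1 _ yv) => s2 wE1; rewrite wE1 in s2.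
have Nyc := Ny c cx ncx; have lc := lE2 c ncy Nyc.
have [b cb] := exists_nbr c.
have lb : l b = 2.
  apply/eqP; rewrite eqn_leq l2 leqNgt -[ltnRHS]lc; apply/negP => /score_lt s2.
  by have := wt_ge1 l cb; rewrite wc s2.
have nby : b != y by apply: contra_eq_neq lb => ->; rewrite ly.
have bp : b.1 != p by rewrite -cx eq_sym adj_part.
have leaf_c : leaf c b.
  apply: leafI => // v cv; apply/eqP/negPn/negP => nvb.
  have := wt_ge2 l cb cv; rewrite wc eq_sym => /(_ nvb).
  have : 0 < score l c b by rewrite score_gt0 // lb lc.
  have : 0 < score l c v by rewrite score_gt0 // lc.
  by clear; lia.
have [a ya ab] : exists2 a, e y a & e a b by apply: (leaf_walk xy); rewrite ?xp.
have bE u : e b u -> u = a \/ u = c.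
  move=> bu; have [|nua] := eqVneq u a; first by left.
  have [|nuc] := eqVneq u c; first by right.
  have nac : a != c by apply: contraNneq Nyc => <-.
  have ba : e b a by rewrite adjC.
  have bc : e b c by rewrite adjC.
  have := wt_ge3 l bu ba bc; rewrite /= !inE negb_or nua nuc nac => /(_ isT).
  have nbx : b != x by apply: contraNneq bp => ->; rewrite xp.
  rewrite wE /m (negPf nby) (negPf nbx) /base (negPf bp).
  have : 0 < score l b u by rewrite score_gt0 // lb.
  rewrite (@score_lt _ l b a) ?lb ?l1 // (@score_eq _ l b c) ?lb ?lc //.
  by clear; lia.
have ap : a.1 != c.1.
  rewrite cx; apply/negP => /eqP ap; have [ax|/(Ny a ap)] := eqVneq a x.
    by move: ab; rewrite ax => /(leaf_eq xy) e1; rewrite e1 eqxx in nby.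
  by rewrite ya.
have [z bz za] := leaf_walk leaf_c ap (adj_ne ab).
have [zE|zE] := bE z bz; first by rewrite zE adjxx in za.
by move: za ab; rewrite zE => /(leaf_eq leaf_c) ->; rewrite adjxx.
Qed.

End Saturated.

(** * Graphs without leaves *)

Section DegreeTwo.

Variables (n : nat) (H : graph (vertex n)).
Hypothesis satH : saturated (K4 n) C4 H.
Implicit Types (a b c u v z : vertex n).
Local Notation e := (adj H).
Variables (x y1 y2 : vertex n).
Hypotheses (y12 : y1 != y2) (Nx : nbhd H x = [set y1; y2]).
Hypothesis NL : forall v z, ~ leaf H v z.

(** Distance from [x], with everything at distance 3 or more put on level 3. Outside the part of [x]
    saturation bounds the distance by 3; vertices in the part of [x] may be farther away, which is
    why they get a smaller budget. *)
Definition lev v :=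
  if v == x then 0 else if e x v then 1 else
  if [exists y, e x y && e y v] then 2 else 3.

Lemma e_xE v : e x v = (v == y1) || (v == y2).
Proof. by rewrite -in_nbhd Nx !inE. Qed.

Lemma lev_le3 v : lev v <= 3.
Proof. by rewrite /lev; do 3?case: ifP. Qed.

Lemma lev_x : lev x = 0.
Proof. by rewrite /lev eqxx. Qed.

Lemma lev_1 v : e x v -> lev v = 1.
Proof. by rewrite /lev => xv; rewrite xv eq_sym (negPf (adj_ne satH xv)). Qed.

Lemma lev_2 y v : e x y -> e y v -> v != x -> ~~ e x v -> lev v = 2.
Proof.
move=> xy yv /negPf vx /negPf xv; rewrite /lev vx xv.
by case: existsP => // -[]; exists y; rewrite xy.
Qed.

Lemma lev_2_inv v : lev v = 2 -> exists2 y, e x y & e v y.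
Proof.
rewrite /lev; do 2?[case: ifP => // _]; case: existsP => // -[y /andP[xy yv] _].
by exists y; rewrite // adjC.
Qed.

Lemma lev_ge2 v : v != x -> ~~ e x v -> 1 < lev v.
Proof. by rewrite /lev => /negPf-> /negPf->; case: ifP. Qed.

Lemma lev_3_nbr v u : lev v = 3 -> e v u -> 1 < lev u.
Proof.
move=> l3 vu; apply: lev_ge2.
  by apply: contra_eq_neq l3 => ux; rewrite lev_1 // -ux adjC.
apply/negP => xu; move: l3; rewrite /lev; do 2?[case: ifP => // _].
by case: existsP => // -[]; exists u; rewrite xu adjC.
Qed.

Lemma lev_3_up v : lev v = 3 -> v.1 != x.1 -> exists2 b, e v b & lev b = 2.
Proof.
move=> l3 vp; have Nxv : ~~ e x v by apply: contra_eqN l3 => /lev_1->.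
have xv : x.1 != v.1 by rewrite eq_sym.
have [a [b [xa ab bv]]] := sat_walk satH xv Nxv.
have vb : e v b by rewrite adjC.
exists b => //; have := lev_3_nbr l3 vb => lb; apply: (lev_2 xa ab).
  by apply: contraTneq lb => ->; rewrite lev_x.
by apply: contraTN lb => /lev_1->.
Qed.

Lemma lev_2_uniq_up v y y' : lev v = 2 -> e x y -> e x y' -> e v y -> e v y' -> y = y'.
Proof.
move=> l2 xy xy' vy vy'; apply: (common_nbr satH xy vy xy' vy').
by apply: contra_eq_neq l2 => <-; rewrite lev_x.
Qed.

(** The ordinary budgets of the three roots are added on the left, which avoids truncated
    subtraction. *)
Lemma sum_nonroot (base : 'I_4 -> nat) (m : vertex n -> nat) :
    (forall v, v != x -> ~~ e x v -> m v = base v.1) ->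
  \sum_v m v + (base x.1 + base y1.1 + base y2.1)
  = n * \sum_i base i + (m x + m y1 + m y2).
Proof.
move=> mE; have n1 : y1 != x by rewrite eq_sym (adj_ne satH) // e_xE eqxx.
have n2 : y2 != x by rewrite eq_sym (adj_ne satH) // e_xE eqxx orbT.
have y21 : y2 != y1 by rewrite eq_sym.
rewrite -sum_part (bigD1 x) // (bigD1 y1) // (bigD1 y2) /=; last by rewrite n2.
rewrite [in RHS](bigD1 x) // [in RHS](bigD1 y1) // [in RHS](bigD1 y2) /=; last by rewrite n2.
rewrite (eq_bigr (fun v => base v.1)); last first.
  move=> v /andP[/andP[vx v1] v2]; rewrite mE // e_xE.
  by rewrite (negPf v1) (negPf v2).
move: (\sum_(i | _) _) => s; clear; lia.
Qed.

Lemma other_nbr v u : e v u -> exists2 u', e v u' & u != u'.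
Proof. by move=> vu; have [w] := nonleaf_nbr (@NL v) vu; exists w; rewrite // eq_sym. Qed.

Lemma wt_lev_3 v : lev v = 3 -> 1 < wt H lev v.
Proof.
move=> l3; have [u vu] := exists_nbr satH v.
have [u' vu' nu] := other_nbr vu.
by rewrite (wt_geD (i := 1) (j := 1) vu vu' nu) // score_gt0 // l3 lev_le3.
Qed.

Lemma wt_lev_3_up v b : lev v = 3 -> e v b -> lev b = 2 -> 2 < wt H lev v.
Proof.
move=> l3 vb lb; have [u vu nu] := other_nbr vb; apply: (wt_geD (i := 2) (j := 1) vb vu nu).
  by rewrite score_lt // lb l3.
by rewrite score_gt0 // l3 lev_le3.
Qed.

Lemma sum_base p f g : \sum_(i : 'I_4) (if i == p then f else g) = f + 3 * g.
Proof.
rewrite (bigD1 p) //= eqxx (eq_bigr (fun => g)) => [|i /negPf->//].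
by rewrite sum_nat_const cardC1 card_ord.
Qed.

(* A vertex of level 2 without neighbours in its level has degree at least 3,
   so at least two neighbours in level 3. Each vertex of level 3 gives 1/3 to
   each of its neighbours in level 2; afterwards the charge of v is at least
   one third of m v. *)
Lemma triangle_bound :
    (forall v z1 z2, z1 != z2 -> nbhd H v = [set z1; z2] -> e z1 z2) ->
  10 * n - 2 < 2 * #|H|.
Proof.
move=> tri; have ey := tri _ _ _ y12 Nx.
have n1 : e x y1 by rewrite e_xE eqxx.
have n2 : e x y2 by rewrite e_xE eqxx orbT.
(* All amounts are in thirds of a unit: [k v] is what [v] gives, [kd v] what it receives. The target
   9 at [y1] and [y2] is the charge 2 + 1 of their edges to [x] and to each other. The targets total
   [30 * n - 4], more than three times [10 * n - 2]. *)
pose f v u : nat := (lev v == 3) && (lev u == 2).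
pose k v := \sum_(u in nbhd H v) f v u; pose kd v := \sum_(u in nbhd H v) f u v.
pose base i := if i == x.1 then 6 else 8.
pose m v := if v == x then 0 else if e x v then 9 else base v.1.
have k0 v : lev v != 3 -> k v = 0 by move=> /negPf l3; apply: big1 => u _; rewrite /f l3.
have le_m v : k v + m v <= 3 * wt H lev v + kd v.
  rewrite /m; case: eqVneq => [->|vx]; first by rewrite k0 ?lev_x.
  have [xv|xv] := boolP (e x v).
    rewrite k0 ?lev_1 // add0n; apply: leq_trans (leq_addr _ _).
    have vx' : e v x by rewrite adjC.
    suff [z vz xz] : exists2 z, e v z & e x z.
      rewrite (leq_mul2l 3 3); apply: (wt_geD (i := 2) (j := 1) vx' vz (adj_ne satH xz)).
        by rewrite score_lt // lev_x lev_1.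
      by rewrite score_gt0 // !lev_1.
    move: xv; rewrite e_xE => /orP[]/eqP->; [exists y2 | exists y1] => //.
    by rewrite adjC.
  have := lev_ge2 vx xv; rewrite leq_eqVlt => /orP[/eqP/esym l2|l3]; last first.
    have {}l3 : lev v = 3 by apply/eqP; rewrite eqn_leq lev_le3.
    have wt2 := wt_lev_3 l3.
    (* Each third is given along an edge that brings charge 2. From a charge [w >= 3] at least
       [3 * w - w / 2] thirds remain, hence at least 8. *)
    have kw : 2 * k v <= wt H lev v.
      rewrite /k big_distrr; apply: leq_sum => u _ /=; rewrite /f l3 /=.
      by case: eqVneq => //= l2; rewrite score_lt // l2 l3.
    have [u /andP[vu /eqP lu]|no] := pickP (fun u => e v u && (lev u == 2)).
      have := wt_lev_3_up l3 vu lu; move: kw; rewrite /base; case: ifP => _; clear; lia.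
    have [vp|vp] := eqVneq v.1 x.1.
      rewrite /base vp eqxx; suff -> : k v = 0 by move: wt2; clear; lia.
      by apply: big1 => u; rewrite in_nbhd /f l3 => vu; have := no u; rewrite vu /= => ->.
    by have [b vb lb] := lev_3_up l3 vp; have := no b; rewrite vb lb.
  rewrite k0 ?l2 // add0n; have [y xy vy] := lev_2_inv l2.
  have sy : score lev v y = 2 by rewrite score_lt // l2 lev_1.
  have base8 : base v.1 <= 8 by rewrite /base; case: ifP.
  apply: leq_trans base8 _.
  have [u /andP[vu /eqP lu]|no] := pickP (fun u => e v u && (lev u == 2)).
    have nyu : y != u by apply: contra_eq_neq lu => <-; rewrite lev_1.
    have w3 : 2 + 1 <= wt H lev v.
      by apply: (wt_geD vy vu nyu); rewrite ?sy // score_gt0 // l2 lu.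
    by move: w3; clear; lia.
  have l3 u : e v u -> u != y -> lev u = 3.
    move=> vu nuy; have := no u; rewrite vu /= => lu2.
    have nux : u != x by apply: contraNneq xv => <-; rewrite adjC.
    have nxu : ~~ e x u.
      by apply: contra nuy => xu; apply/eqP; apply: (lev_2_uniq_up l2).
    have := lev_ge2 nux nxu; rewrite leq_eqVlt eq_sym lu2 /= => l3.
    by apply/eqP; rewrite eqn_leq lev_le3.
  have [u vu nyu] := other_nbr vy.
  have [w /andP[vw /norP[nwy nwu]]|only] := pickP (fun w => e v w && ~~ ((w == y) || (w == u))).
    have nuw : u != w by rewrite eq_sym.
    have nuy : u != y by rewrite eq_sym.
    have kd2 := nbhd_sum_ge2 (f^~ v) vu vw nuw.
    rewrite {1 2}/f (l3 u vu nuy) (l3 w vw nwy) l2 !eqxx in kd2.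
    have := wt_ge1 lev vy; rewrite sy; move: kd2; rewrite -/(kd v) addn1.
    by move: (kd v) (wt _ _ _); clear; lia.
  (* Degree 2 is excluded: the two neighbours would be adjacent, but [u] on level 3 has no neighbour
     on level 1. *)
  have : nbhd H v = [set y; u].
    apply/setP => w; rewrite in_nbhd !inE; apply/idP/orP => [vw|[]/eqP->//].
    by have := only w; rewrite vw /= => /negbFE/orP.
  move=> /(tri _ _ _ nyu) yu; rewrite eq_sym in nyu.
  by have := lev_3_nbr (l3 u vu nyu) (etrans (adjC H u y) yu); rewrite lev_1.
have kdE : \sum_v kd v = \sum_v k v by rewrite -sum_nbhd_exchange.
have : \sum_v (k v + m v) <= \sum_v (3 * wt H lev v + kd v) by apply: leq_sum.
rewrite big_split [X in _ <= X]big_split /= kdE addnC leq_add2r.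
rewrite -(big_distrr 3) sum_wt ?(simple_sat satH) //.
have mE v : v != x -> ~~ e x v -> m v = base v.1.
  by rewrite /m => /negPf-> /negPf->.
have my y : e x y -> m y = 9.
  by move=> xy; rewrite /m eq_sym (negPf (adj_ne satH xy)) xy.
have baseN y : e x y -> base y.1 = 8.
  by move=> xy; rewrite /base eq_sym (negPf (adj_part satH xy)).
have sb : \sum_i base i = 30 by rewrite sum_base.
have bx : base x.1 = 6 by rewrite /base eqxx.
have m0 : m x = 0 by rewrite /m eqxx.
have := sum_nonroot (base := base) mE; rewrite sb m0 bx (my _ n1) (my _ n2) (baseN _ n1) (baseN _ n2).
by move=> /=; move: (\sum_v m v) #|H|; clear; lia.
Qed.

End DegreeTwo.

(** * No leaves, and a vertex of degree 2 with nonadjacent neighbours *)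

Lemma card_part n (i : 'I_4) : #|[set v : vertex n | v.1 == i]| = n.
Proof.
rewrite -sum1dep_card big_mkcond (sum_part n (fun j => if j == i then 1 else 0)).
by rewrite -big_mkcond sum1_card card1 muln1.
Qed.

Lemma part_size2 n (a b c : vertex n) : n <= 2 -> a.1 = b.1 -> a.1 = c.1 ->
  a != b -> a != c -> b = c.
Proof.
move=> hn ab ac nab nac; apply/eqP/negPn/negP => nbc.
suff : 2 < #|[set v : vertex n | v.1 == a.1]| by rewrite card_part ltnNge hn.
apply: leq_trans (_ : #|[set a; b; c]| <= _).
  by rewrite -setUA cardsU1 cards2 !inE negb_or nab nac nbc.
by apply/subset_leq_card/subsetP => v; rewrite !inE => /orP[/orP[]|] /eqP->;
  rewrite -?ab -?ac.
Qed.

(** Three pairs fill three parts, so the remaining two vertices share the fourth. *)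
Lemma part_pairs n (a a' b b' c c' d d' : vertex n) : n <= 2 ->
  uniq [:: a; a'; b; b'; c; c'; d; d'] -> a.1 = a'.1 -> b.1 = b'.1 -> c.1 = c'.1 ->
  d.1 = d'.1.
Proof.
move=> hn us ea eb ec; apply/eqP/negPn/negP => nd.
have off (u u' v : vertex n) : u.1 = u'.1 -> u != u' -> u != v -> u' != v -> u.1 != v.1.
  by move=> euu' nuu' nuv; apply: contraNneq => /(part_size2 hn euu')->.
move: us; rewrite /= !inE !negb_or -!andbA; do ![case/andP=> ?] => _.
have : uniq [:: a.1; b.1; c.1; d.1; d'.1].
  by rewrite /= !inE !negb_or nd !(off a a') ?(off b b') ?(off c c').
move/card_uniqP => c5; have := max_card (mem [:: a.1; b.1; c.1; d.1; d'.1]).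
by rewrite c5 card_ord.
Qed.

Section NonadjacentNbrs.

Variables (n : nat) (H : graph (vertex n)).
Hypothesis satH : saturated (K4 n) C4 H.
Implicit Types (a b c u v z : vertex n).
Local Notation e := (adj H).
Variables (x y1 y2 : vertex n).
Hypotheses (y12 : y1 != y2) (Nx : nbhd H x = [set y1; y2]).
Hypothesis NL : forall v z, ~ leaf H v z.
Hypothesis Ny : ~~ e y1 y2.
Local Notation lev := (lev H x).

Lemma nbrs_x_indep a b : e x a -> e x b -> e a b = false.
Proof.
rewrite !(e_xE Nx) => /orP[]/eqP-> /orP[]/eqP->; rewrite ?(adjxx satH) //.
  exact: negbTE.
by rewrite adjC (negbTE Ny).
Qed.

(** The last step of a walk of length 3 from [x] to [v] starts on level 2, because [y1] and [y2] are
    nonadjacent. This edge inside the level raises the charge of [v] to 3. *)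
Lemma lev_2_side v : lev v = 2 -> v.1 != x.1 -> exists2 b, e v b & lev b = 2.
Proof.
move=> l2 vp; have Nxv : ~~ e x v by apply: contra_eqN l2 => /(lev_1 satH)->.
have xv : x.1 != v.1 by rewrite eq_sym.
have [a [b [xa ab bv]]] := sat_walk satH xv Nxv.
exists b; rewrite 1?adjC //; apply: (lev_2 xa ab).
  by apply: contraNneq Nxv => <-.
by apply/negP => xb; rewrite (nbrs_x_indep xa xb) in ab.
Qed.

(** A column costs 2 + 3 + 3 + 3 and the roots save 4. The total [11 * n - 4] exceeds [10 * n - 2]
    for [n > 2] and equals it for [n = 2]. *)
Let m v := if v == x then 0 else if e x v then 2 else if v.1 == x.1 then 2 else 3.

Lemma le_m_wt v : m v <= wt H lev v.
Proof.
rewrite /m; case: eqVneq => // vx.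
have [xv|xv] := boolP (e x v).
  have vx' : e v x by rewrite adjC.
  apply: leq_trans (wt_ge1 lev vx').
  by rewrite score_lt // lev_x (lev_1 satH).
have := lev_ge2 vx xv; rewrite leq_eqVlt => /orP[/eqP/esym l2|l3]; last first.
  have {}l3 : lev v = 3 by apply/eqP; rewrite eqn_leq lev_le3.
  case: eqVneq => [_|vp]; first exact: wt_lev_3.
  by have [b vb lb] := lev_3_up satH l3 vp; apply: wt_lev_3_up vb lb.
have [y xy vy] := lev_2_inv l2.
have sy : score lev v y = 2 by rewrite score_lt // l2 (lev_1 satH).
case: eqVneq => [_|vp]; first by have := wt_ge1 lev vy; rewrite sy.
have [b vb lb] := lev_2_side l2 vp.
apply: (wt_geD (i := 2) (j := 1) vy vb); rewrite ?sy ?score_gt0 ?l2 ?lb //.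
by apply: contra_eq_neq lb => <-; rewrite (lev_1 satH).
Qed.

Lemma sum_m : \sum_v m v = 11 * n - 4.
Proof.
have mE v : v != x -> ~~ e x v -> m v = if v.1 == x.1 then 2 else 3.
  by rewrite /m => /negPf-> /negPf->.
have n1 : e x y1 by rewrite (e_xE Nx) eqxx.
have n2 : e x y2 by rewrite (e_xE Nx) eqxx orbT.
have := sum_nonroot satH y12 Nx (base := fun i => if i == x.1 then 2 else 3) mE.
have my y : e x y -> m y = 2.
  by move=> xy; rewrite /m eq_sym (negPf (adj_ne satH xy)) xy.
have baseN y : e x y -> (y.1 == x.1) = false.
  by move=> xy; rewrite eq_sym (negPf (adj_part satH xy)).
rewrite sum_base (my _ n1) (my _ n2) (baseN _ n1) (baseN _ n2) eqxx.
have -> : m x = 0 by rewrite /m eqxx.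
by move: (\sum_v m v); clear; lia.
Qed.

Lemma nonadjacent_bound : 2 < n -> 10 * n - 2 < 2 * #|H|.
Proof.
move=> hn; rewrite -(sum_wt lev (simple_sat satH)).
apply: leq_trans (_ : \sum_v m v <= _); last by apply: leq_sum => v _; apply: le_m_wt.
by rewrite sum_m; move: hn; clear; lia.
Qed.

(* For n = 2 the count leaves the equality case open. There, H would have to be
   two 5-cycles sharing an edge: each end of this edge has two further
   neighbours, which are not joined by a walk of length 3, and neither are the
   two vertices opposite to the edge. So these pairs are three of the four
   parts, and the shared edge lies inside the fourth. *)
Section SmallTight.

Hypotheses (hn : n = 2) (H_small : 2 * #|H| <= 10 * n - 2).

Lemma wtE v : wt H lev v = m v.
Proof.
apply: (sum_tight le_m_wt); rewrite sum_m (sum_wt _ (simple_sat satH)).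
by apply: leq_trans H_small _; rewrite hn.
Qed.

(** The charge of [v] is exactly 3: 2 goes to the edge down and 1 to a single edge inside the level.
    The same count on level 3 gives degree 2. *)
Lemma tight_lev_2 v b b' : lev v = 2 -> v.1 != x.1 ->
  lev b = 2 -> lev b' = 2 -> e v b -> e v b' -> b = b'.
Proof.
move=> l2 vp lb lb' vb vb'; apply/eqP/negPn/negP => nbb'.
have [y xy vy] := lev_2_inv l2; have ly := lev_1 satH xy.
have ny u : lev u = 2 -> y != u by apply: contra_eq_neq => <-; rewrite ly.
have us : uniq [:: y; b; b'] by rewrite /= !inE negb_or !ny // nbb'.
have sy : 2 <= score lev v y by rewrite score_lt // l2 ly.
have sb : 1 <= score lev v b by rewrite score_gt0 // l2 lb.
have sb' : 1 <= score lev v b' by rewrite score_gt0 // l2 lb'.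
have := wt_geD3 vy vb vb' us sy sb sb'.
by rewrite wtE /m (negPf vp); do 2?case: ifP.
Qed.

Lemma tight_lev_3 v : lev v = 3 -> v.1 != x.1 -> exists a b,
  [/\ lev a = 2, lev b = 3, e v a, e v b & forall u, e v u -> u = a \/ u = b].
Proof.
move=> l3 vp; have [a va la] := lev_3_up satH l3 vp.
have sa : 2 <= score lev v a by rewrite score_lt // la l3.
have w3 : wt H lev v <= 3 by rewrite wtE /m (negPf vp); do 2?case: ifP.
have nu3 u : e v u -> u != a -> lev u = 3.
  move=> vu nua; apply/eqP; rewrite eqn_leq lev_le3.
  have := lev_3_nbr satH l3 vu; rewrite leq_eqVlt => /orP[/eqP lu|//].
  have su : 2 <= score lev v u by rewrite score_lt // -lu l3.
  by have /leq_trans/(_ w3) := wt_geD vu va nua su sa.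
have [b vb nab] := other_nbr NL va; rewrite eq_sym in nab.
exists a, b; split; rewrite ?(nu3 b) // => u vu.
have [|nua] := eqVneq u a; first by left.
have [|nub] := eqVneq u b; first by right.
have us : uniq [:: a; b; u] by rewrite /= !inE negb_or eq_sym nab eq_sym nua eq_sym nub.
have s1 w : 1 <= score lev v w by rewrite score_gt0 // l3 lev_le3.
by have /leq_trans/(_ w3) := wt_geD3 va vb vu us sa (s1 b) (s1 u).
Qed.

Lemma tight_mate_2 v b : lev v = 2 -> v.1 = x.1 -> e v b -> lev b <> 2.
Proof.
move=> l2 vp vb lb; have [y xy vy] := lev_2_inv l2; have ly := lev_1 satH xy.
have nyb : y != b by apply: contra_eq_neq lb => <-; rewrite ly.
have sy : 2 <= score lev v y by rewrite score_lt // l2 ly.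
have sb : 1 <= score lev v b by rewrite score_gt0 // l2 lb.
have := wt_geD vy vb nyb sy sb.
by rewrite wtE /m vp eqxx; do 2?case: ifP.
Qed.

Lemma tight_mate_3 v : lev v = 3 -> v.1 = x.1 -> exists b b',
  [/\ b != b', e v b, e v b' & forall u, e v u -> lev u = 3].
Proof.
move=> l3 vp; have w2 : wt H lev v <= 2.
  by rewrite wtE /m vp eqxx; do 2?case: ifP.
have nu3 u : e v u -> lev u = 3.
  move=> vu; apply/eqP; rewrite eqn_leq lev_le3.
  have := lev_3_nbr satH l3 vu; rewrite leq_eqVlt => /orP[/eqP lu|//].
  by have := wt_lev_3_up NL l3 vu (esym lu); rewrite ltnNge w2.
have [b vb] := exists_nbr satH v; have [b' vb' nb] := other_nbr NL vb.
by exists b, b'.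
Qed.

Lemma small_card (s : seq (vertex n)) : uniq s -> size s <= 8.
Proof.
by move/card_uniqP=> <-; rewrite (leq_trans (max_card _)) // card_prod !card_ord hn.
Qed.

Lemma lev_neq u v : lev u != lev v -> u != v.
Proof. by apply: contraNneq => ->. Qed.

Lemma lev_1_2 y u : e x y -> e y u -> u != x -> lev u = 2.
Proof.
move=> xy yu nux; apply: (lev_2 xy yu nux).
by apply: contraTN yu => xu; rewrite nbrs_x_indep.
Qed.

Variable x' : vertex n.
Hypotheses (x'p : x'.1 = x.1) (nx' : x' != x).

Lemma off_part v : v != x -> v != x' -> v.1 != x.1.
Proof.
move=> nv nv'; apply/negP => /eqP vp; have hn2 : n <= 2 by rewrite hn.
have e1 : x.1 = x'.1 by [].
have := part_size2 hn2 e1 (esym vp); rewrite eq_sym nx' eq_sym nv.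
by move=> /(_ isT isT) /eqP; rewrite eq_sym (negPf nv').
Qed.

(** Here the 5-cycles are [x], [y], [a1], [a2], [z] and [x'], [b1], [a1], [a2], [b2], with shared
    edge [a1 a2]; the pairs [x x'], [y b1] and [z b2] fill three parts. *)
Lemma not_mate_3 : lev x' = 3 -> False.
Proof.
move=> l3; have [b1 [b2 [nb xb1 xb2 x3]]] := tight_mate_3 l3 x'p.
have lb1 := x3 _ xb1; have lb2 := x3 _ xb2.
have offx v : e x' v -> v.1 != x.1.
  by move=> /(adj_part satH); rewrite x'p eq_sym.
have nbr b : e x' b -> lev b = 3 -> exists a,
    [/\ e b a, lev a = 2, a.1 != x.1 & forall u, e b u -> u = a \/ u = x'].
  move=> xb lb; have [a [c [la lc ba bc bE]]] := tight_lev_3 lb (offx b xb).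
  exists a; split=> //.
    by apply: off_part; apply: lev_neq; rewrite la ?l3 ?lev_x.
  have {}bc : c = x'.
    rewrite adjC in xb; case: (bE _ xb) => // xa.
    by move: la; rewrite -xa l3.
  by move=> u /bE; rewrite bc.
have [a1 [ba1 la1 ap1 bE1]] := nbr b1 xb1 lb1.
have [a2 [ba2 la2 ap2 bE2]] := nbr b2 xb2 lb2.
have na12 : a1 != a2.
  apply/eqP => a12; rewrite -a12 in ba2.
  have bx1 : e b1 x' by rewrite adjC.
  have bx2 : e b2 x' by rewrite adjC.
  by move: l3; rewrite -(common_nbr satH ba1 ba2 bx1 bx2 nb) la1.
have nxv v : lev v != 0 -> x != v by move=> lv; apply: lev_neq; rewrite lev_x eq_sym.
have N u v : lev u <> lev v -> u != v by move/eqP/lev_neq.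
have nx'b1 := adj_ne satH xb1; have nx'b2 := adj_ne satH xb2.
(* A further vertex of level 2 would be the ninth vertex of a graph on eight. *)
have no9 c : lev c = 2 -> c != a1 -> c != a2 -> False.
  move=> lc nc1 nc2; rewrite eq_sym in nc1; rewrite eq_sym in nc2.
  have := @small_card [:: x; y1; y2; x'; b1; b2; a1; a2; c] _.
  have l1 : lev y1 = 1 by rewrite (lev_1 satH) // (e_xE Nx) eqxx.
  have l2 : lev y2 = 1 by rewrite (lev_1 satH) // (e_xE Nx) eqxx orbT.
  rewrite /= !inE !negb_or y12 nx'b1 nx'b2 nb na12 nc1 nc2.
  rewrite !N ?l1 ?l2 ?l3 ?lb1 ?lb2 ?la1 ?la2 ?lc ?lev_x //.
  by move=> /(_ isT).
have a12 : e a1 a2.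
  have [c ac lc] := lev_2_side la1 ap1.
  have [<-//|nc2] := eqVneq c a2.
  by case: (no9 c) => //; rewrite eq_sym (adj_ne satH).
have [y xy ay1] := lev_2_inv la1; have [z xz az2] := lev_2_inv la2.
have nyz : y != z.
  apply/eqP => yz; rewrite -yz in az2.
  have [y' xy' nyy'] := other_nbr NL xy; have y'x := xy'; rewrite adjC in y'x.
  have [c yc nxc] := other_nbr NL y'x; rewrite eq_sym in nxc.
  have lc := lev_1_2 xy' yc nxc; rewrite adjC in yc.
  by case: (no9 c) => //; apply: contraNneq nyy' => ca; apply/eqP; rewrite ca in yc;
    [apply: (lev_2_uniq_up satH la1) | apply: (lev_2_uniq_up satH la2)].
(* A walk of length 3 from [u] to [b] would have to end with [a'], [a], [b], but the only neighbour
   of [a'] on level 1 is [w]. *)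
have same u w a a' b : e x u -> e x w -> u != w -> e a u -> e a' w -> lev a = 2 ->
    a.1 != x.1 -> lev a' = 2 -> e a a' -> lev b = 3 ->
    (forall v, e b v -> v = a \/ v = x') -> u.1 = b.1.
  move=> xu xw nuw au aw la ap la' aa' lb bE; apply/eqP/negPn/negP => ub.
  have Nub : ~~ e u b.
    apply/negP => eub; have := lb; rewrite (lev_1_2 xu eub) //.
    by apply: lev_neq; rewrite lb lev_x.
  have [q [r [uq qr rb]]] := sat_walk satH ub Nub; rewrite adjC in rb.
  case: (bE r rb) => rE; rewrite {r}rE in qr rb; last first.
    rewrite adjC in qr; have lq := x3 q qr; have := lq; rewrite (lev_1_2 xu uq) //.
    by apply: lev_neq; rewrite lq lev_x.
  have nqx : q != x by apply: contra_eq_neq la => qx; rewrite (lev_1 satH) // -qx.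
  have lq := lev_1_2 xu uq nqx; rewrite adjC in qr; rewrite adjC in uq.
  have qE := tight_lev_2 la ap lq la' qr aa'; rewrite qE in uq.
  by move: nuw; rewrite (lev_2_uniq_up satH la' xu xw uq aw) eqxx.
have a21 : e a2 a1 by rewrite adjC.
have s1 := same y z a1 a2 b1 xy xz nyz ay1 az2 la1 ap1 la2 a12 lb1 bE1.
have nzy : z != y by rewrite eq_sym.
have s2 := same z y a2 a1 b2 xz xy nzy az2 ay1 la2 ap2 la1 a21 lb2 bE2.
have hn2 : n <= 2 by rewrite hn.
have := part_pairs (a := x) (a' := x') (d := a1) (d' := a2) hn2 _ (esym x'p) s1 s2.
rewrite /= !inE !negb_or nyz nb na12 nx'b1 nx'b2.
have ly := lev_1 satH xy; have lz := lev_1 satH xz.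
rewrite !N ?lb1 ?lb2 ?la1 ?la2 ?ly ?lz ?l3 ?lev_x // => /(_ isT) a12p.
by have := adj_part satH a12; rewrite a12p eqxx.
Qed.

(** Here the 5-cycles are [x], [y], [a], [a2], [z] and [x'], [y], [a], [b'], [b], with shared edge
    [y a]; the pairs [x x'], [z b] and [b' a2] fill three parts. *)
Lemma not_mate_2 : lev x' = 2 -> False.
Proof.
move=> l2; have [y xy x'y] := lev_2_inv l2; have [y' xy' nyy'] := other_nbr NL xy.
have [b x'b nyb] := other_nbr NL x'y; rewrite eq_sym in nyb.
have ly := lev_1 satH xy; have ly' := lev_1 satH xy'.
have N u v : lev u <> lev v -> u != v by move/eqP/lev_neq.
have offx v : e x' v -> v != x /\ v.1 != x.1.
  move=> /(adj_part satH); rewrite x'p eq_sym => vp; split=> //.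
  by apply: contraNneq vp => ->.
have child v : e x' v -> v != y -> exists w, [/\ lev v = 3, lev w = 3, e v w &
    forall u, e v u -> u = x' \/ u = w].
  move=> x'v nvy; have [nvx vp] := offx v x'v.
  have xv : ~~ e x v.
    by apply: contra nvy => xv; rewrite (lev_2_uniq_up satH l2 xy xv x'y x'v).
  have lv : lev v = 3.
    apply/eqP; rewrite eqn_leq lev_le3; have := lev_ge2 nvx xv.
    by rewrite leq_eqVlt => /orP[/eqP/esym/(tight_mate_2 l2 x'p x'v)|].
  have [a [w [la lw va vw vE]]] := tight_lev_3 lv vp.
  exists w; split=> // u /vE; rewrite adjC in x'v.
  by case: (vE x' x'v) => [<-//|x'w]; move: lw; rewrite -x'w l2.
have [b' [lb lb' bb' bE]] := child b x'b nyb.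
have bp' : b'.1 != x.1 by apply: off_part; apply: N; rewrite lb' ?l2 ?lev_x.
have [a [c [la lc ba bc bE']]] := tight_lev_3 lb' bp'.
have {lc bc} cE : c = b.
  rewrite adjC in bb'; case: (bE' b bb') => // ea.
  by move: la; rewrite -ea lb.
rewrite {c}cE in bE'.
have y'x : e y' x by rewrite adjC.
have [g y'g nxg] := other_nbr NL y'x; rewrite eq_sym in nxg.
have lg := lev_1_2 xy' y'g nxg; have gy' := y'g; rewrite adjC in gy'.
have Ngy : ~~ e g y.
  by apply: contra nyy' => gy; rewrite (lev_2_uniq_up satH lg xy xy' gy gy').
have ngx' : g != x' by apply: contraNneq Ngy => ->.
have gp : g.1 != x.1 by apply: off_part.
have child_g v : e x' v -> e v g -> False.
  move=> x'v vg; have nvy : v != y by apply: contraNneq Ngy => <-; rewrite adjC.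
  have [w [_ lw _ vE]] := child v x'v nvy.
  by case: (vE g vg) => gE; [rewrite gE eqxx in ngx' | move: lw; rewrite -gE lg].
(* If [a = x'], then [x'], [b], [b'] form a triangle from which neither [b] nor [b'] reaches [g] by
   a walk of length 3. Both would lie in the part of [g], although they are adjacent. *)
have [ax'|nax'] := eqVneq a x'.
  have same c c' : e x' c -> lev c' = 3 -> (forall u, e c u -> u = x' \/ u = c') ->
      (forall u, e c' u -> u = x' \/ u = c) -> c.1 = g.1.
    move=> x'c lc' cE c'E; apply/eqP/negPn/negP => cg.
    have Ncg : ~~ e c g by apply/negP; apply: child_g.
    have [q [r [cq qr rg]]] := sat_walk satH cg Ncg.
    case: (cE q cq) => qE; rewrite {q}qE in cq qr; first exact: child_g rg.
    case: (c'E r qr) => rE; rewrite {r}rE in qr rg; last exact: child_g rg.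
    exact: tight_mate_2 l2 x'p rg lg.
  rewrite ax' in bE' la ba.
  have x'b' : e x' b' by rewrite adjC.
  by have := adj_part satH bb'; rewrite (same b b') // (same b' b) // eqxx.
have x'b'p : x'.1 != b'.1 by rewrite x'p eq_sym.
have Nx'b' : ~~ e x' b'.
  rewrite adjC; apply/negP => /bE'[x'a|x'b2]; first by rewrite x'a eqxx in nax'.
  by move: lb; rewrite -x'b2 l2.
(* The walk of length 3 from [x'] to [b'] is forced to be [x'], [y], [a], [b']. *)
have ya : e y a.
  have [q [r [x'q qr rb']]] := sat_walk satH x'b'p Nx'b'; rewrite adjC in rb'.
  have [qy|nqy] := eqVneq q y.
    case: (bE' r rb') => rE; rewrite qy rE // in qr.
    by rewrite adjC in qr; case: (bE y qr) => yE; move: ly; rewrite yE ?l2 ?lb'.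
  have [w [lq lw _ qE]] := child q x'q nqy.
  case: (qE r qr) => rE; first by rewrite rE adjC (negPf Nx'b') in rb'.
  case: (bE' r rb') => rE'; first by move: lw; rewrite -rE rE' la.
  rewrite rE' adjC in qr; case: (bE q qr) => qE'.
    by rewrite qE' (adjxx satH) in x'q.
  by rewrite qE' (negPf Nx'b') in x'q.
have ay := ya; rewrite adjC in ay.
have nax : a != x by apply: N; rewrite la lev_x.
have [a2 aa2 la2] := lev_2_side la (off_part nax nax').
have x'a2 : ~~ e x' a2 by apply/negP => /(tight_mate_2 l2 x'p).
have x'a : ~~ e x' a by apply/negP => /(tight_mate_2 l2 x'p).
have na2x' : x' != a2 by apply: contraNneq x'a => ->; rewrite adjC.
have na2 := adj_ne satH aa2; rewrite eq_sym in nax'; rewrite eq_sym in ngx'.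
have nbb' := adj_ne satH bb'.
have [z xz a2z] := lev_2_inv la2; have lz := lev_1 satH xz.
(* If [a2] hangs from [y] as [a] does, then both differ from [g], and there are nine distinct
   vertices. *)
have [zy|nyz] := eqVneq y z.
  have ga u : e u y -> u != g by apply: contraTneq => ->.
  have ag := ga a ay; have a2g : a2 != g by rewrite ga // zy.
  have := @small_card [:: x; y; y'; x'; b; b'; a; a2; g] _.
  rewrite /= !inE !negb_or nyy' nbb' nax' na2x' ngx' na2 ag a2g.
  by rewrite !N ?ly ?ly' ?l2 ?lb ?lb' ?la ?la2 ?lg ?lev_x // => /(_ isT).
have s1 : z.1 = b.1.
  have Nzb : ~~ e z b.
    rewrite adjC; apply/negP => /bE[] zE; move: lz; rewrite zE ?l2 ?lb' //.
  apply/eqP/negPn/negP => zb; have [q [r [zq qr rb]]] := sat_walk satH zb Nzb.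
  rewrite adjC in rb; case: (bE r rb) => rE; rewrite {r}rE in qr rb.
    rewrite adjC in qr; have [qy|nqy] := eqVneq q y.
      by rewrite qy nbrs_x_indep in zq.
    have [w [lq lw _ qE]] := child q qr nqy; rewrite adjC in zq.
    by case: (qE z zq) => zE; move: lz; rewrite zE ?l2 ?lw.
  rewrite adjC in qr; case: (bE' q qr) => qE; rewrite qE in zq.
    rewrite adjC in zq; move: nyz; rewrite (lev_2_uniq_up satH la xy xz ay zq).
    by rewrite eqxx.
  by rewrite zq in Nzb.
have s2 : b'.1 = a2.1.
  have Nb'a2 : ~~ e b' a2.
    apply/negP => /bE'[] aE; first by rewrite aE eqxx in na2.
    by move: la2; rewrite aE lb.
  apply/eqP/negPn/negP => ba2; have [r [q [br rq qa]]] := sat_walk satH ba2 Nb'a2.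
  case: (bE' r br) => rE; rewrite {r}rE in br rq; last first.
    case: (bE q rq) => qE; rewrite qE in qa; first by rewrite qa in x'a2.
    by rewrite qa in Nb'a2.
  have nqx : q != x.
    by apply: contra_eq_neq la => qx; rewrite (lev_1 satH) // -qx adjC.
  have [xq|Nxq] := boolP (e x q).
    move: nyz; rewrite (lev_2_uniq_up satH la xy xq ay rq) adjC in qa *.
    by rewrite (lev_2_uniq_up satH la2 xq xz qa a2z) eqxx.
  have := lev_ge2 nqx Nxq; rewrite leq_eqVlt => /orP[/eqP/esym lq|lq].
    have qE := tight_lev_2 la (off_part nax _) lq la2 rq aa2.
    by rewrite qE ?(adjxx satH) // eq_sym in qa.
  have {}lq : lev q = 3 by apply/eqP; rewrite eqn_leq lev_le3.
  have qp : q.1 != x.1 by apply: off_part => //; apply: N; rewrite lq l2.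
  have [p [w [lp lw _ _ qE]]] := tight_lev_3 lq qp.
  have pE u : e q u -> lev u = 2 -> u = p.
    by case/qE=> // ->; rewrite lw.
  by move: na2; rewrite (pE a2) // (pE a) ?eqxx // adjC.
have hn2 : n <= 2 by rewrite hn.
have := part_pairs (a := x) (a' := x') (d := y) (d' := a) hn2 _ (esym x'p) s1 s2.
rewrite eq_sym in na2; rewrite eq_sym in nyz.
rewrite /= !inE !negb_or nyz nbb' nax' na2 na2x'.
rewrite !N ?lb ?lb' ?la ?la2 ?ly ?lz ?l2 ?lev_x // => /(_ isT) yap.
by have := adj_part satH ya; rewrite yap eqxx.
Qed.

Lemma tight_false : False.
Proof.
have xx' : ~~ e x x' by apply: contraTN isT => /(adj_part satH); rewrite x'p eqxx.
have := lev_ge2 nx' xx'; rewrite leq_eqVlt => /orP[/eqP/esym/not_mate_2//|l3].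
by apply: not_mate_3; apply/eqP; rewrite eqn_leq lev_le3.
Qed.

End SmallTight.

End NonadjacentNbrs.

Lemma no_leaf_bound n (H : graph (vertex n)) : 2 <= n -> saturated (K4 n) C4 H ->
  (forall v z, ~ leaf H v z) -> 10 * n - 2 < 2 * #|H|.
Proof.
move=> hn satH NL.
have [/existsP[x /existsP[y1 /existsP[y2 /and3P[ny /eqP Nx Ny]]]]|no] := boolP
    [exists x, exists y1, exists y2, [&& y1 != y2, nbhd H x == [set y1; y2] & ~~ adj H y1 y2]].
  have [hn2|] := ltnP 2 n; first exact: nonadjacent_bound satH _ _ _ ny Nx NL Ny hn2.
  move=> n2; have {n2}hn2 : n = 2 by apply/eqP; rewrite eqn_leq n2 hn.
  rewrite ltnNge; apply/negP => small; have [x' x'p nx'] := part_other x hn.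
  exact: tight_false satH _ _ _ ny Nx NL Ny hn2 small _ x'p nx'.
have tri v z1 z2 : z1 != z2 -> nbhd H v = [set z1; z2] -> adj H z1 z2.
  move=> nz Nv; apply/negPn/negP => Nz; case/negP: no; apply/existsP; exists v.
  by apply/existsP; exists z1; apply/existsP; exists z2; rewrite nz Nv eqxx.
have [x /cards2P[y1 [y2 [ny Nx]]]|no2] := pickP (fun x => #|nbhd H x| == 2).
  exact: triangle_bound satH _ _ _ ny Nx NL tri.
(* Every degree is at least 3 here, so the degrees sum to at least [12 * n]. *)
rewrite -sum_deg ?(simple_sat satH) //.
apply: leq_trans (_ : \sum_(v : vertex n) 3 <= _).
  by rewrite sum_nat_const card_prod !card_ord; move: hn; clear; lia.
apply: leq_sum => v _; rewrite /deg; have := no2 v.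
have [u vu] := exists_nbr satH v.
have : 0 < #|nbhd H v| by apply/card_gt0P; exists u; rewrite in_nbhd.
have : #|nbhd H v| != 1.
  by apply/negP => /cards1P[z /NL].
by case: #|_| => [|[|[|]]].
Qed.

(** * Induced subgraphs, and charges as cardinalities *)

Section Induced.

Variable T : finType.
Implicit Types (H : graph T) (A X : {set T}) (u v : T).

Lemma adj_induced H A u v :
  adj (induced H A) u v = [&& adj H u v, u \in A & v \in A].
Proof. by rewrite /adj inE subUset !sub1set. Qed.

Lemma nbhd_induced H A v : v \in A -> nbhd (induced H A) v = nbhd H v :&: A.
Proof. by move=> vA; apply/setP => u; rewrite !inE adj_induced vA. Qed.

Lemma one_regular_onP H A :
  reflect (forall v, v \in A -> exists u, nbhd H v :&: A = [set u]) (one_regular_on H A).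
Proof.
apply: (iffP forall_inP) => reg v vA; have := reg v vA.
  by rewrite /deg nbhd_induced // => /cards1P.
by case=> u uE; rewrite /deg nbhd_induced // uE cards1.
Qed.

Lemma triangle_onP H A : simple H ->
  reflect (#|A| = 3 /\ forall u v, u \in A -> v \in A -> u != v -> adj H u v)
          (triangle_on H A).
Proof.
move=> simH; apply: (iffP andP) => [[/eqP A3 /forall_inP tri]|[-> tri]]; split=> //.
  move=> u v uA vA nuv; have /forall_inP/(_ v vA)/implyP/(_ nuv) := tri u uA.
  by rewrite adj_induced => /and3P[].
apply/forall_inP => u uA; apply/forall_inP => v vA; apply/implyP => nuv.
by rewrite adj_induced uA vA tri.
Qed.

Lemma wt_card H l v : wt H l v =
  2 * #|[set u in nbhd H v | l u < l v]| + #|[set u in nbhd H v | l u == l v]|.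
Proof.
have -> : wt H l v = \sum_(u in nbhd H v) (2 * (l u < l v) + (l u == l v)).
  by apply: eq_bigr => u _; rewrite /score; case: ltngtP.
by rewrite big_split -big_distrr /= !cardsE -!sum1_card !big_mkcondr.
Qed.

(** The charges for the two-level function with [X] at the bottom: 2 on [X], and elsewhere 2 for the
    edge to [X] plus 1 for each neighbour outside [X]. This recovers the number of leaves in family
    1 from the number of edges. *)
Lemma sum_core H X : simple H -> (forall v, #|nbhd H v :&: X| = if v \in X then 2 else 1) ->
  2 * #|H| = 2 * #|T| + \sum_(v | v \notin X) #|nbhd H v :\: X|.
Proof.
move=> simH NX; rewrite -(sum_wt (fun v => v \notin X) simH).
have wX v : wt H (fun v => v \notin X) v = if v \in X then 2 else 2 + #|nbhd H v :\: X|.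
  rewrite wt_card; have := NX v; case: ifP => vX NvX /=.
    rewrite -[RHS]NvX (_ : [set u in _ | _] = set0) ?cards0; last first.
      by apply/setP => u; rewrite !inE ?vX /= ltn0 andbF.
    by congr #|pred_of_set _|; apply/setP => u; rewrite !inE ?vX /=; case: (u \in X).
  congr (_ + _); last first.
    by congr #|pred_of_set _|; apply/setP => u; rewrite !inE ?vX /= andbC; case: (u \in X).
  rewrite (_ : #|[set u in _ | _ < _]| = 1) // -[RHS]NvX.
  by congr #|pred_of_set _|; apply/setP => u; rewrite !inE ?vX /=; case: (u \in X).
have -> : 2 * #|T| = \sum_(v : T) 2 by rewrite sum_nat_const mulnC.
rewrite [X in _ + X]big_mkcond -big_split /=.
by apply: eq_bigr => v _; rewrite wX; case: ifP.
Qed.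

End Induced.

Lemma exists_notin k (s : seq 'I_k) : size s < k -> exists i, i \notin s.
Proof.
move=> sk; apply/existsP; rewrite -negb_forall; apply: contraL sk => /forallP all_s.
rewrite -leqNgt -[leqLHS]card_ord; apply: leq_trans (card_size s).
by apply/subset_leq_card/subsetP => i _; apply: all_s.
Qed.

(** The walk of length 2 from [y] to the leaf [x'] has middle vertex [y']. This needs [x' != y];
    otherwise [x] and [y] would be leaves of each other, out of reach of a vertex of a third
    part. *)
Lemma leaf_leaf n (H : graph (vertex n)) x y x' y' : saturated (K4 n) C4 H ->
  leaf H x y -> leaf H x' y' -> x.1 != x'.1 -> adj H y y'.
Proof.
move=> satH xy xy' px.
have [x'y|nx'y] := eqVneq x' y; last first.
  have [|a ya ax'] := leaf_walk satH xy _ nx'y; first by rewrite eq_sym.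
  by rewrite adjC in ax'; rewrite -(leaf_eq xy' ax').
have [i] := exists_notin (isT : size [:: x.1; x'.1] < 4).
rewrite !inE => /norP[ix ix']; pose z : vertex n := (i, x.2).
have nzy : z != y by rewrite -x'y; apply: contraNneq ix' => <-.
have [a ya az] := leaf_walk satH xy (ix : z.1 != x.1) nzy.
have xx' : adj H x' x by rewrite x'y adjC leaf_adj.
have x'a : adj H x' a by rewrite x'y.
have ax : a = x := etrans (leaf_eq xy' x'a) (esym (leaf_eq xy' xx')).
by move: nzy; rewrite ax in az; rewrite (leaf_eq xy az) eqxx.
Qed.

(** * Leaves in three parts *)

Section ThreeParts.

Variables (n : nat) (H : graph (vertex n)).
Hypothesis satH : saturated (K4 n) C4 H.
Implicit Types (a b c u v z : vertex n).
Local Notation e := (adj H).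
Variables x y : 'I_3 -> vertex n.
Hypotheses (xy : forall i, leaf H (x i) (y i)) (xp : forall i, (x i).1 = i :> nat).
Hypothesis H_small : 2 * #|H| <= 10 * n - 2.
Hypothesis hn : 2 <= n.

Let X := [set y i | i : 'I_3].
Local Notation in4 v := ((v.1 : nat) == 3).

(* Distance to X, except that the fourth part is put above the other neighbours
   of X, so that its vertices take the whole charge of their edges. *)
Let l v := if v \in X then 0 else if [exists i, e (y i) v] then 1 + in4 v else 3.

Lemma adj_yy i j : i != j -> e (y i) (y j).
Proof.
move=> ij; apply: leaf_leaf satH (xy i) (xy j) _.
by apply: contra ij => /eqP/(congr1 val) /=; rewrite !xp => /val_inj->.
Qed.

Lemma y_inj : injective y.
Proof.
move=> i j yij; apply/eqP/negPn/negP => /adj_yy.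
by rewrite yij (adjxx satH).
Qed.

Lemma card_X : #|X| = 3.
Proof. by rewrite card_imset ?card_ord //; apply: y_inj. Qed.

Lemma third (i j : 'I_3) : i != j -> exists k, k != i /\ k != j.
Proof.
move=> _; have [k] := exists_notin (isT : size [:: i; j] < 3).
by rewrite !inE => /norP[]; exists k.
Qed.

(** Two vertices of the triangle already have the third as a common neighbour. *)
Lemma y_twice i j v : i != j -> e v (y i) -> e v (y j) -> v \in X.
Proof.
move=> ij vi vj; have [k [ki kj]] := third ij.
have nyij : y i != y j by apply: contra ij => /eqP/y_inj->.
rewrite adjC in vi; rewrite adjC in vj.
rewrite eq_sym in ki; rewrite eq_sym in kj.
by rewrite (common_nbr satH vi vj (adj_yy ki) (adj_yy kj) nyij) imset_f.
Qed.

Lemma y_notin v i : v \notin X -> v != y i.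
Proof. by apply: contraNneq => ->; apply: imset_f. Qed.

Lemma part_x (i : 'I_3) v : v.1 <> i :> nat -> v.1 != (x i).1.
Proof. by move=> vi; apply/eqP => /(congr1 val); rewrite /= xp. Qed.

Lemma walk_y (i : 'I_3) v : v.1 <> i :> nat -> v \notin X -> exists2 a, e (y i) a & e v a.
Proof.
move=> vi vX; have [a ya av] := leaf_walk satH (xy i) (part_x vi) (y_notin i vX).
by exists a; rewrite // adjC.
Qed.

Lemma in4_neq v (i : 'I_3) : in4 v -> v.1 <> i :> nat.
Proof. by move=> /eqP-> ei; have := ltn_ord i; rewrite -ei. Qed.

Lemma nbr_in4 u v : e u v -> in4 u -> ~~ in4 v.
Proof.
move=> uv /eqP u4; apply: contra (adj_part satH uv) => /eqP v4.
by apply/eqP/val_inj; rewrite /= u4 v4.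
Qed.

Lemma l_X v : v \in X -> l v = 0. Proof. by rewrite /l => ->. Qed.

Lemma l_adj v i : v \notin X -> e (y i) v -> l v = 1 + in4 v.
Proof.
rewrite /l => /negPf-> yv; case: existsP => // -[]; by exists i.
Qed.

Lemma y_nbr_notin v i a : v \notin X -> e v a -> e (y i) a -> (e (y i) v \/ (forall j, ~~ e (y j) v)) ->
  a \notin X.
Proof.
move=> vX va ya yv; apply: contra vX => /imsetP[j _ aE]; rewrite aE in va ya.
case: yv => [yv|/(_ j)]; last by rewrite adjC va.
by apply: (@y_twice i j) => //; [apply: contraTneq ya => ->; rewrite (adjxx satH) | rewrite adjC].
Qed.

Lemma wt_y i : 2 <= wt H l (y i).
Proof.
have [j] := exists_notin (isT : size [:: i] < 3); rewrite inE => ji.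
have [k [kj ki]] := third ji; rewrite eq_sym in ji; rewrite eq_sym in ki.
rewrite eq_sym in kj; have := wt_ge2 l (adj_yy ji) (adj_yy ki) (adj_ne satH (adj_yy kj)).
by rewrite !score_eq ?l_X ?imset_f.
Qed.

Lemma wt_adj v i : v \notin X -> e (y i) v -> 2 <= wt H l v.
Proof.
move=> vX yv; have vy : e v (y i) by rewrite adjC.
by apply: leq_trans (wt_ge1 l vy); rewrite score_lt // l_X ?imset_f // (l_adj vX yv).
Qed.

Lemma adj_in4 v i : v \notin X -> e (y i) v -> in4 v ->
  exists a, [/\ e v a, e (y i) a, a \notin X & ~~ in4 a].
Proof.
move=> vX yv v4; have [a ya va] := walk_y (@in4_neq _ i v4) vX.
by exists a; split; rewrite ?(nbr_in4 va) //; apply: (y_nbr_notin vX va ya); left.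
Qed.

(** The edges to [y i] and to the middle vertex of a walk from [y i] both go down, because the
    fourth part is raised by one level. *)
Lemma wt_adj4 v i : v \notin X -> e (y i) v -> in4 v -> 4 <= wt H l v.
Proof.
move=> vX yv v4; have vy : e v (y i) by rewrite adjC.
have [a [va ya aX a4]] := adj_in4 vX yv v4.
apply: (wt_geD (i := 2) (j := 2) vy va (adj_ne satH ya)).
  by rewrite score_lt // l_X ?imset_f // (l_adj vX yv).
by rewrite score_lt // (l_adj vX yv) (l_adj aX ya) v4 (negPf a4).
Qed.

Lemma far_walk v (i : 'I_3) : v \notin X -> (forall j, ~~ e (y j) v) -> v.1 <> i :> nat ->
  exists a, [/\ e v a, e (y i) a, a \notin X & 2 <= score l v a].
Proof.
move=> vX Nv vi; have [a ya va] := walk_y vi vX.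
have aX : a \notin X by apply: (y_nbr_notin vX va ya); right.
exists a; split=> //; rewrite score_lt // (l_adj aX ya) /l (negPf vX).
by case: existsP => [[j yv]|_]; [case/negP: (Nv j) | case: (in4 a)].
Qed.

(** A vertex not adjacent to [X] needs a separate middle vertex, on a lower level, for each [y i]
    whose leaf lies in another part. With two or three of these the charge is 4 or, in the fourth
    part, 6, which exceeds the budgets 2 and 4: equality leaves no such vertex. *)
Lemma wt_far v (i j : 'I_3) : v \notin X -> (forall j, ~~ e (y j) v) -> i != j ->
  v.1 <> i :> nat -> v.1 <> j :> nat -> 4 <= wt H l v.
Proof.
move=> vX Nv ij vi vj; have [a [va ya aX sa]] := far_walk vX Nv vi.
have [b [vb yb bX sb]] := far_walk vX Nv vj.
apply: (wt_geD (i := 2) (j := 2) va vb) => //; apply: contraNneq aX => ab.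
by rewrite -ab adjC in yb; apply: y_twice ij _ yb; rewrite adjC.
Qed.

Lemma wt_far4 v : v \notin X -> (forall j, ~~ e (y j) v) -> in4 v -> 6 <= wt H l v.
Proof.
move=> vX Nv v4; have w i := far_walk vX Nv (@in4_neq _ i v4).
have [i] := exists_notin (isT : size (Nil 'I_3) < 3).
have [j] := exists_notin (isT : size [:: i] < 3); rewrite inE => ji _.
have [k [kj ki]] := third ji.
have [a [va ya aX sa]] := w i; have [b [vb yb bX sb]] := w j.
have [c [vc yc cX sc]] := w k.
have diff p q u u' : p != q -> e (y p) u -> e (y q) u' -> u \notin X -> u != u'.
  move=> pq pu qu; apply: contraNneq => uu'; rewrite -uu' adjC in qu.
  by apply: y_twice pq _ qu; rewrite adjC.
apply: (wt_geD3 (i := 2) (j := 2) (k := 2) va vb vc) => //.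
rewrite /= !inE negb_or eq_sym (diff j i b a) // [a == c]eq_sym (diff k i c a) //.
by rewrite eq_sym (diff k j c b).
Qed.

(** A column costs 2 + 2 + 2 + 4; the only saving is 2 for each triangle vertex in the fourth
    part. *)
Let m v := if v \in X then 2 else if in4 v then 4 else 2.

Lemma far_pair v : v \notin X -> (forall j, ~~ e (y j) v) -> 4 <= wt H l v.
Proof.
move=> vX Nv; have [v4|v4] := boolP (in4 v).
  exact: leq_trans (wt_far4 vX Nv v4).
have [i] := exists_notin (isT : size [:: inord v.1 : 'I_3] < 3).
rewrite inE => vi; have vi' : v.1 <> i :> nat by move=> E; rewrite E inord_val eqxx in vi.
have [j [ji jv]] := third vi; rewrite eq_sym in ji.
by apply: (wt_far vX Nv ji vi') => E; rewrite E inord_val eqxx in jv.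
Qed.

Lemma m_le_wt v : m v <= wt H l v.
Proof.
rewrite /m; case: ifP => [/imsetP[i _ ->]|/negbT vX]; first exact: wt_y.
have [/existsP[i yv]|/existsPn Nv] := boolP [exists i, e (y i) v].
  by case: ifP => v4; [apply: wt_adj4 vX yv v4 | apply: wt_adj vX yv].
by apply: leq_trans (far_pair vX Nv); case: ifP.
Qed.

Let X4 := [set v in X | in4 v].

Lemma sum_m3 : \sum_v m v + 2 * #|X4| = 10 * n.
Proof.
have -> : 2 * #|X4| = \sum_v (if v \in X4 then 2 else 0).
  by rewrite -big_mkcond sum_nat_const mulnC.
rewrite -big_split /= (eq_bigr (fun v => if in4 v then 4 else 2)); last first.
  by move=> v _; rewrite /m inE; case: (v \in X) => //; case: (in4 v).
rewrite (sum_part n (fun i => if (i : nat) == 3 then 4 else 2)) mulnC; congr (_ * _).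
by rewrite !big_ord_recl big_ord0.
Qed.

(** A triangle has at most one vertex in a part; with none in the fourth part the charges would
    reach [10 * n]. *)
Lemma card_X4 : #|X4| = 1.
Proof.
apply/eqP; rewrite eqn_leq; apply/andP; split.
  apply/card_le1_eqP => u v; rewrite !inE.
  move=> /andP[/imsetP[i _ ->] i4] /andP[/imsetP[j _ ->] j4].
  have [->//|ij] := eqVneq i j.
  by have := nbr_in4 (adj_yy ij) i4; rewrite j4.
rewrite lt0n; apply: contraTneq H_small => X0; have := sum_m3.
rewrite X0 muln0 addn0 -ltnNge -(sum_wt l (simple_sat satH)) => sm.
apply: leq_trans (_ : 10 * n <= _); first by move: hn; clear; lia.
by rewrite -sm; apply: leq_sum => v _; apply: m_le_wt.
Qed.

Lemma y_in4 : exists i, in4 (y i).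
Proof.
have /card_gt0P[v] : 0 < #|X4| by rewrite card_X4.
by rewrite inE => /andP[/imsetP[i _ ->]]; exists i.
Qed.

Lemma wt_m v : wt H l v = m v.
Proof.
apply: (sum_tight m_le_wt); rewrite (sum_wt _ (simple_sat satH)).
apply: leq_trans H_small _; have := sum_m3; rewrite card_X4.
by move: (\sum_v m v); clear; lia.
Qed.

Lemma adj_y v : v \notin X -> exists i, e v (y i).
Proof.
move=> vX; have [/existsP[i yv]|/existsPn Nv] := boolP [exists i, e (y i) v].
  by exists i; rewrite adjC.
have := wt_m v; rewrite /m (negPf vX); case: ifP => v4.
  by move=> w4; have := wt_far4 vX Nv v4; rewrite w4.
by move=> w2; have := far_pair vX Nv; rewrite w2.
Qed.

Lemma l_notin v : v \notin X -> l v = 1 + in4 v.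
Proof. by move=> vX; have [i vy] := adj_y vX; rewrite (l_adj (i := i)) // adjC. Qed.

(** The charge 2 of [v] is spent on [y i], so any other neighbour is on a higher level, that is, in
    the fourth part. *)
Lemma nbr_not4 v u i : v \notin X -> ~~ in4 v -> e v (y i) -> e v u ->
  u != y i -> u \notin X /\ in4 u.
Proof.
move=> vX v4 vy vu nu; have uX : u \notin X.
  apply: contra vX => /imsetP[j _ uj]; rewrite uj in vu nu.
  by apply: y_twice vu vy; apply: contraNneq nu => ->.
split=> //; apply/negPn/negP => u4; rewrite eq_sym in nu.
have sy : 2 <= score l v (y i) by rewrite score_lt // l_X ?imset_f // l_notin.
have su : 1 <= score l v u by rewrite score_gt0 // !l_notin // (negPf v4) (negPf u4).
have := wt_geD vy vu nu sy su; rewrite wt_m /m (negPf vX) (negPf v4) //.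
Qed.

Lemma nbrs_in4 v : v \notin X -> in4 v -> exists i a,
  [/\ e v (y i), e (y i) a, a \notin X, e v a & nbhd H v = [set y i; a]].
Proof.
move=> vX v4; have [i vy] := adj_y vX; have yv := vy; rewrite adjC in yv.
have [a [va ya aX a4]] := adj_in4 vX yv v4; exists i, a; split=> //.
have nya := adj_ne satH ya.
apply/setP => u; rewrite in_nbhd !inE; apply/idP/orP => [vu|[]/eqP->//].
have [|nuy] := eqVneq u (y i); first by left.
have [|nua] := eqVneq u a; first by right.
have us : uniq [:: y i; a; u] by rewrite /= !inE negb_or nya eq_sym nuy eq_sym nua.
have sy : 2 <= score l v (y i) by rewrite score_lt // l_X ?imset_f // l_notin.
have sa : 2 <= score l v a by rewrite score_lt // !l_notin // v4 (negPf a4).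
have su : 1 <= score l v u.
  rewrite score_gt0 // (l_notin vX) v4; have [uX|uX] := boolP (u \in X).
    by rewrite l_X.
  by rewrite l_notin // (negPf (nbr_in4 vu v4)).
by have := wt_geD3 vy va vu us sy sa su; rewrite wt_m /m (negPf vX) v4.
Qed.

Let I (i : 'I_3) := [set v : vertex n | (nbhd H v == [set y i]) && ((v.1 : nat) == i)].
Let W := ~: (\bigcup_i I i :|: X).

Lemma in_W v : v \in W -> v \notin X /\ forall i, v \notin I i.
Proof.
rewrite !inE => /norP[vI vX]; split=> // i; apply: contra vI => vI.
by apply/bigcupP; exists i.
Qed.

Lemma notin_X_W v : v \notin X -> (forall i, ~ leaf H v (y i)) -> v \in W.
Proof.
move=> vX Nv; rewrite inE in_setU negb_or vX andbT.
by apply/bigcupP => -[i _]; rewrite inE => /andP[/eqP/Nv].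
Qed.

Lemma leaf_partE v i : v \notin X -> leaf H v (y i) -> v.1 = i :> nat.
Proof.
move=> vX vy; apply/eqP/negPn/negP => /eqP vi.
have [a ya] := walk_y vi vX; move/(leaf_eq vy) => ay.
by rewrite ay (adjxx satH) in ya.
Qed.

Lemma y_uniq i j v : v \notin X -> e v (y i) -> e v (y j) -> i = j.
Proof.
move=> vX vi vj; apply/eqP/negPn/negP => ij.
by rewrite (y_twice ij vi vj) in vX.
Qed.

(** The charge 4 is used up by [y i] and [a]. Another neighbour of [a] in the fourth part would also
    hang from [y i] and close a 4-cycle with [v]. *)
Lemma mate4 v : v \notin X -> in4 v -> exists i a,
  [/\ v \in W, a \in W, nbhd H v = [set y i; a] & nbhd H a = [set y i; v]].
Proof.
move=> vX v4; have [i [a [vy ya aX va Nv]]] := nbrs_in4 vX v4.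
have ay := ya; rewrite adjC in ay; have av := va; rewrite adjC in av.
have a4 := nbr_in4 va v4; have nvy := y_notin i vX.
have noleaf u w : w \notin X -> e u w -> forall j, ~ leaf H u (y j).
  by move=> wX uw j uy; rewrite (leaf_eq uy uw) imset_f in wX.
have vW : v \in W by apply: notin_X_W vX (noleaf v a aX va).
have aW : a \in W by apply: notin_X_W aX (noleaf a v vX av).
exists i, a; split=> //.
apply/setP => w; rewrite in_nbhd !inE; apply/idP/orP => [aw|[]/eqP->//].
have [|nwy] := eqVneq w (y i); first by left.
have [wX w4] := nbr_not4 aX a4 ay aw nwy.
have [i' [a' [wy' ya' aX' wa' Nw]]] := nbrs_in4 wX w4.
have : a \in nbhd H w by rewrite in_nbhd adjC.
rewrite Nw !inE (negPf (y_notin i' aX)) /= => /eqP aa'; right.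
rewrite -aa' adjC in ya'; have ii := y_uniq aX ay ya'; rewrite -ii in wy'.
apply/negPn/negP => nwv; rewrite adjC in aw; have := y_notin i aX.
by rewrite (common_nbr satH aw va wy' vy nwv) eqxx.
Qed.

Lemma mate v : v \in W -> exists i u,
  [/\ u \in W, nbhd H v = [set y i; u], nbhd H u = [set y i; v] & in4 v || in4 u].
Proof.
case/in_W=> vX vI; have [v4|v4] := boolP (in4 v).
  by have [i [a [_ aW Nv Na]]] := mate4 vX v4; exists i, a.
have [i vy] := adj_y vX.
have [u /andP[vu nuy]|no] := pickP (fun u => e v u && (u != y i)); last first.
  have vleaf : leaf H v (y i).
    by apply: leafI => // u vu; apply/eqP; have := no u; rewrite vu /= => /negbFE.
  by case/negP: (vI i); rewrite inE (leaf_partE vX vleaf) eqxx; apply/andP; split; apply/eqP.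
have [uX u4] := nbr_not4 vX v4 vy vu nuy.
have [j [a [uW aW Nu Na]]] := mate4 uX u4; exists j, u.
have va : v = a.
  have : v \in nbhd H u by rewrite in_nbhd adjC.
  by rewrite Nu !inE (negPf (y_notin j vX)) => /eqP.
by rewrite va u4 orbT.
Qed.

Lemma W_notin_X v : v \in W -> v \notin X.
Proof. by case/in_W. Qed.

Lemma nbhd_W v i u : u \in W -> nbhd H v = [set y i; u] ->
  nbhd H v :&: X = [set y i] /\ nbhd H v :&: W = [set u].
Proof.
move=> uW ->; have uX := W_notin_X uW.
have yX : y i \in X by apply: imset_f.
have yW : y i \notin W by apply/negP => /W_notin_X; rewrite yX.
have nuy : (u == y i) = false by apply: contraNF yW => /eqP<-.
split; apply/setP => w; rewrite in_setI in_set2 in_set1.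
  have [->|nwy] := eqVneq w (y i); first by rewrite yX.
  by have [->|] := eqVneq w u; rewrite ?(negPf uX).
have [->|nwy] := eqVneq w (y i); first by rewrite (negPf yW) eq_sym nuy.
by have [->|] := eqVneq w u; rewrite ?uW.
Qed.

Lemma in_I i v : v \in I i -> nbhd H v = [set y i] /\ v.1 = i :> nat.
Proof. by rewrite inE => /andP[/eqP-> /eqP->]. Qed.

Lemma nbhd_X i : nbhd H (y i) :&: X = X :\ y i.
Proof.
apply/setP => u; rewrite in_setI in_setD1 andbC; have [/imsetP[j _ ->]|] := boolP (u \in X).
  rewrite in_nbhd (inj_eq y_inj) /= eq_sym andbT.
  by have [->|/adj_yy//] := eqVneq i j; rewrite (adjxx satH).
by rewrite andbF.
Qed.

Lemma card_nbhd_X i : #|nbhd H (y i) :&: X| = 2.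
Proof.
by have := cardsD1 (y i) X; rewrite nbhd_X card_X imset_f //= add1n => -[<-].
Qed.

Lemma I_notin_X i v : v \in I i -> v \notin X.
Proof.
case/in_I=> Nv vi; apply/imsetP => -[j _ vj].
have : #|nbhd H (y j) :&: X| <= 1.
  by rewrite -vj Nv (leq_trans (subset_leq_card (subsetIl _ _))) ?cards1.
by rewrite card_nbhd_X.
Qed.

Lemma card_H : 2 * #|H| = 10 * n - 2.
Proof.
rewrite -(sum_wt l (simple_sat satH)) (eq_bigr m) => [|v _]; last exact: wt_m.
by have := sum_m3; rewrite card_X4; move: (\sum_v m v); clear; lia.
Qed.

(** Two counts of the edges: [card_H] from the charges, and [sum_core], where each vertex of [W]
    contributes 1 for its mate. They give [2 * n - 2] vertices in [W]; the triangle takes 3 of the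
    other vertices. *)
Lemma sum_I : \sum_i #|I i| = 2 * n - 1.
Proof.
have disjI i j : i != j -> [disjoint I i & I j].
  move=> ij; rewrite -setI_eq0; apply/set0Pn => -[v]; rewrite in_setI => /andP[].
  by move=> /in_I[_ vi] /in_I[_ vj]; move: ij; rewrite -val_eqE /= -vi -vj eqxx.
have -> : \sum_i #|I i| = #|\bigcup_i I i|.
  rewrite -sum1_card partition_disjoint_bigcup; last exact: disjI.
  by apply: eq_bigr => i _; rewrite sum1_card.
have cU : #|\bigcup_i I i :|: X| = #|\bigcup_i I i| + 3.
  rewrite cardsU card_X (_ : _ :&: _ = set0) ?cards0 ?subn0 //; apply/setP => v.
  rewrite in_setI in_set0; apply/negP => /andP[/bigcupP[i _ /I_notin_X vX]].
  by rewrite (negPf vX).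
have cT := cardsC (\bigcup_i I i :|: X); rewrite cU -/W card_prod !card_ord in cT.
have NX v : #|nbhd H v :&: X| = if v \in X then 2 else 1.
  case: ifP => [/imsetP[i _ ->]|/negbT vX].
    exact: card_nbhd_X.
  have [i vy] := adj_y vX; apply/eqP/cards1P; exists (y i); apply/setP => u.
  rewrite in_setI in_set1 in_nbhd; apply/andP/eqP => [[vu /imsetP[j _ uj]]|->].
    by rewrite uj in vu *; rewrite (y_uniq vX vu vy).
  by rewrite vy imset_f.
have := sum_core (simple_sat satH) NX.
have -> : \sum_(v | v \notin X) #|nbhd H v :\: X| = #|W|.
  rewrite -sum1_card big_mkcond [RHS]big_mkcond; apply: eq_bigr => v _ /=.
  have [vW|vW] := boolP (v \in W).
    have [i [a [aW Nv _ _]]] := mate vW; rewrite W_notin_X //.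
    have [NvX _] := nbhd_W aW Nv; rewrite cardsD NvX Nv cards1 cards2.
    by rewrite eq_sym (y_notin i (W_notin_X aW)).
  case: ifP => // vX; move: vW; rewrite in_setC negbK in_setU (negPf vX) orbF.
  case/bigcupP=> i _ /in_I[-> _]; rewrite cardsD cards1.
  by rewrite (setIidPl _) ?cards1 // sub1set imset_f.
rewrite card_H card_prod !card_ord; move: cT hn; clear.
by move: #|W| #|\bigcup_i I i| => w c; lia.
Qed.

(** The triangle misses exactly one part. The hypothesis makes it the first, as family 1 prescribes;
    a permutation of the parts achieves this later. *)
Lemma three_parts_family1 : (forall i, (y i).1 <> 0 :> nat) -> family1 H.
Proof.
move=> y0; split; first exact: sat_sub satH.
exists y, I => XX /=; rewrite -/W -/X.
split.
- split.
    apply/subsetP => _ /imsetP[i _ ->]; have := y0 i; rewrite !inE !eqSS.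
    by case: (y i).1 => [[|[|[|[|]]]]].
  apply/(triangle_onP _ (simple_sat satH)); split; first exact: card_X.
  move=> _ _ /imsetP[i _ ->] /imsetP[j _ ->] ij; apply: adj_yy.
  by apply: contraNneq ij => ->.
- split.
  + move=> i; split; first by apply/set0Pn; exists (x i); rewrite inE xy xp !eqxx.
    by apply/subsetP => v /in_I[_ vi]; rewrite inE vi.
  + exact: sum_I.
  by move=> i v /in_I[].
- move=> u uW; have [i [a [aW Nu _ _]]] := mate uW.
  have [NX NW] := nbhd_W aW Nu; rewrite NX NW !cards1 /deg Nu cards2; split=> //.
  by rewrite eq_sym (memPn (_ : y i \notin W)) //; apply/negP => /W_notin_X; rewrite imset_f.
- apply/one_regular_onP => u uW; have [i [a [aW Nu _ _]]] := mate uW.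
  by exists a; have [] := nbhd_W aW Nu.
move=> u v uW vW uv; have [i [a [aW Nu Na u4a]]] := mate uW.
have av : v = a.
  have : v \in nbhd H u :&: W by rewrite in_setI in_nbhd uv vW.
  by have [_ ->] := nbhd_W aW Nu; rewrite in_set1 => /eqP.
rewrite av; split.
- by case/orP: u4a => k4; [left | right]; rewrite inE eqSS.
- by apply/set0Pn; exists (y i); rewrite inE Nu Na !inE eqxx.
apply/subsetP => w; rewrite inE Nu Na !inE => /andP[/orP[/eqP->|/eqP->]]; first by rewrite imset_f.
rewrite (negPf (y_notin i _)) ?W_notin_X //= => /eqP au.
by have := adj_ne satH uv; rewrite av au eqxx.
Qed.

End ThreeParts.

(** * Leaves in two parts *)

Section TwoParts.

Variables (n : nat) (H : graph (vertex n)).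
Hypothesis satH : saturated (K4 n) C4 H.
Implicit Types (a h u v w z : vertex n) (b : bool).
Local Notation e := (adj H).
Local Notation Q v := (1 < (v.1 : nat)).
Variables x y : bool -> vertex n.
Hypotheses (xy : forall b, leaf H (x b) (y b)) (xp : forall b, (x b).1 = b :> nat).
Hypothesis NL : forall v, Q v -> forall z, ~ leaf H v z.
Hypothesis H_small : 2 * #|H| <= 10 * n - 2.
Hypothesis hn : 2 <= n.

Definition core v := (v == y false) || (v == y true).
(** The apex of a triangle on the root edge. There is at most one; whether it exists separates the
    cases below. *)
Definition top v := e (y false) v && e (y true) v.

Let l v := if core v then 0 else if e (y false) v || e (y true) v then 1 else 2.

Lemma coreP v : reflect (exists b, v = y b) (core v).
Proof.
apply: (iffP orP) => [[]/eqP->|[[] ->]]; [by exists false | by exists true | |];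
  by [right | left].
Qed.

Lemma core_y b : core (y b).
Proof. by apply/coreP; exists b. Qed.

Lemma noncore v b : ~~ core v -> v != y b.
Proof. by apply: contraNneq => ->; apply: core_y. Qed.

Lemma topP v : reflect (forall b, e (y b) v) (top v).
Proof. by apply: (iffP andP) => [[? ?] []|tv]. Qed.

Lemma top_split v b : e (y b) v -> ~~ top v -> ~~ e (y (~~ b)) v.
Proof. by rewrite /top; case: b => /= ->; rewrite ?andbT. Qed.

Lemma adj_yy2 b : e (y b) (y (~~ b)).
Proof.
apply: leaf_leaf satH (xy b) (xy (~~ b)) _.
by apply/eqP => /(congr1 val); rewrite /= !xp; case: b.
Qed.

Lemma y_neq b : y b != y (~~ b).
Proof. exact: (adj_ne satH (adj_yy2 b)). Qed.

Lemma top_uniq u v : top u -> top v -> u = v.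
Proof.
move=> /topP tu /topP tv.
exact: (common_nbr satH (tu false) (tu true) (tv false) (tv true) (y_neq false)).
Qed.

Lemma top_noncore v : top v -> ~~ core v.
Proof.
by move=> /topP tv; apply/coreP => -[b vb]; have := tv b; rewrite vb (adjxx satH).
Qed.

Lemma walk_y2 b v : v.1 <> b :> nat -> v != y b -> exists2 a, e (y b) a & e v a.
Proof.
move=> vb vy; have vx : v.1 != (x b).1.
  by apply/eqP => /(congr1 val); rewrite /= xp.
by have [a ya av] := leaf_walk satH (xy b) vx vy; exists a; rewrite // adjC.
Qed.

Lemma Q_neq b v : Q v -> v.1 <> b :> nat.
Proof. by move=> + vb; rewrite vb; case: b vb. Qed.

Lemma l_le2 v : l v <= 2.
Proof. by rewrite /l; do 2?case: ifP. Qed.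

Lemma l_core b : l (y b) = 0.
Proof. by rewrite /l core_y. Qed.

Lemma l1 v b : ~~ core v -> e (y b) v -> l v = 1.
Proof. by rewrite /l => /negPf->; case: b => ->; rewrite ?orbT. Qed.

Lemma l1_inv v : l v = 1 -> ~~ core v /\ exists b, e (y b) v.
Proof.
rewrite /l; case: ifP => // _; case: ifP => // /orP[yv|yv] _; split=> //.
  by exists false.
by exists true.
Qed.

Lemma l2_inv v : l v = 2 -> ~~ core v /\ forall b, ~~ e (y b) v.
Proof.
by rewrite /l; case: ifP => // _; case: ifP => // /norP[? ?] _; split=> // -[].
Qed.

Lemma l_cases v : ~~ core v -> l v = 1 \/ l v = 2.
Proof. by rewrite /l => /negPf->; case: ifP; [left | right]. Qed.

Lemma l2_nbr v u : l v = 2 -> e v u -> ~~ core u.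
Proof.
case/l2_inv=> _ Nv vu; apply/coreP => -[b ub].
by have := Nv b; rewrite -ub adjC vu.
Qed.

Lemma l2_walk v b : l v = 2 -> v.1 <> b :> nat ->
  exists a, [/\ e v a, e (y b) a, l a = 1 & score l v a = 2].
Proof.
move=> lv vb; have [vC _] := l2_inv lv.
have [a ya va] := walk_y2 vb (noncore b vC).
have la := l1 (l2_nbr lv va) ya.
by exists a; rewrite score_lt // la lv.
Qed.

Lemma some_side v : exists b, v.1 <> b :> nat.
Proof. by case: v => [[[|[|k]]] ?] ?; [exists true | exists false | exists false]. Qed.

Lemma l1_Q v b : l v = 1 -> e (y b) v -> ~~ top v -> v.1 <> b :> nat ->
  exists a, [/\ e v a, e (y b) a & l a = 1].
Proof.
move=> lv yv Tv vb; have [vC _] := l1_inv lv.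
have [a ya va] := walk_y2 vb (noncore b vC); exists a; split=> //.
apply: (l1 _ ya); apply/coreP => -[b' ab]; rewrite ab in va ya.
have b'b : b' = ~~ b.
  by case: eqP (adj_ne satH ya) => // ; case: b b' {yv vb ab va ya} => [] [].
by have := top_split yv Tv; rewrite -b'b adjC va.
Qed.

(** Relative to [2 + Q v], which costs 10 per column, each core vertex saves 1, the apex adds 2, and
    each of these vertices in the last two parts saves 1 more. *)
Let m v := if core v then 1 else if top v then 4 else 2 + Q v.

Lemma m2_le_wt v : m v <= wt H l v.
Proof.
rewrite /m; case: ifP => [/coreP[b ->]|/negbT vC].
  by apply: leq_trans (wt_ge1 l (adj_yy2 b)); rewrite score_gt0 // !l_core.
have sy b : l v = 1 -> 2 <= score l v (y b).
  by move=> lv; rewrite score_lt // l_core lv.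
case: ifP => [/topP tv|/negbT Tv].
  have lv := l1 vC (tv false).
  have v1 : e v (y false) by rewrite adjC.
  have v2 : e v (y (~~ false)) by rewrite adjC.
  exact: (wt_geD (i := 2) (j := 2) v1 v2 (y_neq false) (sy _ lv) (sy _ lv)).
case: (l_cases vC) => lv.
  have [_ [b yv]] := l1_inv lv; have vy : e v (y b) by rewrite adjC.
  have [vQ|vQ] := boolP (Q v); last first.
    by rewrite addn0; apply: leq_trans (sy b lv) (wt_ge1 l vy).
  have [a [va ya la]] := l1_Q lv yv Tv (@Q_neq b v vQ).
  apply: (wt_geD (i := 2) (j := 1) vy va (adj_ne satH ya) (sy b lv)).
  by rewrite score_gt0 // la lv.
have [b vb] := some_side v; have [a [va ya la sa]] := l2_walk lv vb.
have [vQ|vQ] := boolP (Q v); last by have := wt_ge1 l va; rewrite sa addn0.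
have [c vc nca] := nonleaf_nbr (NL vQ) va; rewrite eq_sym in nca.
apply: (wt_geD (i := 2) (j := 1) va vc nca); first by rewrite sa.
by rewrite score_gt0 // lv l_le2.
Qed.

Let XQ := [set v | (core v || top v) && Q v].
Let Tp := [set v | top v].

Lemma adj_X u v : core u || top u -> core v || top v -> u != v -> e u v.
Proof.
case/orP=> [/coreP[b ->]|tu]; case/orP=> [/coreP[c ->]|tv].
- by case: b c => [] []; rewrite ?eqxx // => _; [apply: (adj_yy2 true) | apply: (adj_yy2 false)].
- by move/topP: tv.
- by rewrite adjC; move/topP: tu.
by rewrite (top_uniq tu tv) eqxx.
Qed.

(** Otherwise the walk of length 2 from [y (~~ b)] to [y b] passes through a common neighbour of the
    two. *)
Lemma notop_part b : (forall v, ~~ top v) -> (y b).1 = ~~ b :> nat.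
Proof.
move=> Nt; apply/eqP/negPn/negP => /eqP yb.
have [a ya yba] := walk_y2 yb (y_neq b); have := Nt a; case/negP; apply/topP.
by case: b yb ya yba => _ /= ya yba [].
Qed.

(** Without an apex the root edge joins the first two parts. With one, the triangle has at most two
    vertices in two parts. So the extra savings never outweigh what the apex adds. *)
Lemma card_XQ_le : #|XQ| <= 2 * #|Tp|.
Proof.
have [T0|/set0Pn[t]] := eqVneq Tp set0.
  have Nt v : ~~ top v by have := in_set0 v; rewrite -T0 inE => ->.
  rewrite T0 cards0 leqn0 cards_eq0; apply/eqP/setP => v; rewrite !inE (negPf (Nt v)) orbF.
  by apply/negP => /andP[/coreP[b ->]]; rewrite notop_part //; case: b.
rewrite inE => tt; have -> : Tp = [set t].
  by apply/setP => v; rewrite !inE; apply/idP/eqP => [tv|->] //; apply: top_uniq.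
rewrite cards1 -(card_in_imset (f := fun v : vertex n => v.1)) => [|u v]; last first.
  rewrite !inE => /andP[uX uQ] /andP[vX vQ] uv; apply/eqP/negPn/negP => nuv.
  by have := adj_part satH (adj_X uX vX nuv); rewrite uv eqxx.
apply: leq_trans (_ : #|[set i : 'I_4 | 1 < i]| <= _).
  by apply/subset_leq_card/subsetP => _ /imsetP[v + ->]; rewrite !inE => /andP[].
rewrite -sum1_card (eq_bigl (fun i : 'I_4 => 1 < i)) => [|i]; last by rewrite inE.
by rewrite big_mkcond !big_ord_recl big_ord0.
Qed.

Lemma sum_m2 : \sum_v m v + 2 + #|XQ| = 10 * n + 2 * #|Tp|.
Proof.
have c2 : #|[set v | core v]| = 2.
  have -> : [set v | core v] = [set y false; y true] by apply/setP => v; rewrite !inE.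
  by rewrite cards2 (y_neq false).
have cS (A : {set vertex n}) : #|A| = \sum_v (v \in A).
  by rewrite -sum1_card big_mkcond; apply: eq_bigr => v _; case: (v \in A).
rewrite -[X in _ + X + _]c2 !cS big_distrr -!big_split /=.
have -> : 10 * n = \sum_(v : vertex n) (2 + Q v).
  rewrite (sum_part n (fun i : 'I_4 => 2 + (1 < i))) mulnC; congr (_ * _).
  by rewrite !big_ord_recl big_ord0.
rewrite -big_split; apply: eq_bigr => v _; rewrite !inE /m.
by case: (core v) (top v) (Q v) (@top_noncore v) => [] [] [] // /(_ isT).
Qed.

Lemma sum_m2_le : \sum_v m v <= 2 * #|H|.
Proof. by rewrite -(sum_wt l (simple_sat satH)); apply: leq_sum => v _; apply: m2_le_wt. Qed.

Lemma card_XQ : #|XQ| = 2 * #|Tp|.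
Proof.
have := sum_m2_le; have := sum_m2; have := card_XQ_le; move: H_small hn; clear.
by move: (\sum_v m v) #|XQ| #|Tp| #|H|; lia.
Qed.

Lemma wt_m2 v : wt H l v = m v.
Proof.
apply: (sum_tight m2_le_wt); rewrite (sum_wt _ (simple_sat satH)).
apply: leq_trans H_small _; have := sum_m2; rewrite card_XQ.
by move: (\sum_v m v) #|Tp|; clear; lia.
Qed.

Lemma card_H2 : 2 * #|H| = 10 * n - 2.
Proof.
have := sum_m2_le; have := sum_m2; rewrite card_XQ; move: H_small hn; clear.
by move: (\sum_v m v) #|Tp| #|H|; lia.
Qed.

(** The exact charge 2 is spent on the lower neighbour [w]. In the next two lemmas the charge is at
    most 3: it leaves room for one more edge that is not upward, but not for two edges down. *)
Lemma low_nbr_nonQ v u w : ~~ core v -> ~~ top v -> ~~ Q v ->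
  e v u -> e v w -> l u <= l v -> l w < l v -> u = w.
Proof.
move=> vC vT vQ vu vw lu lw; apply/eqP/negPn/negP => nuw.
have su : 1 <= score l v u by rewrite score_gt0.
have sw : 2 <= score l v w by rewrite score_lt.
have := wt_geD vu vw nuw su sw; rewrite wt_m2 /m (negPf vC) (negPf vT) (negPf vQ).
by [].
Qed.

Lemma low_nbr_Q v u u' w : ~~ core v -> ~~ top v ->
  e v u -> e v u' -> e v w -> l u <= l v -> l u' <= l v -> l w < l v ->
  u != w -> u' != w -> u = u'.
Proof.
move=> vC vT vu vu' vw lu lu' lw nuw nuw'; apply/eqP/negPn/negP => nuu'.
have us : uniq [:: u; u'; w] by rewrite /= !inE negb_or nuw nuw' nuu'.
have su : 1 <= score l v u by rewrite score_gt0.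
have su' : 1 <= score l v u' by rewrite score_gt0.
have sw : 2 <= score l v w by rewrite score_lt.
have := wt_geD3 vu vu' vw us su su' sw; rewrite wt_m2 /m (negPf vC) (negPf vT).
by case: (Q v).
Qed.

Lemma up_nbr_uniq v u w : ~~ core v -> ~~ top v ->
  e v u -> e v w -> l u < l v -> l w < l v -> u = w.
Proof.
move=> vC vT vu vw lu lw; apply/eqP/negPn/negP => nuw.
have su : 2 <= score l v u by rewrite score_lt.
have sw : 2 <= score l v w by rewrite score_lt.
have := wt_geD vu vw nuw su sw; rewrite wt_m2 /m (negPf vC) (negPf vT).
by case: (Q v).
Qed.

Lemma top_nbr t u : top t -> e t u -> l u <= 1 -> core u.
Proof.
move=> tt tu lu; apply/negPn/negP => uC; have tC := top_noncore tt.
move/topP: (tt) => yt; have lt := l1 tC (yt false).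
have n1 := noncore false uC; have n2 := noncore true uC.
have t1 : e t (y false) by rewrite adjC.
have t2 : e t (y true) by rewrite adjC.
have us : uniq [:: u; y false; y true].
  by rewrite /= !inE negb_or n1 n2 (y_neq false).
have su : 1 <= score l t u by rewrite score_gt0 // lt.
have s b : 2 <= score l t (y b) by rewrite score_lt // lt l_core.
by have := wt_geD3 tu t1 t2 us su (s _) (s _); rewrite wt_m2 /m (negPf tC) tt.
Qed.

Lemma l_top t : top t -> l t = 1.
Proof. by move=> tt; apply: (l1 (b := false) (top_noncore tt)); apply: (topP t tt). Qed.

Lemma l2_free v : l v = 2 -> ~~ core v && ~~ top v.
Proof.
move=> lv; have [-> _] := l2_inv lv; apply/negP => /l_top; by rewrite lv.
Qed.

Lemma l2_Q v : l v = 2 -> Q v -> exists2 t, top t & e v t.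
Proof.
move=> lv vQ; have /andP[vC vT] := l2_free lv.
have [a [va ya la _]] := l2_walk lv (@Q_neq false v vQ).
have [a' [va' ya' la' _]] := l2_walk lv (@Q_neq true v vQ).
have aa' : a = a' by apply: (up_nbr_uniq vC vT va va'); rewrite lv ?la ?la'.
by rewrite -aa' in ya'; exists a => //; apply/topP => -[].
Qed.

Lemma Q_triangle u v w : e u v -> e v w -> e u w -> Q u -> Q v -> Q w -> False.
Proof.
move=> /(adj_part satH) uv /(adj_part satH) vw /(adj_part satH) uw.
move: uv vw uw; rewrite -!val_eqE /=.
have := ltn_ord u.1; have := ltn_ord v.1; have := ltn_ord w.1.
by move: (val u.1) (val v.1) (val w.1) => [|[|[|[|p]]]] [|[|[|[|q]]]] [|[|[|[|r]]]].
Qed.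

(** On level 1 the mate is the middle vertex of a walk from [y b]; outside the last two parts it
    could not afford both edges. On level 2 the walks from both core vertices share their middle
    vertex, the apex, and the mate is a further neighbour, [v] not being a leaf. *)
Lemma Q_mate v : Q v -> ~~ core v -> ~~ top v -> exists h v',
  [/\ [/\ core h || top h, e h v, e h v' & e v v'],
      [/\ Q v', ~~ core v', ~~ top v' & l v' = l v], ~~ Q h
    & forall u, e v u -> [\/ u = h, u = v' | l v < l u]].
Proof.
move=> vQ vC vT.
suff [h [v' [[hX hv hv' vv'] [v'Q v'C v'T lv'] hl]]] : exists h v',
   [/\ [/\ core h || top h, e h v, e h v' & e v v'],
       [/\ Q v', ~~ core v', ~~ top v' & l v' = l v] & l h < l v].
  exists h, v'; split=> //.
    by apply/negP => hQ; apply: (Q_triangle hv vv' hv').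
  move=> u vu; have [|nuh] := eqVneq u h; first by constructor 1.
  have [lu|lu] := leqP (l u) (l v); last by constructor 3.
  constructor 2; rewrite adjC in hv; apply: (low_nbr_Q vC vT vu vv' hv) => //.
    by rewrite lv'.
  by rewrite eq_sym (adj_ne satH hv').
case: (l_cases vC) => lv.
  have [_ [b yv]] := l1_inv lv; have [a [va ya la]] := l1_Q lv yv vT (@Q_neq b v vQ).
  have [aC _] := l1_inv la; have av := va; rewrite adjC in av.
  have ay := ya; rewrite adjC in ay.
  have aT : ~~ top a by apply: contra vC => /top_nbr/(_ av); rewrite lv; apply.
  exists (y b), a; rewrite core_y la lv l_core; split=> //; split=> //.
  apply/negPn/negP => aQ; have := noncore b vC.
  by rewrite (low_nbr_nonQ aC aT aQ av ay) ?lv ?la ?l_core // eqxx.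
have [t tt vt] := l2_Q lv vQ; have [c vc nct] := nonleaf_nbr (NL vQ) vt.
have cC := l2_nbr lv vc; have lt := l_top tt.
have lc : l c = 2.
  case: (l_cases cC) => // lc; case/negP: nct; apply/eqP.
  by apply: (up_nbr_uniq vC vT vc vt); rewrite lv ?lc ?lt.
have /andP[_ cT] := l2_free lc; rewrite adjC in vc.
have cQ : Q c.
  apply/negPn/negP => cQ; have [b cb] := some_side c.
  have [a [ca _ la _]] := l2_walk lc cb; have := lv.
  by rewrite (low_nbr_nonQ cC cT cQ vc ca) ?lv ?lc ?la.
have [t' tt' ct] := l2_Q lc cQ; rewrite (top_uniq tt' tt) in ct.
exists t, c; rewrite tt orbT lc lv lt; split=> //.
by split; rewrite // adjC.
Qed.

Lemma in_VQ v : (v \in V n 3 :|: V n 4) = Q v.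
Proof.
rewrite !inE !eqSS; have := ltn_ord v.1.
by move: (nat_of_ord v.1) => [|[|[|[|k]]]].
Qed.

Lemma Q_free_nbr v w : Q v -> ~~ core v -> ~~ top v -> Q w -> e v w ->
  [/\ ~~ core w, ~~ top w & l w = l v].
Proof.
move=> vQ vC vT wQ vw.
have [h [v' [_ [_ v'C v'T lv'] hQ vE]]] := Q_mate vQ vC vT.
case: (vE w vw) => [wh|->|lvw]; first by rewrite wh (negPf hQ) in wQ.
  by [].
have lv : l v = 1.
  by case: (l_cases vC) => // lv; have := l_le2 w; rewrite leqNgt -[ltnLHS]lv lvw.
have lw : l w = 2 by apply/eqP; rewrite eqn_leq l_le2 -[ltnLHS]lv.
have /andP[wC wT] := l2_free lw; rewrite adjC in vw.
have [h' [w' [[hX _ _ _] [_ _ _ lw'] _ wE]]] := Q_mate wQ wC wT.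
case: (wE v vw) => [vh|vw'|]; last by rewrite lv lw.
  by move: hX; rewrite -vh (negPf vC) (negPf vT).
by move: lw'; rewrite -vw' lv lw.
Qed.

(** By [card_XQ] the core and apex have no vertex or exactly two in the last two parts, and these
    two are matched with each other; [Q_mate] matches the rest. *)
Lemma regular_Q : one_regular_on H (V n 3 :|: V n 4).
Proof.
apply/one_regular_onP => v; rewrite in_VQ => vQ.
have [vX|] := boolP (core v || top v).
  have vXQ : v \in XQ by rewrite inE vX.
  have [u uXQ nuv] : exists2 u, u \in XQ & u != v.
    have : 1 < #|XQ|.
      have : 0 < #|XQ| by apply/card_gt0P; exists v.
      by rewrite card_XQ; case: #|Tp| => // k _; rewrite mulnS.
    by rewrite (cardsD1 v) vXQ ltnS => /card_gt0P[u]; rewrite !inE => /andP[]; exists u;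
      rewrite ?inE.
  have /[!inE]/andP[uX uQ] := uXQ; have uv := adj_X uX vX nuv.
  exists u; apply/setP => w; rewrite in_setI in_VQ in_set1 in_nbhd.
  apply/andP/eqP => [[vw wQ]|->]; last by rewrite adjC.
  have [wX|/norP[wC wT]] := boolP (core w || top w).
    apply/eqP/negPn/negP => nwu.
    by apply: (Q_triangle uv vw _ uQ vQ wQ); rewrite adj_X // eq_sym.
  rewrite adjC in vw; have [vC vT _] := Q_free_nbr wQ wC wT vQ vw.
  by rewrite (negPf vC) (negPf vT) in vX.
case/norP=> vC vT; have [h [v' [[_ _ _ vv'] [v'Q _ _ _] hQ vE]]] := Q_mate vQ vC vT.
exists v'; apply/setP => w; rewrite in_setI in_VQ in_set1 in_nbhd.
apply/andP/eqP => [[vw wQ]|->]; last by [].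
have [_ _ lw] := Q_free_nbr vQ vC vT wQ vw.
by case: (vE w vw) => // [wh|]; [rewrite wh (negPf hQ) in wQ | rewrite lw ltnn].
Qed.

Lemma leaf_l2 v : l v = 2 -> ~~ Q v -> exists2 a, leaf H v a & l a = 1.
Proof.
move=> lv vQ; have [b vb] := some_side v; have [a [va _ la _]] := l2_walk lv vb.
have /andP[vC vT] := l2_free lv; exists a => //; apply: leafI => // u vu.
by apply: (low_nbr_nonQ vC vT vQ vu va); rewrite lv ?l_le2 ?la.
Qed.

Lemma part_nonQ b v : v.1 = b :> nat -> ~~ Q v.
Proof. by move=> ->; case: b. Qed.

(** Hanging from [y (~~ b)] is too expensive: the walk of length 2 from there would give [v] a
    second edge on its level, against the charge 2. *)
Lemma side b v : ~~ core v -> ~~ top v -> v.1 = b :> nat ->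
  e (y b) v \/ exists a, [/\ leaf H v a, l v = 2, l a = 1 & e (y (~~ b)) a].
Proof.
move=> vC vT vb; have vQ := part_nonQ vb.
have vNb : v.1 <> ~~ b :> nat by rewrite vb; case: (b).
case: (l_cases vC) => lv.
  have [_ [b' yv]] := l1_inv lv; have [<-|nb] := eqVneq b' b; first by left.
  have b'E : b' = ~~ b by case: b b' nb {vb vNb yv} => [] [].
  rewrite b'E in yv; have [a [va _ la]] := l1_Q lv yv vT vNb.
  rewrite adjC in yv; have := la.
  by rewrite (low_nbr_nonQ vC vT vQ va yv) ?lv ?la ?l_core.
right; have [a [va ya la _]] := l2_walk lv vNb.
have [a' leaf_v _] := leaf_l2 lv vQ; exists a; split=> //.
by rewrite (leaf_eq leaf_v va).
Qed.

Lemma Q_mate_l1 v b : Q v -> ~~ core v -> ~~ top v -> e (y b) v -> exists v',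
  [/\ e (y b) v', e v v', [/\ Q v', ~~ core v', ~~ top v' & l v' = 1]
    & forall u, e v u -> [\/ u = y b, u = v' | l u = 2]].
Proof.
move=> vQ vC vT yv; have lv := l1 vC yv.
have [h [v' [[hX hv hv' vv'] [v'Q v'C v'T lv'] hQ vE]]] := Q_mate vQ vC vT.
have hy : h = y b.
  case/orP: hX => [/coreP[b' hb']|hT]; last first.
    by case/negP: vC; apply: (top_nbr hT hv); rewrite lv.
  rewrite hb' in hv *; have [->//|nb] := eqVneq b' b.
  have b'E : b' = ~~ b by case: b b' nb {yv hb' hv} => [] [].
  by have := top_split yv vT; rewrite -b'E hv.
rewrite hy in hv' vE; exists v'; split=> //; first by split; rewrite // lv' lv.
move=> u /vE[->|->|]; [by constructor 1 | by constructor 2 | rewrite lv => lu].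
by constructor 3; apply/eqP; rewrite eqn_leq l_le2.
Qed.

Lemma l2_nbr_l1 z u : l z = 2 -> l u = 1 -> e z u -> top u \/ (~~ Q z /\ leaf H z u).
Proof.
move=> lz lu zu; have /andP[zC zT] := l2_free lz.
have [zQ|zQ] := boolP (Q z).
  have [t tt zt] := l2_Q lz zQ; left.
  by rewrite (up_nbr_uniq zC zT zu zt) ?lz ?lu ?(l_top tt).
by right; split=> //; have [a leaf_z _] := leaf_l2 lz zQ; rewrite (leaf_eq leaf_z zu).
Qed.

(** Saturation between the leaf [w] and [u] requires a walk of length 2 from [a] to [u], but [u] is
    only joined to [y b], its mate and level 2. Hence without an apex such a leaf [w] keeps all of
    the last two parts off [y b]. *)
Lemma leaf_far u w a b : Q u -> ~~ core u -> ~~ top u -> e (y b) u ->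
  leaf H w a -> w.1 = b :> nat -> l a = 1 -> e (y (~~ b)) a -> top a.
Proof.
move=> uQ uC uT yu wa wb la ya; have lu := l1 uC yu.
apply/negPn/negP => aT; have Nya : ~~ e (y b) a.
  by rewrite -[b]negbK; apply: top_split ya aT.
have nua : u != a by apply: contraNneq Nya => <-.
have uw : u.1 != w.1.
  by apply/eqP => /(congr1 val) /= uw; rewrite uw wb in uQ; case: (b) uQ.
have [z az zu] := leaf_walk satH wa uw nua; rewrite adjC in zu.
have [u' [yu' uu' [u'Q u'C u'T lu'] uE]] := Q_mate_l1 uQ uC uT yu.
have [aC _] := l1_inv la.
case: (uE z zu) => [zy|zu'|lz].
- by rewrite zy adjC (negPf Nya) in az.
- rewrite zu' in az; rewrite adjC in uu'; rewrite adjC in az; rewrite adjC in yu'.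
  move/eqP: nua; apply; apply: (low_nbr_Q u'C u'T uu' az yu'); rewrite ?lu' ?lu ?la ?l_core //.
    exact: noncore.
  exact: noncore.
rewrite adjC in zu; rewrite adjC in az.
case: (l2_nbr_l1 lz lu zu) => [tu|[_ zleaf]]; first by rewrite tu in uT.
by rewrite (leaf_eq zleaf az) eqxx in nua.
Qed.

(** Families 2 and 3 have a hub in [V 2], which is [hub 1]; a hub in [V 1] is brought there by
    exchanging the two parts. *)
Definition hub (k : nat) := exists h, h.1 = k :> nat /\ forall v, Q v -> e h v.

Lemma in_V k v : (v \in V n k.+1) = ((v.1 : nat) == k).
Proof. by rewrite inE eqSS. Qed.

Lemma notop_case : (forall v, ~~ top v) -> [\/ family4 H, hub 0 | hub 1].
Proof.
move=> Nt; have yp b : (y b).1 = ~~ b :> nat := notop_part b Nt.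
have Qfree v : Q v -> ~~ core v.
  by move=> vQ; apply/coreP => -[b vb]; rewrite vb yp in vQ; case: b vb vQ.
have Q1 v : Q v -> exists b, e (y b) v.
  move=> vQ; case: (l_cases (Qfree v vQ)) => lv; first by have [] := l1_inv lv.
  by have [t tt] := l2_Q lv vQ; have := Nt t; rewrite tt.
(* If both sides hang directly from the root edge, the graph is in family 4. An exception in part
   [b] is a leaf on level 2 and forces the hub [y (~~ b)]. *)
pose side_b b := [forall v : vertex n, (~~ core v) && ((v.1 : nat) == b) ==> e (y b) v].
have hubN b : ~~ side_b b -> hub b.
  case/forallPn=> w; rewrite negb_imply => /andP[/andP[wC /eqP wb] yw].
  case: (side wC (Nt w) wb) => [yw'|[a [wa lw la ya]]]; first by rewrite yw' in yw.
  exists (y (~~ b)); split; first by rewrite yp negbK.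
  move=> u uQ; have [b' yu] := Q1 u uQ; have [bb|nb] := eqVneq b' b; last first.
    by have <- : b' = ~~ b by case: b b' nb {yu wb yw wa ya} => [] [].
  rewrite bb in yu; have := Nt a.
  by rewrite (leaf_far uQ (Qfree u uQ) (Nt u) yu wa wb la ya).
have [s0|] := boolP (side_b false); last by move/hubN; constructor 2.
have [s1|] := boolP (side_b true); last by move/hubN; constructor 3.
have sP b v : ~~ core v -> v.1 = b :> nat -> e (y b) v.
  move=> vC vb; have sb : side_b b by case: b {vb}.
  by move/forallP/(_ v)/implyP: sb; apply; rewrite vC vb eqxx.
have sP' b v : v.1 = b :> nat -> v = y (~~ b) \/ [/\ ~~ core v, v != y (~~ b) & e (y b) v].
  move=> vb; have [vC|vC] := boolP (core v); last first.
    by right; split; rewrite ?noncore ?sP.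
  move/coreP: vC => [b' vE]; left; rewrite vE; congr y; move: vb; rewrite vE yp.
  by case: b b' {vE} => [] [].
constructor 1; split; first exact: sat_sub satH.
(* Without an apex [y b] lies in part [~~ b], so [y true] is the root in [V 1]. *)
exists (y true), (y false); split.
- rewrite !in_V !yp; split=> //; apply/subsetP => v; rewrite in_V in_nbhd => /eqP vb.
    case: (@sP' true v vb) => [->|[_ _ //]]; exact: (adj_yy2 true).
  case: (@sP' false v vb) => [->|[_ _ //]]; exact: (adj_yy2 false).
- exact: regular_Q.
- move=> i v i34 vi; have vQ : Q v.
    by move: i34 vi; rewrite !inE => /orP[]/eqP->; rewrite eqSS => /eqP->.
  have [b yv] := Q1 v vQ; have vC := Qfree v vQ.
  have [v' [yv' vv' [v'Q _ _ _] vE]] := Q_mate_l1 vQ vC (Nt v) yv.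
  have v'i : v' \in V n (7 - i).
    have := adj_part satH vv'; rewrite -val_eqE /= => nvv'; have v'4 := ltn_ord v'.1.
    move: i34 vi; rewrite !inE => /orP[]/eqP->; rewrite eqSS => /eqP vi; move: nvv' v'4 v'Q;
      by rewrite vi; case: (nat_of_ord v'.1) => [|[|[|[|p]]]].
  have Nv : nbhd H v = [set y b; v'].
    apply/setP => u; rewrite in_nbhd in_set2; apply/idP/orP => [vu|[]/eqP->//].
      case: (vE u vu) => [->|->|lu]; [by left | by right |].
      have uQ : ~~ Q u.
        by apply/negP => uQ; have [t tt] := l2_Q lu uQ; have := Nt t; rewrite tt.
      have [uC Nu] := l2_inv lu; have [b' ub'] : exists b' : bool, u.1 = b' :> nat.
        by case: (u.1 : nat) uQ => [|[|]] // _; [exists false | exists true].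
      by have := Nu b'; rewrite sP.
    by rewrite adjC.
  by case: b {yv yv' vE} Nv => Nv; [right | left]; exists v'.
- move=> v v'; rewrite !in_VQ => vQ v'Q vv'; have [b yv] := Q1 v vQ.
  have [w [yw _ _ vE]] := Q_mate_l1 vQ (Qfree v vQ) (Nt v) yv.
  case: (vE v' vv') => [v'y|v'w|lv'].
  + by rewrite v'y yp in v'Q; case: (b) v'Q.
  + apply/set0Pn; exists (y b); rewrite in_setI !in_nbhd ![e _ (y b)]adjC yv v'w.
    exact: yw.
  by have [t tt] := l2_Q lv' v'Q; have := Nt t; rewrite tt.
move=> u w; rewrite !in_V => /eqP u0 /eqP w1 uw.
case: (@sP' false u u0) => [->|[uC _ yu]]; first by left.
case: (@sP' true w w1) => [->|[wC _ yw]]; first by right.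
right; rewrite adjC in yu; apply: (low_nbr_nonQ uC (Nt u) _ uw yu).
- by rewrite u0.
- by rewrite (l1 wC yw) (l1 (b := false) uC) // adjC.
by rewrite l_core (l1 (b := false) uC) // adjC.
Qed.

(** Of the three triangle vertices exactly two lie in the last two parts. The third is the only
    possible apex for the triangles of [Q_mate], hence joined to everything there. *)
Lemma top_case t : top t -> exists h, [/\ core h || top h, ~~ Q h,
  forall v, core v || top v -> ~~ Q v -> v = h & forall v, Q v -> e h v].
Proof.
move=> tt; have tC := top_noncore tt.
have T1 : #|Tp| = 1.
  apply/eqP/cards1P; exists t; apply/setP => v; rewrite !inE.
  by apply/idP/eqP => [tv|-> //]; apply: top_uniq.
have X3 : #|[set v | core v || top v]| = 3.
  have -> : [set v | core v || top v] = [set t; y false; y true].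
    apply/setP => v; rewrite !inE -orbA orbC; congr (_ || _).
    by apply/idP/eqP => [tv|-> //]; apply: top_uniq.
  rewrite -setUA cardsU1 cards2 (y_neq false) !inE negb_or.
  by rewrite (noncore _ tC) (noncore _ tC).
have := cardsID [set v : vertex n | Q v] [set v | core v || top v].
have -> : [set v | core v || top v] :&: [set v : vertex n | Q v] = XQ by apply/setP => v; rewrite !inE.
rewrite X3 card_XQ T1 muln1 add2n => -[] /eqP/cards1P[h hE].
have hP v : core v || top v -> ~~ Q v -> v = h.
  by move=> vX vQ; apply/set1P; rewrite -hE !inE vX vQ.
have : h \in [set h] by rewrite inE.
rewrite -hE !inE => /andP[hQ hX]; exists h; split=> // v vQ.
have [vX|/norP[vC vT]] := boolP (core v || top v).
  by apply: adj_X => //; apply: contraNneq hQ => ->.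
have [h' [v' [[h'X h'v _ _] _ h'Q _]]] := Q_mate vQ vC vT.
by rewrite -(hP h').
Qed.

Lemma two_parts : [\/ family4 H, hub 0 | hub 1].
Proof.
have [t tt|Nt] := pickP top; last by apply: notop_case => v; rewrite Nt.
have [h [_ hQ _ hE]] := top_case tt; move: hQ; case E: (h.1 : nat) => [|[|]] // _.
  by constructor 2; exists h.
by constructor 3; exists h.
Qed.

Lemma free_Q : exists v, [/\ Q v, ~~ core v & ~~ top v].
Proof.
pose v : vertex n := (Ordinal (isT : 2 < 4), (y true).2).
have [u uv nuv] := part_other v hn; have uQ : Q u by rewrite uv.
have [vX|/norP[]] := boolP (core v || top v); last by exists v.
have [uX|/norP[]] := boolP (core u || top u); last by exists u.
by have := adj_part satH (adj_X uX vX nuv); rewrite uv eqxx.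
Qed.

Lemma hub_core h : h.1 = 1 :> nat -> (forall v, Q v -> e h v) ->
  h = y false \/ top h.
Proof.
move=> h1 hE; have [v [vQ vC vT]] := free_Q; have hQ : ~~ Q h by rewrite h1.
have [/coreP[[] hy]|hC] := boolP (core h); [|by left|].
  by have := adj_part satH (leaf_adj (xy true)); rewrite -hy -val_eqE /= xp h1.
have [|hT] := boolP (top h); [by right | exfalso].
have [h' [v' [[h'X h'v h'v' vv'] [v'Q _ _ _] _ vE]]] := Q_mate vQ vC vT.
have vh : e v h by rewrite adjC hE.
case: (vE h vh) => [hh|hv'|lvh].
- by rewrite -hh (negPf hC) (negPf hT) in h'X.
- by rewrite hv' v'Q in hQ.
have lh : l h = 2.
  by case: (l_cases hC) => // lh; case: (l_cases vC) lvh; rewrite lh => ->.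
have [a ha _] := leaf_l2 lh hQ; have := adj_ne satH vv'.
by rewrite (leaf_eq ha (hE v vQ)) (leaf_eq ha (hE v' v'Q)) eqxx.
Qed.

(** The charge 2 goes to [y b]; any other neighbour is on level 2 and has to be a leaf hanging from
    [u]. *)
Lemma leaf_l1 u b : ~~ core u -> ~~ top u -> ~~ Q u -> e (y b) u ->
  (forall w, e u w -> l w = 2 -> ~~ Q w -> leaf H w u -> False) -> leaf H u (y b).
Proof.
move=> uC uT uQ yu no; have lu := l1 uC yu; rewrite adjC in yu.
apply: leafI => // w uw; have [lw|lw] := leqP (l w) 1.
  by apply: (low_nbr_nonQ uC uT uQ uw yu); rewrite ?lu ?l_core.
have {}lw : l w = 2 by apply/eqP; rewrite eqn_leq l_le2.
rewrite adjC in uw; case: (l2_nbr_l1 lw lu uw) => [tu|[wQ wu]].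
  by rewrite tu in uT.
by rewrite adjC in uw; case: (no w).
Qed.

Lemma in_V134 v : (v \in V n 1 :|: V n 3 :|: V n 4) = ((v.1 : nat) != 1).
Proof.
rewrite !inE !eqSS; have := ltn_ord v.1.
by move: (nat_of_ord v.1) => [|[|[|[|k]]]].
Qed.

Lemma leaf_deg u a : leaf H u a -> deg H u = 1.
Proof. by rewrite /deg => ->; rewrite cards1. Qed.

Lemma triangle_X u v w : core u || top u -> core v || top v -> core w || top w ->
  uniq [:: u; v; w] -> triangle_on H [set u; v; w].
Proof.
rewrite /= !inE negb_or => uX vX wX /and3P[/andP[nuv nuw] nvw _].
apply/(triangle_onP _ (simple_sat satH)); split.
  by rewrite -setUA cardsU1 cards2 nvw !inE negb_or nuv nuw.
move=> a b; rewrite !inE => /orP[/orP[]|]/eqP-> /orP[/orP[]|]/eqP-> ?; exact: adj_X.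
Qed.

(** Family 2 arises when the hub is joined to all of [V 1]. Otherwise some vertex of [V 1] is a leaf
    of the apex [t]; then [y true] and [t] lie in the last two parts, as [z] and [w] of family 3. *)
Lemma hub_y : (y false).1 = 1 :> nat -> (forall v, Q v -> e (y false) v) ->
  family2 H \/ family3 H.
Proof.
set Y := y false => Y1 YE; have [f [fQ fC fT]] := free_Q.
have YQ : ~~ Q Y by rewrite Y1.
have far w a : leaf H w a -> w.1 = 0 :> nat -> l a = 1 -> e (y true) a -> top a.
  by move=> wa w0 la ya; apply: (leaf_far (b := false) fQ fC fT (YE f fQ) wa w0 la ya).
have yt1 : (y true).1 <> 1 :> nat.
  by move=> yt; have := adj_part satH (adj_yy2 true); rewrite -val_eqE /= yt Y1.
have YT u v : e Y u -> top v -> u.1 = 1 :> nat -> False.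
  by move=> /(adj_part satH); rewrite -val_eqE /= Y1 => + _ u1; rewrite u1.
have part0 v : v.1 = 0 :> nat -> e Y v \/ exists2 t, top t & leaf H v t.
  move=> v0; have [/coreP[b vb]|vC] := boolP (core v).
    left; rewrite vb; case: b vb => vb; first exact: (adj_yy2 false).
    by move: Y1; rewrite /Y -vb v0.
  have [/topP tv|vT] := boolP (top v); first by left; apply: tv.
  case: (side (b := false) vC vT v0) => [|[a [va _ la ya]]]; first by left.
  by right; exists a => //; apply: far va v0 la ya.
have part1 u : u.1 = 1 :> nat -> u != Y -> leaf H u (y true) \/
    exists a, [/\ leaf H u a, l u = 2, l a = 1 & e Y a].
  move=> u1 nuY; have uC : ~~ core u.
    by apply/coreP => -[[] uy]; [case: yt1; rewrite -uy | rewrite uy eqxx in nuY].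
  have uT : ~~ top u.
    apply/negP => tu; move/topP/(_ false)/(adj_part satH): (tu).
    by rewrite -val_eqE /= Y1 u1.
  have uQ : ~~ Q u by rewrite u1.
  case: (side (b := true) uC uT u1) => [yu|]; last by right.
  left; apply: (leaf_l1 uC uT uQ yu) => w uw lw wQ wu.
  have w0 : w.1 = 0 :> nat.
    have := adj_part satH uw; rewrite -val_eqE /= u1.
    by case: (w.1 : nat) wQ => [|[|]].
  by case/negP: uT; apply: far wu w0 (l1 uC yu) yu.
have [allY|] := boolP [forall v : vertex n, ((v.1 : nat) == 0) ==> e Y v].
  have {}allY v : v.1 = 0 :> nat -> e Y v.
    by move=> v0; move/forallP/(_ v)/implyP: allY; rewrite v0; apply.
  left; split; first exact: sat_sub satH.
  exists Y; first by rewrite in_V Y1.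
  split; first 1 last.
  - exact: regular_Q.
  - move=> u; rewrite in_setD1 in_V => /andP[nuY /eqP u1]; split.
      by case: (part1 u u1 nuY) => [/leaf_deg|[a [/leaf_deg]]].
    apply/subsetP => v; rewrite in_nbhd in_V134 => /(adj_part satH).
    by rewrite -val_eqE /= u1 eq_sym.
  - move=> u v; rewrite in_V in_VQ => /eqP u0 vQ; apply/negP => uv.
    have Yu := allY u u0; have Yv := YE v vQ; have uQ : ~~ Q u by rewrite u0.
    have nuY := adj_ne satH Yu; have YX : core Y || top Y by rewrite core_y.
    have noX t : top t -> core u || top u -> False.
      move=> tt uX; have [h [_ _ hP _]] := top_case tt.
      by move: nuY; rewrite (hP u uX uQ) (hP Y YX YQ) eqxx.
    have [uX|/norP[uC uT]] := boolP (core u || top u).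
      have [tu|uT] := boolP (top u); first exact: noX tu uX.
      move: (uX); rewrite (negPf uT) orbF => /coreP[[] uy]; last first.
        by rewrite uy eqxx in nuY.
      by apply: (noX v) uX; apply/topP => -[] //; rewrite -uy.
    rewrite adjC in Yu; have vY : v = Y.
      apply: (low_nbr_nonQ uC uT uQ uv Yu); rewrite ?l_core (l1 (b := false) uC) 1?adjC //.
      have [vC|vC] := boolP (core v); last by rewrite (l1 vC Yv).
      by move/coreP: vC => [b ->]; rewrite l_core.
    by rewrite vY (negPf YQ) in vQ.
  apply/setP => v; rewrite in_nbhd in_V134; apply/idP/idP => [/(adj_part satH)|].
    by rewrite -val_eqE /= Y1 eq_sym.
  by case E: (v.1 : nat) => [|[|k]] // _; [apply: allY | apply: YE; rewrite E].
case/forallPn => w0; rewrite negb_imply => /andP[/eqP w00 Yw].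
case: (part0 w0 w00) => [Yw'|[t tt wt0]]; first by rewrite Yw' in Yw.
have [h [_ _ hP _]] := top_case tt.
have hY : h = Y by rewrite -(hP Y) ?core_y.
have XQ_other v : core v || top v -> v != Y -> Q v.
  by move=> vX; apply: contraR => vQ; rewrite (hP v vX vQ) hY.
have ytQ : Q (y true) by apply: XQ_other (y_neq true); rewrite core_y.
have tY : t != Y by rewrite eq_sym (adj_ne satH (topP _ tt false)).
have tQ : Q t by apply: XQ_other; rewrite ?tt ?orbT.
have part1' u : u.1 = 1 :> nat -> u != Y -> leaf H u (y true).
  move=> u1 nuY; case: (part1 u u1 nuY) => // -[a [ua lu la Ya]].
  have w0u : w0.1 != u.1 by rewrite -val_eqE /= w00 u1.
  have := top_nbr tt (leaf_leaf satH wt0 ua w0u); rewrite la => /(_ isT).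
  by case/coreP=> b ab; rewrite ab l_core in la.
right; split; first exact: sat_sub satH.
exists Y, (y true), t; split.
- by rewrite in_V Y1 subUset !sub1set !in_VQ ytQ tQ.
- by move=> u; rewrite in_setD1 in_V => /andP[nuY /eqP u1]; apply: part1'.
- apply: triangle_X; rewrite ?core_y ?tt ?orbT //.
  rewrite /= !inE negb_or (y_neq false) eq_sym tY /=.
  by rewrite (adj_ne satH (topP _ tt true)).
- split; last exact: regular_Q.
  by apply/subsetP => v; rewrite in_VQ in_nbhd; apply: YE.
move=> u; rewrite in_V => /eqP u0.
have uQ : ~~ Q u by rewrite u0.
have uX : ~~ (core u || top u).
  have nuY : u != Y by apply/eqP => uY; move: Y1; rewrite -uY u0.
  by apply: contra uQ => uX; apply: XQ_other.
case/norP: uX => uC uT; suff [a ua aE] : exists2 a, leaf H u a & a \in [set Y; t].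
  by rewrite (leaf_deg ua) ua sub1set.
case: (part0 u u0) => [Yu|[t' tt' ut']]; last first.
  by exists t'; rewrite // (top_uniq tt' tt) set22.
exists Y; last by rewrite set21.
apply: (leaf_l1 uC uT uQ Yu) => w uw lw wQ wu.
have w1 : w.1 = 1 :> nat.
  have := adj_part satH uw; rewrite -val_eqE /= u0.
  by case: (w.1 : nat) wQ => [|[|]].
have nwY : w != Y by apply: contra_eq_neq lw => ->; rewrite l_core.
by move: ytQ; rewrite (leaf_eq wu (leaf_adj (part1' w w1 nwY))) (negPf uQ).
Qed.

(** Now both core vertices lie in the last two parts. A vertex [v] there off the triangle has only
    [h] and its mate as neighbours, so it cannot be reached in two steps from a level-1 vertex with
    a pendant leaf, unless that vertex is [h]. *)
Lemma hub_top h : top h -> h.1 = 1 :> nat -> (forall v, Q v -> e h v) -> family3 H.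
Proof.
move=> th h1 hE; have hQ : ~~ Q h by rewrite h1.
have [h' [_ _ hP _]] := top_case th.
have {hP}hP v : core v || top v -> ~~ Q v -> v = h.
  by move=> vX vQ; rewrite (hP v vX vQ) -(hP h) ?th ?orbT.
have yQ b : Q (y b).
  apply/negPn/negP => bQ; have := top_noncore th.
  by rewrite -(hP (y b)) ?core_y.
have [v [vQ vC vT]] := free_Q.
have lv : l v = 2.
  by case: (l_cases vC) => // lv; case/negP: vC; apply: (top_nbr th (hE v vQ)); rewrite lv.
have [h0 [v' [[h0X h0v _ vv'] [v'Q _ _ lv'] h0Q vE]]] := Q_mate vQ vC vT.
have {h0X h0Q}hh : h0 = h by apply: hP.
have far w a : leaf H w a -> ~~ Q w -> l a = 1 -> ~~ top a -> False.
  move=> wa wQ la aT; have vw : v.1 != w.1 by apply: contraNneq wQ => <-.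
  have nva : v != a by apply: contra_eq_neq la => <-; rewrite lv.
  have [z az zv] := leaf_walk satH wa vw nva; rewrite adjC in zv.
  case: (vE z zv) => [zh|zv'|]; last by rewrite lv ltnNge l_le2.
    rewrite zh hh adjC in az; have := top_nbr th az; rewrite la => /(_ isT).
    by case/coreP=> b ab; rewrite ab l_core in la.
  rewrite zv' adjC in az; rewrite lv in lv'.
  by case: (l2_nbr_l1 lv' la az) => [ta|[]]; [rewrite ta in aT | rewrite v'Q].
have leaves b u : u.1 = b :> nat -> u != h -> leaf H u (y b) \/ leaf H u h.
  move=> ub nuh; have uQ := part_nonQ ub.
  have /norP[uC uT] : ~~ (core u || top u).
    by apply/negP => uX; rewrite (hP u uX uQ) eqxx in nuh.
  case: (side uC uT ub) => [yu|[a [ua _ la _]]].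
    left; apply: (leaf_l1 uC uT uQ yu) => w uw lw wQ wu.
    exact: far wu wQ (l1 uC yu) uT.
  right; have [ta|aT] := boolP (top a); first by rewrite -(top_uniq ta th).
  by case: (far u a ua uQ la aT).
have leaf1 u : u.1 = 1 :> nat -> u != h -> leaf H u (y true).
  move=> u1 nuh; case: (leaves true u u1 nuh) => // /leaf_adj/(adj_part satH).
  by rewrite -val_eqE /= u1 h1.
split; first exact: sat_sub satH.
exists h, (y true), (y false); split.
- by rewrite in_V h1 subUset !sub1set !in_VQ !yQ.
- by move=> u; rewrite in_setD1 in_V => /andP[nuh /eqP u1]; apply: leaf1.
- apply: triangle_X; rewrite ?core_y ?th ?orbT //.
  rewrite /= !inE negb_or (y_neq true) [h == _]eq_sym [h == _]eq_sym.
  by rewrite !(adj_ne satH (topP _ th _)).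
- split; last exact: regular_Q.
  by apply/subsetP => u; rewrite in_VQ in_nbhd; apply: hE.
move=> u; rewrite in_V => /eqP u0.
have nuh : u != h by apply/eqP => uh; move: h1; rewrite -uh u0.
by case: (leaves false u u0 nuh) => ul; rewrite (leaf_deg ul) ul sub1set !inE eqxx ?orbT.
Qed.

Lemma hub_families : hub 1 -> family2 H \/ family3 H.
Proof.
case=> h [h1 hE]; case: (hub_core h1 hE) => [hy|th].
  by rewrite hy in h1 hE; apply: hub_y.
by right; apply: (hub_top th).
Qed.

End TwoParts.

(** * The four families are saturated *)

Section Cactus.

Variables (T : finType) (H : graph T) (l : T -> nat) (S : {set T}).
Hypothesis simH : simple H.
Local Notation e := (adj H).
Hypothesis parent_uniq : forall v u w,
  e v u -> e v w -> l u < l v -> l w < l v -> u = w.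
Hypothesis mate_uniq : forall v u w, 0 < l v ->
  e v u -> e v w -> l u = l v -> l w = l v -> u = w.
Hypothesis mate_parent : forall v v' u u', 0 < l v -> e v v' -> l v' = l v ->
  e v u -> l u < l v -> e v' u' -> l u' < l v -> u = u'.
Hypothesis mate_S : forall v u, 0 < l v -> e v u -> l u = l v -> v \in S.

Let core := [set v | l v == 0].

(** Look at a highest vertex [a] of the cycle. Two lower neighbours or two on its level are
    excluded; a mate and a parent would make the mate's other neighbour [c] either that same parent
    or a second mate. On level 0 the core is too small for four vertices. *)
Lemma cycle_max_level a b c d : #|core| <= 3 ->
    e a b -> e b c -> e c d -> e d a -> a != c -> b != d ->
  l b <= l a -> l c <= l a -> l d <= l a -> False.
Proof.
move=> c3 ab bc cd da nac nbd lb lc ld.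
have [a0|apos] := posnP (l a).
  have : uniq [:: a; b; c; d].
    rewrite /= !inE !negb_or nac nbd (adj_neq simH ab) (adj_neq simH bc).
    by rewrite (adj_neq simH cd) eq_sym (adj_neq simH da).
  move/card_uniqP => /= c4; suff : 4 <= 3 by [].
  rewrite -[X in X <= _]c4; apply: leq_trans c3; apply/subset_leq_card/subsetP => v.
  by rewrite !inE -leqn0 -a0 => /or4P[]/eqP->.
have ad : e a d by rewrite adjC.
have no u v : e a u -> e a v -> e u c -> e c v -> u != v ->
    l u = l a -> l v < l a -> False.
  move=> au av uc cv nuv lu lv; have lupos : 0 < l u by rewrite lu.
  have [luc|lcu|lcu] := ltngtP (l c) (l u).
  - have lca : l c < l a by rewrite -lu.
    have vc : v = c by apply: (mate_parent apos au lu av lv uc lca).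
    by have := adj_neq simH cv; rewrite vc eqxx.
  - by move: lcu; rewrite lu ltnNge lc.
  have ua : e u a by rewrite adjC.
  by have := mate_uniq lupos ua uc (esym lu) lcu => ac; rewrite ac eqxx in nac.
move: lb ld; rewrite leq_eqVlt => /orP[/eqP lb|lb]; rewrite leq_eqVlt => /orP[/eqP ld|ld].
- by have := mate_uniq apos ab ad lb ld => bd; rewrite bd eqxx in nbd.
- exact: no ab ad bc cd nbd lb ld.
- rewrite eq_sym in nbd; rewrite adjC in bc; rewrite adjC in cd.
  exact: no ad ab cd bc nbd ld lb.
by have := parent_uniq ab ad lb ld => bd; rewrite bd eqxx in nbd.
Qed.

Lemma cactus_free : #|core| <= 3 -> c4free H.
Proof.
move=> c3 a b c d ab bc cd da.
have [|nac] := eqVneq a c; first by left.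
have [|nbd] := eqVneq b d; [by right | exfalso].
(* Rotating the cycle reduces all comparisons of opposite vertices to this one. *)
have main a' b' c' d' : e a' b' -> e b' c' -> e c' d' -> e d' a' -> a' != c' -> b' != d' ->
    l c' <= l a' -> l d' <= l b' -> False.
  move=> ab' bc' cd' da' nac' nbd' lc ld.
  have [lb|/ltnW la] := leqP (l b') (l a').
    exact: (cycle_max_level c3 ab' bc' cd' da' nac' nbd' lb lc (leq_trans ld lb)).
  have nca' : c' != a' by rewrite eq_sym.
  exact: (cycle_max_level c3 bc' cd' da' ab' nbd' nca' (leq_trans lc la) ld la).
have nca : c != a by rewrite eq_sym.
have ndb : d != b by rewrite eq_sym.
have [lc|/ltnW la] := leqP (l c) (l a); have [ld|/ltnW lb] := leqP (l d) (l b).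
- exact: main ab bc cd da nac nbd lc ld.
- exact: main da ab bc cd ndb nac lb lc.
- exact: main bc cd da ab nbd nca ld la.
exact: main cd da ab bc nca ndb la lb.
Qed.

(** The charge is at most [#|core| - 1] on the core and 2, plus 1 for a mate, elsewhere. The core's
    share of 2 is added on the left to avoid subtraction. *)
Lemma cactus_card : [disjoint S & core] ->
  2 * #|H| + 2 * #|core| <= #|core| * (#|core| - 1) + 2 * #|T| + #|S|.
Proof.
move=> dSC; rewrite -(sum_wt l simH).
have cS (A : {set T}) : #|A| = \sum_v (v \in A).
  by rewrite -sum1_card big_mkcond; apply: eq_bigr => v _; case: (v \in A).
have le_v v : wt H l v + 2 * (v \in core) <=
    (#|core| - 1) * (v \in core) + 2 + (v \in S).
  rewrite wt_card; have [vC|vC] := boolP (v \in core).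
    have v0 : l v = 0 by apply/eqP; rewrite inE in vC.
    have -> : [set u in nbhd H v | l u < l v] = set0.
      by apply/setP => u; rewrite !inE v0 ltn0 andbF.
    rewrite cards0 !muln1 add0n (disjointFl dSC vC) addn0 leq_add2r.
    have <- : #|core :\ v| = #|core| - 1 by rewrite (cardsD1 v core) vC addKn.
    apply/subset_leq_card/subsetP => u; rewrite !inE v0 => /andP[vu ->].
    by rewrite andbT eq_sym (adj_neq simH vu).
  have v0 : 0 < l v by rewrite lt0n; rewrite inE in vC.
  have low : #|[set u in nbhd H v | l u < l v]| <= 1.
    apply/card_le1_eqP => u w; rewrite !inE => /andP[vu lu] /andP[vw lw].
    exact: parent_uniq vw vu lw lu.
  have same : #|[set u in nbhd H v | l u == l v]| <= (v \in S).
    have [vS|vS] := boolP (v \in S).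
      apply/card_le1_eqP => u w; rewrite !inE => /andP[vu /eqP lu] /andP[vw /eqP lw].
      exact: mate_uniq v0 vw vu lw lu.
    rewrite leqn0 cards_eq0; apply/eqP/setP => u; rewrite !inE.
    by apply: contraNF vS => /andP[vu /eqP lu]; apply: mate_S v0 vu lu.
  by rewrite !muln0 addn0 add0n leq_add // (leq_mul2l 2 _ 1).
have le_sum : \sum_v (wt H l v + 2 * (v \in core)) <=
    \sum_v ((#|core| - 1) * (v \in core) + 2 + (v \in S)) by apply: leq_sum.
rewrite big_split [X in _ <= X]big_split [X in _ <= X + _]big_split /= in le_sum.
rewrite -(big_distrr 2) -(big_distrr (#|core| - 1)) /= -!cS sum_nat_const in le_sum.
by rewrite [(#|core| - 1) * _]mulnC [#|_| * 2]mulnC in le_sum.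
Qed.

End Cactus.

Lemma regular_mate (T : finType) (H : graph T) A v : one_regular_on H A -> v \in A ->
  exists v', [/\ v' \in A, adj H v v' & forall u, u \in A -> adj H v u -> u = v'].
Proof.
move=> /one_regular_onP reg vA; have [v' v'E] := reg v vA.
have : v' \in nbhd H v :&: A by rewrite v'E set11.
rewrite in_setI in_nbhd => /andP[vv' v'A]; exists v'; split=> // u uA vu.
by apply/set1P; rewrite -v'E in_setI in_nbhd vu uA.
Qed.

Lemma deg1_leaf n (H : graph (vertex n)) u : deg H u = 1 -> exists a, leaf H u a.
Proof. by move=> /eqP/cards1P. Qed.

Section Sufficiency.

Variables (n : nat) (H : graph (vertex n)).
Hypotheses (hn : 2 <= n) (sHK : H \subset K4 n).
Implicit Types (a b u v w : vertex n).
Local Notation e := (adj H).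
Local Notation Q v := (1 < (v.1 : nat)).

Lemma sub_adj_part u v : e u v -> u.1 != v.1.
Proof. by rewrite -adj_K4; apply: (subsetP sHK). Qed.

Lemma sub_adj_nat u v : e u v -> (u.1 : nat) != v.1.
Proof. by move/sub_adj_part; rewrite -val_eqE. Qed.

Let simH : simple H := simple_sub sHK (simple_K4 n).

(** The numerical condition is what turns [cactus_card] into [10 * n - 2]: cores of 1, 2 or 3
    vertices allow [2 * n], [2 * n] or [2 * n - 2] matched vertices. *)
Lemma cactus_sat (l : vertex n -> nat) (S : {set vertex n}) c :
  (forall v u w, e v u -> e v w -> l u < l v -> l w < l v -> u = w) ->
  (forall v u w, 0 < l v -> e v u -> e v w -> l u = l v -> l w = l v -> u = w) ->
  (forall v v' u u', 0 < l v -> e v v' -> l v' = l v ->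
     e v u -> l u < l v -> e v' u' -> l u' < l v -> u = u') ->
  (forall v u, 0 < l v -> e v u -> l u = l v -> v \in S) ->
  (forall v, v \in S -> 0 < l v) -> #|[set v | l v == 0]| = c -> c <= 3 ->
  c * (c - 1) + #|S| <= 2 * n - 2 + 2 * c -> walk3 H ->
  saturated (K4 n) C4 H /\ 2 * #|H| <= 10 * n - 2.
Proof.
move=> H1 H2 H3 H4 H5 cE c3 cS wH; split.
  by apply/saturatedP; split=> //; apply: (cactus_free simH H1 H2 H3); rewrite cE.
have dS : [disjoint S & [set v | l v == 0]].
  by apply/pred0P => v /=; apply/andP => -[/H5]; rewrite inE; case: (l v).
have := cactus_card simH H1 H2 H4 dS; rewrite cE card_prod !card_ord.
by move: hn c3 cS; clear; move: (c * _) #|S| #|H|; lia.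
Qed.

Lemma walk_rev u v :
  (exists a b, [/\ e u a, e a b & e b v]) -> exists a b, [/\ e v a, e a b & e b u].
Proof.
by case=> a [b [ua ab bv]]; exists b, a; rewrite adjC bv adjC ab adjC ua.
Qed.

Lemma card_Q : #|V n 3 :|: V n 4| = 2 * n.
Proof.
rewrite -sum1_card big_mkcond (eq_bigr (fun v : vertex n => (Q v : nat))) => [|v _].
  rewrite (sum_part n (fun i : 'I_4 => 1 < i)) mulnC; congr (_ * _).
  by rewrite !big_ord_recl big_ord0.
by rewrite in_VQ; case: (Q v).
Qed.

Lemma family2_saturated : family2 H -> saturated (K4 n) C4 H /\ 2 * #|H| <= 10 * n - 2.
Proof.
case=> _ [y]; rewrite in_V => /eqP y1 [Ny reg leafP no02].
have yE v : e y v = ((v.1 : nat) != 1) by rewrite -in_nbhd Ny in_V134.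
have leafE (u : vertex n) : u.1 = 1 :> nat -> u != y -> exists2 a, leaf H u a & e y a.
  move=> u1 nuy; have [|d1 sN] := leafP u; first by rewrite in_setD1 in_V u1 nuy.
  have [a ua] := deg1_leaf d1; exists a; rewrite // yE -in_V134.
  by apply: (subsetP sN); rewrite in_nbhd leaf_adj.
have mate (v : vertex n) : Q v -> exists v', [/\ Q v', e v v' & forall u, Q u -> e v u -> u = v'].
  rewrite -in_VQ => vQ; have [v' [v'Q vv' v'E]] := regular_mate reg vQ.
  by exists v'; rewrite -in_VQ; split=> // u; rewrite -in_VQ; apply: v'E.
(* The other vertices of [V 2] are leaves that hang from neighbours of [y], hence level 2. *)
pose l (v : vertex n) := if v == y then 0 else if (v.1 : nat) == 1 then 2 else 1.
have ly : l y = 0 by rewrite /l eqxx.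
have l0 v : l v = 0 -> v = y by rewrite /l; case: eqP => // _; case: ifP.
have l1E v : l v = 1 -> v.1 <> 1 :> nat.
  by rewrite /l; case: ifP => // _; case: eqP.
have l2E v : l v = 2 -> v.1 = 1 :> nat /\ v != y.
  by rewrite /l; case: ifP => // _; case: eqP.
have l3 v : [\/ l v = 0, l v = 1 | l v = 2].
  by rewrite /l; do 2?case: ifP; [constructor 1 | constructor 3 | constructor 2].
have H1 v u : e v u -> l u < l v -> l v = 1 -> u = y.
  by move=> _ + lv; rewrite lv ltnS leqn0 => /eqP/l0.
have Q1 v u : l v = 1 -> l u = 1 -> e v u -> Q v /\ Q u.
  move=> lv lu vu; have := l1E v lv; have := l1E u lu; have := sub_adj_nat vu.
  case Ev: (v.1 : nat) => [|[|kv]] //; case Eu: (u.1 : nat) => [|[|ku]] // _ _ _.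
    by have := no02 v u; rewrite in_V Ev in_VQ Eu vu => /(_ isT isT).
  by have := no02 u v; rewrite in_V Eu in_VQ Ev adjC vu => /(_ isT isT).
have no22 v u : l v = 2 -> l u = 2 -> ~~ e v u.
  move=> /l2E[v1 _] /l2E[u1 _]; apply/negP => /sub_adj_nat.
  by rewrite v1 u1.
apply: (@cactus_sat l (V n 3 :|: V n 4) 1).
- move=> v u w vu vw lu lw; case: (l3 v) => lv; first by rewrite lv in lu.
    by rewrite (H1 v u) // (H1 v w).
  have [v1 nvy] := l2E v lv; have [a va _] := leafE v v1 nvy.
  by rewrite (leaf_eq va vu) (leaf_eq va vw).
- move=> v u w lv vu vw lu lw; case: (l3 v) => lv'; first by rewrite lv' in lv.
    rewrite lv' in lu lw; have [vQ uQ] := Q1 v u lv' lu vu.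
    have [_ wQ] := Q1 v w lv' lw vw; have [v' [_ _ v'E]] := mate v vQ.
    by rewrite (v'E u) // (v'E w).
  by rewrite lv' in lu; have := no22 v u lv' lu; rewrite vu.
- move=> v v' u u' lv vv' lv' vu lu v'u' lu'.
  case: (l3 v) => lvE; first by rewrite lvE in lv.
    by rewrite (H1 v u) // (H1 v' u') // lv'.
  by rewrite lvE in lv'; have := no22 v v' lvE lv'; rewrite vv'.
- move=> v u lv vu lu; rewrite in_VQ; case: (l3 v) => lv'; first by rewrite lv' in lv.
    by rewrite lv' in lu; have [] := Q1 v u lv' lu vu.
  by rewrite lv' in lu; have := no22 v u lv' lu; rewrite vu.
- by move=> v; rewrite in_VQ lt0n; apply: contraTneq => /l0->; rewrite y1.
- apply/eqP/cards1P; exists y; apply/setP => v; rewrite !inE.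
  by apply/eqP/eqP => [/l0|->].
- by [].
- by rewrite card_Q; move: hn; clear; lia.
(* A matched vertex [u] is reached through [y] and the mate of [u]. *)
have wQ (u v : vertex n) : Q u -> e y v -> exists a b, [/\ e v a, e a b & e b u].
  move=> uQ yv; have [u' [u'Q uu' _]] := mate u uQ; exists y, u'.
  by rewrite adjC yv yE adjC uu' neq_ltn u'Q orbT.
have w1 (u v : vertex n) : u.1 = 1 :> nat -> u.1 != v.1 -> ~~ e u v ->
    exists a b, [/\ e u a, e a b & e b v].
  rewrite -val_eqE /= => u1 uv Nuv; have yv : e y v by rewrite yE eq_sym; rewrite u1 in uv.
  have [uy|nuy] := eqVneq u y; first by rewrite uy yv in Nuv.
  by have [a ua ya] := leafE u u1 nuy; exists a, y; rewrite leaf_adj // adjC ya yv.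
move=> u v uv Nuv; have [u1|u1] := eqVneq (u.1 : nat) 1; first exact: w1.
have [v1|v1] := eqVneq (v.1 : nat) 1.
  by apply: walk_rev; apply: w1; rewrite // 1?eq_sym // adjC.
have [uQ|uQ] := boolP (Q u); first by apply: walk_rev; apply: wQ; rewrite // yE.
have [vQ|vQ] := boolP (Q v); first by apply: wQ; rewrite // yE.
move: uv; rewrite -val_eqE /=.
by case: (u.1 : nat) u1 uQ => [|[|]] //; case: (v.1 : nat) v1 vQ => [|[|]].
Qed.

Lemma family3_saturated : family3 H -> saturated (K4 n) C4 H /\ 2 * #|H| <= 10 * n - 2.
Proof.
case=> _ [y [z [w [[yV zwQ] leafP tri [QN reg] v1P]]]].
move: yV zwQ; rewrite in_V subUset !sub1set !in_VQ => /eqP y1 /andP[zQ wQ].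
have [X3 adjX] := triangle_onP _ simH tri.
have yE v : Q v -> e y v by rewrite -in_VQ -in_nbhd; apply: (subsetP QN).
have leaf1 u : u.1 = 1 :> nat -> u != y -> leaf H u z.
  by move=> u1 nuy; apply: leafP; rewrite in_setD1 in_V u1 nuy.
have leaf0 u : u.1 = 0 :> nat -> leaf H u y \/ leaf H u w.
  move=> u0; have [|d1 sN] := v1P u; first by rewrite in_V u0.
  have [a ua] := deg1_leaf d1; move: sN; rewrite ua sub1set !inE.
  by case/orP=> /eqP aE; [left | right]; rewrite -aE.
have mate v : Q v -> exists v', [/\ Q v', e v v' & forall u, Q u -> e v u -> u = v'].
  rewrite -in_VQ => vQ; have [v' [v'Q vv' v'E]] := regular_mate reg vQ.
  by exists v'; rewrite -in_VQ; split=> // u; rewrite -in_VQ; apply: v'E.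
have nzw : z != w.
  apply: contra_eq_neq X3 => ->; rewrite -setUA setUid cards2 eqn_leq andbC.
  by case: (y != w).
have zw : e z w by apply: adjX => //; rewrite !inE eqxx ?orbT.
set X := [set y; z; w] in X3 adjX.
have yX : y \in X by rewrite !inE eqxx.
have zX : z \in X by rewrite !inE eqxx orbT.
have wX : w \in X by rewrite !inE eqxx orbT.
pose l v : nat := v \notin X.
have l0 v : (l v == 0) = (v \in X) by rewrite /l; case: (v \in X).
have lpos v : (0 < l v) = (v \notin X) by rewrite /l; case: (v \in X).
(* [z] and [w] are matched with each other, so the other matched vertices meet the triangle in [y]
   only. *)
have QX v u : v \notin X -> Q v -> e v u -> u \in X -> u = y.
  move=> vX vQ vu; rewrite !inE -orbA => /or3P[/eqP//||] /eqP uE; rewrite uE adjC in vu.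
    have [z' [_ _ zE]] := mate z zQ; case/negP: vX.
    by rewrite (zE v vQ vu) -(zE w wQ zw).
  rewrite adjC in zw; have [w' [_ _ wE]] := mate w wQ; case/negP: vX.
  by rewrite (wE v vQ vu) -(wE z zQ zw).
have nonQ v u : v \notin X -> ~~ Q v -> e v u -> u \in X /\ leaf H v u.
  move=> vX vQ vu; case E: (v.1 : nat) vQ => [|[|]] // _.
    by case: (leaf0 v E) => vl; have ul := leaf_eq vl vu; rewrite ul.
  have vl : leaf H v z by apply: leaf1 E _; apply: contraNneq vX => ->.
  by have ul := leaf_eq vl vu; rewrite ul.
have QQ v u : v \notin X -> u \notin X -> e v u -> Q v /\ Q u.
  move=> vX uX vu; split; apply/negPn/negP => nQ.
    by have [uX' _] := nonQ v u vX nQ vu; rewrite uX' in uX.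
  rewrite adjC in vu; have [vX' _] := nonQ u v uX nQ vu; by rewrite vX' in vX.
have eqX v u : v \notin X -> l u = l v -> u \notin X.
  by move=> vX lu; rewrite -lpos lu lpos.
have ltX v u : l u < l v -> u \in X by rewrite -l0 /l; case: (u \in X); case: (v \in X).
clearbody l.
apply: (@cactus_sat l ((V n 3 :|: V n 4) :\ z :\ w) 3).
- move=> v u u' vu vu' lu lu'; have vX : v \notin X by rewrite -lpos (leq_ltn_trans _ lu).
  have [vQ|vQ] := boolP (Q v).
    by rewrite (QX v u vX vQ vu (ltX _ _ lu)) (QX v u' vX vQ vu' (ltX _ _ lu')).
  by have [_ vl] := nonQ v u vX vQ vu; rewrite (leaf_eq vl vu').
- move=> v u u'; rewrite lpos => vX vu vu' /(eqX v u vX) uX /(eqX v u' vX) u'X.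
  have [vQ uQ] := QQ v u vX uX vu; have [_ u'Q] := QQ v u' vX u'X vu'.
  by have [v' [_ _ v'E]] := mate v vQ; rewrite (v'E u) // (v'E u').
- move=> v v' u u'; rewrite lpos => vX vv' lv' vu lu v'u' lu'.
  have v'X := eqX v v' vX lv'; have [vQ v'Q] := QQ v v' vX v'X vv'.
  by rewrite (QX v u vX vQ vu (ltX _ _ lu)) (QX v' u' v'X v'Q v'u' (ltX _ _ lu')).
- move=> v u; rewrite lpos => vX vu /(eqX v u vX) uX.
  have [vQ _] := QQ v u vX uX vu; rewrite !in_setD1 in_VQ vQ andbT.
  by apply/andP; split; apply: contraNneq vX => ->.
- move=> v; rewrite lpos !in_setD1 in_VQ !inE => /and3P[/negPf-> /negPf-> vQ].
  by rewrite !orbF; apply: contraTneq vQ => ->; rewrite y1.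
- by rewrite -[RHS]X3; apply: eq_card => v; rewrite inE l0.
- by [].
- have := cardsD1 z (V n 3 :|: V n 4); have := cardsD1 w ((V n 3 :|: V n 4) :\ z).
  rewrite card_Q in_setD1 !in_VQ zQ wQ eq_sym nzw /=.
  by move: hn; clear; move: #|_ :\ z| #|_ :\ w|; lia.
have wQ2 u v : Q u -> e y v -> exists a b, [/\ e v a, e a b & e b u].
  move=> uQ yv; have [u' [u'Q uu' _]] := mate u uQ; exists y, u'.
  by rewrite adjC yv yE // adjC.
have yz : e y z by apply: yE.
have yw : e y w by apply: yE.
have w1 u v : u.1 = 1 :> nat -> u.1 != v.1 -> ~~ e u v ->
    exists a b, [/\ e u a, e a b & e b v].
  rewrite -val_eqE /= => u1 uv Nuv; have [uy|nuy] := eqVneq u y.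
    have v0 : v.1 = 0 :> nat.
      move: uv; rewrite u1; case E: (v.1 : nat) => [|[|k]] // _.
      by case/negP: Nuv; rewrite uy yE // E.
    case: (leaf0 v v0) => /leaf_adj vl; first by rewrite uy adjC vl in Nuv.
    by exists z, w; rewrite uy yz zw adjC vl.
  have uz := leaf_adj (leaf1 u u1 nuy); case E: (v.1 : nat) uv => [|[|k]]; rewrite u1 // => _.
    case: (leaf0 v E) => /leaf_adj; rewrite adjC => vl; [exists z, y | exists z, w].
      by rewrite uz [e z y]adjC yz vl.
    by rewrite uz zw vl.
  by exists z, y; rewrite uz adjC yz yE // E.
have w0 u v : u.1 = 0 :> nat -> Q v -> exists a b, [/\ e u a, e a b & e b v].
  move=> u0 vQ; case: (leaf0 u u0) => /leaf_adj ul.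
    by apply: wQ2; rewrite // adjC.
  by exists w, y; rewrite ul adjC yw yE.
move=> u v uv Nuv; have [u1|u1] := eqVneq (u.1 : nat) 1; first exact: w1.
have [v1|v1] := eqVneq (v.1 : nat) 1.
  by apply: walk_rev; apply: w1; rewrite // 1?eq_sym // adjC.
have [uQ|uQ] := boolP (Q u).
  have [vQ|vQ] := boolP (Q v); first by apply: wQ2; rewrite // yE.
  by apply: walk_rev; apply: w0 => //; case: (v.1 : nat) v1 vQ => [|[|]].
apply: w0; first by case: (u.1 : nat) u1 uQ => [|[|]].
by move: uv; rewrite -val_eqE /=; case: (u.1 : nat) u1 uQ => [|[|]] //;
  case: (v.1 : nat) v1 => [|[|]].
Qed.

Lemma family4_saturated : family4 H -> saturated (K4 n) C4 H /\ 2 * #|H| <= 10 * n - 2.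
Proof.
case=> _ [x [y [[xV yV V2x V1y] reg QP share no]]].
move: xV yV; rewrite !in_V => /eqP x0 /eqP y1.
have xE v : v.1 = 1 :> nat -> e x v.
  by move=> v1; rewrite -in_nbhd; apply: (subsetP V2x); rewrite in_V v1.
have yE v : v.1 = 0 :> nat -> e y v.
  by move=> v0; rewrite -in_nbhd; apply: (subsetP V1y); rewrite in_V v0.
have exy : e x y by apply: xE.
have nxy : x != y by apply: adj_neq simH exy.
pose X := [set x; y].
have XQ v : v \in X -> ~~ Q v by rewrite !inE => /orP[]/eqP->; rewrite ?x0 ?y1.
have hubP v : Q v -> exists h v', [/\ h \in X, nbhd H v = [set h; v'], e h v' & Q v'].
  move=> vQ; suff [h [v' [hX Nv v'Q]]] : exists h v',
      [/\ h \in X, nbhd H v = [set h; v'] & Q v'].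
    exists h, v'; split=> //; have vv' : e v v' by rewrite -in_nbhd Nv set22.
    (* The common neighbour can only be [h], the other neighbour of [v] being [v'] itself. *)
    have /set0Pn[c] : nbhd H v :&: nbhd H v' != set0 by apply: share; rewrite ?in_VQ.
    rewrite in_setI Nv in_set2 in_nbhd => /andP[/orP[]/eqP->]; first by rewrite adjC.
    by move/(adj_neq simH); rewrite eqxx.
  have [i i34 vi] : exists2 i, i \in [:: 3; 4] & v \in V n i.
    by move: vQ; rewrite -in_VQ => /setUP[]; [exists 3 | exists 4].
  have VQ (v' : vertex n) : v' \in V n (7 - i) -> Q v'.
    by move: i34; rewrite !inE => /orP[]/eqP->; rewrite eqSS => /eqP->.
  case: (QP i v i34 vi) => -[v' /VQ v'Q Nv]; [exists y, v' | exists x, v'];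
    by rewrite !inE eqxx ?orbT.
have leaf0 u v : u.1 = 0 :> nat -> u \notin X -> e u v -> v = y.
  move=> u0 uX uv; case E: (v.1 : nat) => [|[|k]].
  - by have := sub_adj_nat uv; rewrite u0 E.
  - have [ux|//] : u = x \/ v = y by apply: no => //; rewrite in_V ?u0 ?E.
    by rewrite ux !inE eqxx in uX.
  have [|h [v' [hX Nv _ v'Q]]] := hubP v; first by rewrite E.
  have : u \in nbhd H v by rewrite in_nbhd adjC.
  by rewrite Nv !inE => /orP[]/eqP uE; [rewrite uE hX in uX | rewrite -uE u0 in v'Q].
have leaf1 u v : u.1 = 1 :> nat -> u \notin X -> e u v -> v = x.
  move=> u1 uX uv; case E: (v.1 : nat) => [|[|k]].
  - have [//|uy] : v = x \/ u = y by apply: no; rewrite ?in_V ?u1 ?E // adjC.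
    by rewrite uy !inE eqxx orbT in uX.
  - by have := sub_adj_nat uv; rewrite u1 E.
  have [|h [v' [hX Nv _ v'Q]]] := hubP v; first by rewrite E.
  have : u \in nbhd H v by rewrite in_nbhd adjC.
  by rewrite Nv !inE => /orP[]/eqP uE; [rewrite uE hX in uX | rewrite -uE u1 in v'Q].
pose l v : nat := v \notin X.
have l0 v : (l v == 0) = (v \in X) by rewrite /l; case: (v \in X).
have lpos v : (0 < l v) = (v \notin X) by rewrite /l; case: (v \in X).
have eqX v u : v \notin X -> l u = l v -> u \notin X.
  by move=> vX lu; rewrite -lpos lu lpos.
have ltX v u : l u < l v -> u \in X by rewrite -l0 /l; case: (u \in X); case: (v \in X).
clearbody l.
have nonQ v u : v \notin X -> ~~ Q v -> e v u -> u \in X /\ forall u', e v u' -> u' = u.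
  move=> vX vQ vu; case E: (v.1 : nat) vQ => [|[|]] // _.
    rewrite (leaf0 v u E vX vu) !inE eqxx orbT; split=> // u' vu'; exact: leaf0 E vX vu'.
  by rewrite (leaf1 v u E vX vu) !inE eqxx; split=> // u' vu'; exact: leaf1 E vX vu'.
have QQ v u : v \notin X -> u \notin X -> e v u -> Q v /\ Q u.
  move=> vX uX vu; split; apply/negPn/negP => nQ.
    by have [uX' _] := nonQ v u vX nQ vu; rewrite uX' in uX.
  rewrite adjC in vu; have [vX' _] := nonQ u v uX nQ vu; by rewrite vX' in vX.
have Xuniq v u u' : v \notin X -> e v u -> e v u' -> u \in X -> u' \in X -> u = u'.
  move=> vX vu vu' uX u'X; have [vQ|vQ] := boolP (Q v); last first.
    by have [_ only] := nonQ v u' vX vQ vu'; apply: only.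
  have [h [v' [hX Nv _ v'Q]]] := hubP v vQ.
  have only c : e v c -> c \in X -> c = h.
    by rewrite -in_nbhd Nv in_set2 => /orP[]/eqP-> // /XQ; rewrite v'Q.
  by rewrite (only u) // (only u').
have Quniq v u u' : Q v -> e v u -> e v u' -> u \notin X -> u' \notin X -> u = u'.
  move=> vQ vu vu' uX u'X; have [h [v' [hX Nv _ v'Q]]] := hubP v vQ.
  have only c : e v c -> c \notin X -> c = v'.
    by rewrite -in_nbhd Nv in_set2 => /orP[]/eqP-> //; rewrite hX.
  by rewrite (only u) // (only u').
apply: (@cactus_sat l (V n 3 :|: V n 4) 2).
- move=> v u u' vu vu' lu lu'; have vX : v \notin X by rewrite -lpos (leq_ltn_trans _ lu).
  exact: (Xuniq v u u' vX vu vu' (ltX _ _ lu) (ltX _ _ lu')).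
- move=> v u u'; rewrite lpos => vX vu vu' /(eqX v u vX) uX /(eqX v u' vX) u'X.
  have [vQ _] := QQ v u vX uX vu; exact: (Quniq v).
- move=> v v' u u'; rewrite lpos => vX vv' lv' vu lu v'u' lu'.
  have v'X := eqX v v' vX lv'; have [vQ v'Q] := QQ v v' vX v'X vv'.
  have [h [v'' [hX Nv hv'' v''Q]]] := hubP v vQ.
  have vh : e v h by rewrite -in_nbhd Nv set21.
  have vv'' : e v v'' by rewrite -in_nbhd Nv set22.
  have v''X : v'' \notin X by apply: contraL v''Q => /XQ.
  rewrite (Xuniq v u h vX vu vh (ltX _ _ lu) hX); rewrite adjC in hv''.
  apply: (Xuniq v' h u' v'X _ v'u' hX (ltX _ _ lu')).
  by rewrite (Quniq v v' v'' vQ vv' vv'' v'X v''X).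
- move=> v u; rewrite lpos => vX vu /(eqX v u vX) uX.
  by have [vQ _] := QQ v u vX uX vu; rewrite in_VQ.
- by move=> v; rewrite lpos in_VQ; apply: contraL => /XQ.
- have X2 : #|X| = 2 by rewrite cards2 nxy.
  by rewrite -[RHS]X2; apply: eq_card => v; rewrite inE l0.
- by [].
- by rewrite card_Q; move: hn; clear; lia.
have XE h k : h \in X -> k \in X -> h = k \/ e h k.
  rewrite !inE => /orP[]/eqP-> /orP[]/eqP->; [by left | by right | | by left].
  by right; rewrite adjC.
have hub_any v : v \notin X -> exists2 h, h \in X & e v h.
  move=> vX; case E: (v.1 : nat) => [|[|k]].
  - by exists y; [rewrite !inE eqxx orbT | rewrite adjC yE].
  - by exists x; [rewrite !inE eqxx | rewrite adjC xE].
  have [|h [v' [hX Nv _ _]]] := hubP v; first by rewrite E.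
  by exists h; rewrite // -in_nbhd Nv set21.
have viaQ h u v : Q u -> h \in X -> e u h -> e v h -> exists a b, [/\ e v a, e a b & e b u].
  move=> uQ hX uh vh; have [h' [u' [h'X Nu hu' u'Q]]] := hubP u uQ.
  have uh' : e u h' by rewrite -in_nbhd Nu set21.
  have uu' : e u u' by rewrite -in_nbhd Nu set22.
  have uX : u \notin X by apply: contraL uQ => /XQ.
  by exists h, u'; rewrite vh (Xuniq u h h') // hu' adjC.
have Xwalk u v : u \in X -> v \notin X -> u.1 != v.1 -> ~~ e u v ->
    exists a b, [/\ e u a, e a b & e b v].
  move=> uX vX uv Nuv; have [h hX vh] := hub_any v vX.
  case: (XE u h uX hX) => [uE|uh]; first by rewrite uE adjC vh in Nuv.
  have [vQ|vQ] := boolP (Q v); first exact: viaQ vQ hX vh uh.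
  move: uv; rewrite -val_eqE /=; move: uX uh Nuv; rewrite !inE => /orP[]/eqP-> uh Nuv.
    by rewrite x0; case E: (v.1 : nat) vQ => [|[|]] // _ _; rewrite xE in Nuv.
  by rewrite y1; case E: (v.1 : nat) vQ => [|[|]] // _ _; rewrite yE in Nuv.
move=> u v uv Nuv; have [uX|uX] := boolP (u \in X).
  have [vX|vX] := boolP (v \in X); last exact: Xwalk.
  case: (XE u v uX vX) => [uE|]; first by rewrite uE eqxx in uv.
  by rewrite (negPf Nuv).
have [vX|vX] := boolP (v \in X).
  by apply: walk_rev; apply: Xwalk; rewrite // 1?eq_sym // adjC.
have [h hX uh] := hub_any u uX; have [k kX vk] := hub_any v vX.
case: (XE h k hX kX) => [hk|hk]; last by exists h, k; rewrite uh hk adjC.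
rewrite -hk in vk; have [uQ|uQ] := boolP (Q u).
  by apply: walk_rev; apply: viaQ uQ hX uh vk.
have [vQ|vQ] := boolP (Q v); first exact: viaQ vQ hX vk uh.
move: uv; rewrite -val_eqE /=; case Eu: (u.1 : nat) uQ => [|[|]] // _.
  case Ev: (v.1 : nat) vQ => [|[|]] // _ _.
  by have := nxy; rewrite -(leaf0 u h Eu uX uh) -(leaf1 v h Ev vX vk) eqxx.
case Ev: (v.1 : nat) vQ => [|[|]] // _ _.
by have := nxy; rewrite -(leaf1 u h Eu uX uh) -(leaf0 v h Ev vX vk) eqxx.
Qed.

Lemma family1_saturated : family1 H -> saturated (K4 n) C4 H /\ 2 * #|H| <= 10 * n - 2.
Proof.
case=> _ [y [I [[XV tri] [IP sumI leafP] WP reg mateP]]].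
set X := [set y i | i : 'I_3] in XV tri WP reg mateP.
set W := ~: (\bigcup_i I i :|: X) in WP reg mateP.
have [X3 adjX] := triangle_onP _ simH tri.
have y_inj : injective y.
  have /imset_injP inj : #|X| == #|'I_3| by rewrite X3 card_ord.
  by move=> i j; apply: inj.
have yX i : y i \in X by apply: imset_f.
have yy i j : i != j -> e (y i) (y j).
  by move=> ij; apply: adjX; rewrite ?yX // (inj_eq y_inj).
have IX i v : v \in I i -> v \notin X.
  move=> vI; apply/negP => vX; have [j vj] := imsetP vX.
  have := cardsD1 v X; rewrite X3 vX add1n => -[X2].
  have : X :\ v \subset nbhd H v.
    apply/subsetP => u; rewrite in_setD1 in_nbhd => /andP[nuv uX].
    by apply: adjX => //; rewrite eq_sym.
  by move/subset_leq_card; rewrite (leafP i v vI) cards1 -X2.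
have part_I i v : v \in I i -> v.1 = i :> nat.
  by case: (IP i) => _ /subsetP sI /sI; rewrite in_V => /eqP.
have WX v : v \in W -> v \notin X by rewrite in_setC in_setU negb_or => /andP[].
have WI v i : v \in W -> v \notin I i.
  rewrite in_setC in_setU negb_or => /andP[vI _]; apply: contra vI => vI.
  by apply/bigcupP; exists i.
have IW v : v \notin X -> (exists i, v \in I i) \/ v \in W.
  move=> vX; have [/bigcupP[i _ vI]|vI] := boolP (v \in \bigcup_i I i).
    by left; exists i.
  by right; rewrite in_setC in_setU negb_or vI.
have hubP v : v \notin X -> exists i, e v (y i) /\ forall u, u \in X -> e v u -> u = y i.
  case/IW => [[i vI]|vW].
    have vl := leafP i v vI; exists i; split; first exact: leaf_adj.
    by move=> u _; apply: leaf_eq.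
  have [_ /eqP/cards1P[c cE] _] := WP v vW.
  have : c \in nbhd H v :&: X by rewrite cE set11.
  rewrite in_setI in_nbhd => /andP[vc /imsetP[i _ ci]]; exists i; rewrite -ci; split=> // u uX vu.
  by apply/set1P; rewrite -cE in_setI in_nbhd vu.
have off v u : v \notin X -> u \notin X -> e v u -> v \in W.
  move=> vX uX vu; case: (IW v vX) => // -[i vI].
  by move: uX; rewrite (leaf_eq (leafP i v vI) vu) yX.
have mate v : v \in W -> exists u, [/\ u \in W, e v u & forall w, w \notin X -> e v w -> w = u].
  move=> vW; have [u [uW vu uE]] := regular_mate reg vW; exists u; split=> // w wX vw.
  by apply: uE => //; apply: (off w v) => //; [apply: WX | rewrite adjC].
have share v u i : v \in W -> u \in W -> e v u -> e v (y i) -> e u (y i).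
  move=> vW uW vu vy; have [_ /set0Pn[c cN] /subsetP sX] := mateP v u vW uW vu.
  have cX := sX c cN; move: cN; rewrite in_setI !in_nbhd => /andP[vc uc].
  by have [j [_ jE]] := hubP v (WX v vW); rewrite (jE (y i)) // -(jE c).
pose l v : nat := v \notin X.
have l0 v : (l v == 0) = (v \in X) by rewrite /l; case: (v \in X).
have lpos v : (0 < l v) = (v \notin X) by rewrite /l; case: (v \in X).
have eqX v u : v \notin X -> l u = l v -> u \notin X.
  by move=> vX lu; rewrite -lpos lu lpos.
have ltX v u : l u < l v -> u \in X by rewrite -l0 /l; case: (u \in X); case: (v \in X).
clearbody l.
apply: (@cactus_sat l W 3).
- move=> v u u' vu vu' lu lu'; have vX : v \notin X by rewrite -lpos (leq_ltn_trans _ lu).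
  by have [i [_ iE]] := hubP v vX; rewrite (iE u (ltX _ _ lu) vu) (iE u' (ltX _ _ lu') vu').
- move=> v u u'; rewrite lpos => vX vu vu' /(eqX v u vX) uX /(eqX v u' vX) u'X.
  have [w [_ _ wE]] := mate v (off v u vX uX vu).
  by rewrite (wE u) // (wE u').
- move=> v v' u u'; rewrite lpos => vX vv' lv' vu lu v'u' lu'.
  have v'X := eqX v v' vX lv'; have vW := off v v' vX v'X vv'.
  have v'W : v' \in W by apply: (off v' v); rewrite // adjC.
  have [i [vi iE]] := hubP v vX; have [j [_ jE]] := hubP v' v'X.
  have uX := ltX v u lu; have u'X := ltX v u' lu'.
  rewrite (iE u uX vu) (jE u' u'X v'u'); apply: jE; rewrite ?yX //.
  exact: (share v v').
- by move=> v u; rewrite lpos => vX vu /(eqX v u vX) uX; apply: (off v u).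
- by move=> v vW; rewrite lpos WX.
- by rewrite -[RHS]X3; apply: eq_card => v; rewrite inE l0.
- by [].
- have disjI i j : i != j -> [disjoint I i & I j].
    move=> ij; rewrite -setI_eq0; apply/set0Pn => -[v]; rewrite in_setI => /andP[].
    by move=> /part_I vi /part_I vj; move: ij; rewrite -val_eqE /= -vi -vj eqxx.
  have cI : #|\bigcup_i I i| = 2 * n - 1.
    rewrite -sumI -sum1_card partition_disjoint_bigcup; last exact: disjI.
    by apply: eq_bigr => i _; rewrite sum1_card.
  have cU : #|\bigcup_i I i :|: X| = 2 * n - 1 + 3.
    rewrite cardsU X3 cI (_ : _ :&: _ = set0) ?cards0 ?subn0 //; apply/setP => v.
    rewrite in_setI in_set0; apply/negP => /andP[/bigcupP[i _ /IX vX]].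
    by rewrite (negPf vX).
  have := cardsC (\bigcup_i I i :|: X); rewrite cU -/W card_prod !card_ord.
  by move: hn; clear; move: #|W| => k; lia.
have XW u v : u \notin X -> v \in X -> ~~ e u v -> exists a b, [/\ e u a, e a b & e b v].
  move=> uX /imsetP[j _ ->] Nuv; have [i [ui _]] := hubP u uX.
  have [k] := exists_notin (isT : size [:: i; j] < 3); rewrite !inE => /norP[ki kj].
  by exists (y i), (y k); rewrite ui !yy // eq_sym.
have Wwalk u v i : u \in W -> e u (y i) -> e v (y i) -> exists a b, [/\ e v a, e a b & e b u].
  move=> uW ui vi; have [u' [u'W uu' _]] := mate u uW; exists (y i), u'.
  by rewrite vi adjC (share u u') // adjC.
move=> u v uv Nuv; have [uX|uX] := boolP (u \in X).
  have [vX|vX] := boolP (v \in X); last by apply: walk_rev; apply: XW; rewrite // adjC.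
  by case/negP: Nuv; apply: adjX => //; apply: contraNneq uv => ->.
have [vX|vX] := boolP (v \in X); first exact: XW.
have [i [ui iE]] := hubP u uX; have [j [vj jE]] := hubP v vX.
have [ij|nij] := eqVneq i j; last by exists (y i), (y j); rewrite ui yy // adjC.
rewrite -ij in vj; case: (IW u uX) => [[a ua]|uW]; last by apply: walk_rev; apply: Wwalk uW ui vj.
case: (IW v vX) => [[b vb]|vW]; last exact: Wwalk vW vj ui.
(* Two leaves of the same triangle vertex lie in the same part, so no walk between them is
   required. *)
have ai := y_inj _ _ (leaf_eq (leafP a u ua) ui).
have bi := y_inj _ _ (leaf_eq (leafP b v vb) vj).
by move: uv; rewrite -val_eqE /= (part_I a u ua) (part_I b v vb) -ai -bi eqxx.
Qed.

Lemma extremal_saturated :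
  extremal H -> saturated (K4 n) C4 H /\ 2 * #|H| <= 10 * n - 2.
Proof.
by case; [apply: family1_saturated | apply: family2_saturated
         | apply: family3_saturated | apply: family4_saturated].
Qed.

End Sufficiency.

(** * Classification *)

Section Classification.

Variable n : nat.
Hypothesis hn : 2 <= n.
Implicit Types (H G : graph (vertex n)) (x y u v z : vertex n) (s : {perm 'I_4}).

Definition leaf_at H (k : nat) := exists x y, (x.1 : nat) = k /\ leaf H x y.

Definition has_leaf_in H (i : 'I_4) := [exists v : vertex n, (v.1 == i) && (deg H v == 1)].

Lemma has_leaf_inP H i : reflect (exists x y, x.1 = i /\ leaf H x y) (has_leaf_in H i).
Proof.
apply: (iffP existsP) => [[x /andP[/eqP xi /cards1P[y xy]]]|[x [y [xi xy]]]].
  by exists x, y.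
by exists x; rewrite xi eqxx (leaf_deg xy).
Qed.

Lemma leaf_relabel H (p : {perm vertex n}) x y :
  leaf H x y -> leaf (relabel p H) (p x) (p y).
Proof. by rewrite /leaf nbhd_relabel => ->; rewrite imset_set1. Qed.

Lemma leaf_relabelV H (p : {perm vertex n}) x y :
  leaf (relabel p H) x y -> leaf H (p^-1%g x) (p^-1%g y).
Proof. by move/(leaf_relabel p^-1); rewrite relabelK. Qed.

Lemma leaf_at_relabel H s (i : 'I_4) : has_leaf_in H i ->
  leaf_at (relabel (part_perm n s) H) (s i).
Proof.
case/has_leaf_inP=> x [y [xi xy]]; exists (part_perm n s x), (part_perm n s y).
by split; [rewrite part_permE xi | apply: leaf_relabel].
Qed.

Lemma part_relabelV H s v z :
  leaf (relabel (part_perm n s) H) v z -> exists2 i, has_leaf_in H i & s i = v.1.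
Proof.
move/leaf_relabelV => l; exists ((part_perm n s)^-1%g v).1.
  by apply/has_leaf_inP; exists ((part_perm n s)^-1%g v), ((part_perm n s)^-1%g z).
by rewrite -[in RHS](permKV (part_perm n s) v) part_permE.
Qed.

(** The edge number is kept together with the family, so that one classification gives the lower
    bound, the value for the families and the list of extremal graphs. *)
Definition has_extremal_iso H :=
  2 * #|H| = 10 * n - 2 /\ exists2 G, extremal G & iso_in (K4 n) H G.

Lemma has_extremal_iso_relabel H s :
  has_extremal_iso (relabel (part_perm n s) H) -> has_extremal_iso H.
Proof.
case; rewrite card_relabel => cH [G extG isoG]; split=> //; exists G => //.
exact: iso_trans (iso_part_perm s H) isoG.
Qed.

Lemma extremal_has_iso H : 2 * #|H| = 10 * n - 2 -> extremal H -> has_extremal_iso H.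
Proof. by move=> cH extH; split=> //; exists H => //; apply: iso_refl. Qed.

(** If the triangle meets the first part, it also meets the fourth, so the part [r] that it misses
    is one of the middle two. Exchanging the first part with [r] permutes the three parts with
    leaves among themselves. *)
Lemma three_parts_extremal H : saturated (K4 n) C4 H -> 2 * #|H| <= 10 * n - 2 ->
  (forall a : 'I_3, leaf_at H a) -> has_extremal_iso H.
Proof.
move=> satH small leaves.
have /fin_all_exists[f fP] : forall a : 'I_3, exists f : vertex n * vertex n,
    (f.1.1 : nat) = a /\ leaf H f.1 f.2.
  by move=> a; have [x [y xy]] := leaves a; exists (x, y).
pose x a := (f a).1; pose y a := (f a).2.
have xy a : leaf H (x a) (y a) by have [] := fP a.
have xp a : (x a).1 = a :> nat by have [] := fP a.
have yy := adj_yy satH xy xp.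
have [i /eqP i3] := y_in4 satH xy xp small hn.
have [no0|] := boolP [forall j, ((y j).1 : nat) != 0].
  apply: extremal_has_iso; first exact: (card_H satH xy xp small hn).
  constructor 1; apply: (three_parts_family1 satH xy xp small hn) => j.
  by move/forallP/(_ j)/eqP: no0.
case/forallPn=> j; rewrite negbK => /eqP j0.
have ij : i != j by apply: contra_eq_neq i3 => ->; rewrite j0.
have [k [ki kj]] := third ij.
have ypart p q : p != q -> ((y p).1 : nat) != (y q).1.
  by move=> /yy/(adj_part satH); rewrite -val_eqE.
have [r r12 nr] : exists2 r : 'I_4, 0 < r < 3 & forall a, (y a).1 != r.
  have rP (r : 'I_4) : 0 < r < 3 -> ((y k).1 : nat) != r -> forall a, (y a).1 != r.
    move=> r12 kr a; rewrite -val_eqE /=.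
    have [->|ai] := eqVneq a i; first by rewrite i3; case: (r : nat) r12 => [|[|[|[|]]]].
    have [->|aj] := eqVneq a j; first by rewrite j0; case: (r : nat) r12.
    suff -> : a = k by [].
    apply: val_inj; move: ai aj ki kj ij (ltn_ord a) (ltn_ord i) (ltn_ord j) (ltn_ord k).
    by rewrite -!val_eqE /=; clear; lia.
  have := ypart k i ki; have := ypart k j kj; rewrite i3 j0.
  have := ltn_ord (y k).1; case E: ((y k).1 : nat) => [|[|[|[|]]]] // _ _ _.
    by exists (inord 2); [rewrite inordK | apply: rP; rewrite ?inordK ?E].
  by exists (inord 1); [rewrite inordK | apply: rP; rewrite ?inordK ?E].
have r0 : r != ord0 by rewrite -val_eqE /= -lt0n; case/andP: r12.
pose s := tperm ord0 r; apply: (@has_extremal_iso_relabel H s).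
have lt3 (a : 'I_3) : (s (inord a) : nat) < 3.
  rewrite /s; case: tpermP => [_|_|_ _]; rewrite ?inordK //.
    by case/andP: r12.
  exact: ltn_trans (ltn_ord a) _.
(* The triangle is renumbered along with the parts, so that the leaf with index [a] is again in part
   [a]. *)
pose t a : 'I_3 := Ordinal (lt3 a).
have tE a : s (x (t a)).1 = a :> nat.
  have -> : (x (t a)).1 = s (inord a) by apply: val_inj; rewrite /= xp.
  by rewrite tpermK inordK // (ltn_trans (ltn_ord a)).
pose x' a := part_perm n s (x (t a)); pose y' a := part_perm n s (y (t a)).
have xy' a : leaf (relabel (part_perm n s) H) (x' a) (y' a) by apply: leaf_relabel.
have xp' a : (x' a).1 = a :> nat by rewrite /x' part_permE tE.
have satH' := sat_part_perm s satH.
have small' : 2 * #|relabel (part_perm n s) H| <= 10 * n - 2 by rewrite card_relabel.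
apply: extremal_has_iso; first exact: (card_H satH' xy' xp' small' hn).
constructor 1; apply: (three_parts_family1 satH' xy' xp' small' hn) => b.
rewrite /y' part_permE /= => /(@val_inj _ _ 'I_4 _ ord0) sy.
have := nr (t b); have : s (s (y (t b)).1) = s ord0 by rewrite sy.
by rewrite tpermK tpermL => ->; rewrite eqxx.
Qed.

(** A hub in the first part is moved to the second by a transposition, under which the hypotheses on
    the leaves are symmetric. *)
Lemma two_parts_extremal H : saturated (K4 n) C4 H -> 2 * #|H| <= 10 * n - 2 ->
  leaf_at H 0 -> leaf_at H 1 -> (forall v, 1 < (v.1 : nat) -> forall z, ~ leaf H v z) ->
  has_extremal_iso H.
Proof.
have data G : leaf_at G 0 -> leaf_at G 1 -> exists x y : bool -> vertex n,
    (forall b, leaf G (x b) (y b)) /\ (forall b, (x b).1 = b :> nat).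
  move=> [x0 [y0 [x00 l0]]] [x1 [y1 [x11 l1]]].
  by exists (fun b : bool => if b then x1 else x0), (fun b : bool => if b then y1 else y0);
    split=> -[].
move=> satH small l0 l1 NL; have [x [y [xy xp]]] := data H l0 l1.
have cH := card_H2 satH xy xp NL small hn.
case: (two_parts satH xy xp NL small hn) => [f4|hub0|hub1]; first last.
- apply: extremal_has_iso => //.
  by case: (hub_families satH xy xp NL small hn hub1); [constructor 2 | constructor 3].
- pose s : {perm 'I_4} := tperm ord0 (inord 1); apply: (@has_extremal_iso_relabel H s).
  have s0 : s ord0 = 1 :> nat by rewrite tpermL inordK.
  have s1 : s (inord 1) = 0 :> nat by rewrite tpermR.
  have lp k : leaf_at H k -> has_leaf_in H (inord k).
    move=> [u [z [uk uz]]]; apply/has_leaf_inP; exists u, z; split=> //.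
    by rewrite -uk inord_val.
  have i0 : inord 0 = ord0 :> 'I_4 by apply: val_inj; rewrite /= inordK.
  have l0' := leaf_at_relabel s (lp 1 l1); rewrite s1 in l0'.
  have l1' := leaf_at_relabel s (lp 0 l0); rewrite i0 s0 in l1'.
  have sQ (i : 'I_4) : 1 < (s i : nat) -> 1 < (i : nat).
    by rewrite /s; case: tpermP => [->|->|//]; rewrite /= inordK.
  have NL' v : 1 < (v.1 : nat) -> forall z, ~ leaf (relabel (part_perm n s) H) v z.
    move=> vQ z /part_relabelV[i /has_leaf_inP[u [w [ui uw]]] iv].
    by apply: (NL u _ w uw); rewrite ui; apply: sQ; rewrite iv.
  have satH' := sat_part_perm s satH.
  have small' : 2 * #|relabel (part_perm n s) H| <= 10 * n - 2 by rewrite card_relabel.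
  have [x' [y' [xy' xp']]] := data _ l0' l1'.
  have hub1 : hub (relabel (part_perm n s) H) 1.
    case: hub0 => h [h0 hE]; exists (part_perm n s h); split.
      have -> : h = (ord0, h.2) by case: h h0 {hE} => i a h0; congr (_, _); apply: val_inj.
      by rewrite part_permE /= s0.
    move=> v vQ; rewrite -(permKV (part_perm n s) v) adj_relabel; apply: hE.
    by apply: sQ; rewrite -(permKV (part_perm n s) v) part_permE in vQ.
  apply: extremal_has_iso; first by rewrite card_relabel.
  by case: (hub_families satH' xy' xp' NL' small' hn hub1); [constructor 2 | constructor 3].
by apply: extremal_has_iso => //; constructor 4.
Qed.

Lemma small_saturated H : saturated (K4 n) C4 H -> 2 * #|H| <= 10 * n - 2 ->
  has_extremal_iso H.
Proof.
move=> satH small.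
have [i iL|no1] := pickP (has_leaf_in H); last first.
  have := no_leaf_bound hn satH; rewrite ltnNge small => /(_ _)/negP[] // v z vz.
  by have /has_leaf_inP[] := no1 v.1; exists v, z.
have [j /andP[jL ji]|no2] := pickP (fun j => has_leaf_in H j && (j != i)); last first.
  have [x [y [xi xy]]] := has_leaf_inP _ _ iL.
  have := one_part_leaves satH hn xy xi; rewrite ltnNge small => /(_ _)/negP[] //.
  move=> v vi z vz; have := no2 v.1; rewrite vi andbT => /has_leaf_inP[].
  by exists v, z.
have sat_rel s := sat_part_perm s satH.
have small_rel s : 2 * #|relabel (part_perm n s) H| <= 10 * n - 2.
  by rewrite card_relabel.
have [k /and3P[kL ki kj]|no3] := pickP (fun k => [&& has_leaf_in H k, k != i & k != j]).
  have us : uniq [:: i; j; k] by rewrite /= !inE negb_or eq_sym ji eq_sym ki eq_sym kj.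
  have [s sE] := perm_parts us; apply: (@has_extremal_iso_relabel H s).
  apply: three_parts_extremal => // a.
  have [b bL ba] : exists2 b, has_leaf_in H b & s b = a :> nat.
    have bs : nth i [:: i; j; k] a \in [:: i; j; k] by rewrite mem_nth.
    exists (nth i [:: i; j; k] a); last by rewrite sE // index_uniq.
    by move: bs; rewrite !inE => /or3P[]/eqP->.
  by have := leaf_at_relabel s bL; rewrite ba.
have us : uniq [:: i; j] by rewrite /= inE eq_sym ji.
have [s sE] := perm_parts us; apply: (@has_extremal_iso_relabel H s).
have si : s i = 0 :> nat by rewrite sE ?inE ?eqxx //= eqxx.
have sj : s j = 1 :> nat by rewrite sE ?inE ?eqxx ?orbT //= eq_sym (negPf ji) eqxx.
apply: two_parts_extremal => //.
- by have := leaf_at_relabel s iL; rewrite si.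
- by have := leaf_at_relabel s jL; rewrite sj.
move=> v vQ z /part_relabelV[b bL bv]; have := no3 b; rewrite bL /= -bv in vQ *.
by have [bi|_] := eqVneq b i; [rewrite bi si in vQ | have [bj|//] := eqVneq b j; rewrite bj sj in vQ].
Qed.

End Classification.

(** * An explicit graph of the second family *)

Section Example.

Variable n : nat.
Hypothesis n_gt0 : 0 < n.
Implicit Types u v : vertex n.

Let i0 : 'I_n := Ordinal n_gt0.
Let y : vertex n := (Ordinal (isT : 1 < 4), i0).
Let z : vertex n := (ord0, i0).

(** Edges of a witness that saturated graphs exist, without which [sat] would only be its default
    value: [y] is joined to the three other parts, the last two parts are matched by second
    coordinates, and the rest of the part of [y] hangs from [z]. *)
Let rel0 u v := [|| (u == y) && (v.1 != y.1),
  [&& (u.1 : nat) == 2, (v.1 : nat) == 3 & u.2 == v.2]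
  | [&& u.1 == y.1, u != y & v == z]].

Definition example : graph (vertex n) :=
  [set [set p.1; p.2] | p : vertex n * vertex n & rel0 p.1 p.2].

Lemma adj_example u v : adj example u v = rel0 u v || rel0 v u.
Proof.
apply/imsetP/orP => [[[a b]]|[uv|vu]].
- by rewrite inE /= => ab /set2_inj[[-> ->]|[-> ->]]; [left | right].
- by exists (u, v); rewrite ?inE.
by exists (v, u); rewrite ?inE // setUC.
Qed.

Lemma rel0_part u v : rel0 u v -> u.1 != v.1.
Proof.
case/or3P=> [/andP[/eqP->]|/and3P[/eqP u2 /eqP v3 _]|/and3P[/eqP-> _ /eqP->]] //.
  by rewrite eq_sym.
by rewrite -val_eqE /= u2 v3.
Qed.

Lemma example_sub : example \subset K4 n.
Proof.
apply/subsetP => e /imsetP[[u v]]; rewrite inE /= => uv ->.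
by have := adj_K4 u v; rewrite rel0_part.
Qed.

Lemma example_family2 : family2 example.
Proof.
split; first exact: example_sub.
exists y; first by rewrite in_V.
have y1 u : (u.1 == y.1) = ((u.1 : nat) == 1) by rewrite -val_eqE.
have zP : z.1 = 0 :> nat by [].
split.
- apply/setP => v; rewrite in_nbhd in_V134 -y1 adj_example.
  apply/idP/idP => [/orP[]/rel0_part //|vy]; first by rewrite eq_sym.
  by apply/orP; left; apply/or3P; constructor 1; rewrite vy andbT.
- apply/one_regular_onP => v; rewrite in_VQ => vQ.
  have nvy u : 1 < (u.1 : nat) -> (u == y) = false by apply: contraTF => /eqP->.
  have nvz u : 1 < (u.1 : nat) -> (u == z) = false by apply: contraTF => /eqP->.
  (* [5 - k] exchanges the indices 2 and 3 of the last two parts. *)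
  pose w : vertex n := (inord (5 - v.1), v.2); have v4 := ltn_ord v.1.
  exists w; apply/setP => u; rewrite in_setI in_nbhd in_VQ in_set1 adj_example.
  have w1 : w.1 = 5 - v.1 :> nat by rewrite inordK //; case: (v.1 : nat) vQ => [|[|k]] // _; apply: leq_subr.
  apply/andP/eqP => [[]|->].
    rewrite /rel0 !y1 => + uQ; rewrite !nvy // !nvz // !andbF !orbF.
    case: u uQ => i a /= iQ; rewrite /w; case/orP=> /and3P[/eqP e1 /eqP e2 /eqP e3].
      by rewrite -e3 e1; congr (_, _); apply: val_inj; rewrite /= e2 inordK.
    by rewrite e3 e2; congr (_, _); apply: val_inj; rewrite /= e1 inordK.
  rewrite w1; move: vQ v4; case E: (v.1 : nat) => [|[|[|[|k]]]] // _ _; split=> //.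
    by rewrite /rel0 w1 E !eqxx !orbT.
  by rewrite /rel0 w1 E !eqxx !orbT.
- move=> u; rewrite in_setD1 in_V => /andP[nuy u1].
  have Nu : nbhd example u = [set z].
    apply/setP => v; rewrite in_nbhd in_set1 adj_example; apply/orP/eqP => [[]|->].
    + case/or3P=> [/andP[uy]|/and3P[u2]|/and3P[_ _ /eqP]] //.
        by rewrite uy in nuy.
      by rewrite (eqP u1) in u2.
    + case/or3P=> [/andP[_]|/and3P[_ u3]|/and3P[_ _ /eqP uz]] //.
        by rewrite y1 u1.
        by rewrite (eqP u1) in u3.
      by rewrite uz in u1.
    by left; rewrite /rel0 !y1 u1 nuy eqxx !orbT.
  by rewrite /deg Nu cards1 sub1set in_V134.
move=> u v; rewrite in_V in_VQ => /eqP u0 vQ; rewrite adj_example /rel0 !y1 u0 /=.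
have nuy : (u == y) = false by apply: contra_eqF u0 => /eqP->.
have nvy : (v == y) = false by apply: contraTF vQ => /eqP->.
have v1 : (v.1 : nat) == 1 = false by apply: contraTF vQ => /eqP->.
by rewrite nuy nvy v1 !andbF.
Qed.

End Example.

Theorem theorem2p2 (n : nat) (hn : 2 <= n) :
  sat (K4 n) C4 = 5 * n - 1 /\
  forall H : graph (vertex n),
    H \in Sat (K4 n) C4 <->
    exists2 G : graph (vertex n), extremal G & iso_in (K4 n) H G.
Proof.
have n0 : 0 < n by apply: leq_trans hn.
have ext_card G : extremal G -> saturated (K4 n) C4 G /\ #|G| = 5 * n - 1.
  move=> extG; have sGK : G \subset K4 n by case: extG => -[].
  have [satG small] := extremal_saturated hn sGK extG; split=> //.
  (* The upper bound on the edges becomes exact by classifying the saturated graph [G] again. *)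
  have [cG _] := small_saturated hn satG small.
  by move: cG hn; clear; move: #|G| => k; lia.
have [satE cE] : saturated (K4 n) C4 (example n0) /\ #|example n0| = 5 * n - 1.
  by apply: ext_card; constructor 2; apply: example_family2.
have satn : sat (K4 n) C4 = 5 * n - 1.
  have le_sat := sat_le satE; rewrite cE in le_sat.
  have [K satK cK] := sat_attained satE; rewrite -cK in le_sat *.
  have small : 2 * #|K| <= 10 * n - 2 by move: le_sat; clear; move: #|K| => k; lia.
  have [cK' _] := small_saturated hn satK small.
  by move: cK' hn; clear; move: #|K| => k; lia.
split=> // H; rewrite inE satn; split=> [/andP[satH /eqP cH]|[G extG isoG]].
  have small : 2 * #|H| <= 10 * n - 2 by rewrite cH; clear; lia.
  by have [_] := small_saturated hn satH small.
have [satG cG] := ext_card G extG.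
by have [-> ->] := iso_sat isoG satG; rewrite cG eqxx.
Qed.
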